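(* Let $p,q\in[1,\infty)$, $\alpha\in\mathbb{R}$, and $\alpha_0:=n\left(\frac1q-\frac1p\right)$. (i) If $\alpha_0<0$, then $JNQ^{\alpha}_{p,q}(\mathbb{R}^n)=\{0\}$. (ii) If $\alpha_0=0$, then $JNQ^{\alpha}_{p,q}(\mathbb{R}^n)=JN^{\mathrm{con}}_{p,p}(\mathbb{R}^n)$ when $\alpha\in(-\infty,0)$, and $JNQ^{\alpha}_{p,q}(\mathbb{R}^n)=\{0\}$ when $\alpha\in[0,\infty)$. (iii) If $\alpha_0\in(0,1)$, then $JNQ^{\alpha}_{p,q}(\mathbb{R}^n)=JN^{\mathrm{con}}_{p,q}(\mathbb{R}^n)$ when $\alpha\in(-\infty,0)$; $JNQ^{\alpha}_{p,q}(\mathbb{R}^n)\supset W^{\alpha_0,q}(\mathbb{R}^n)$ when $\alpha\in[0,\alpha_0]$; and $JNQ^{\alpha}_{p,q}(\mathbb{R}^n)=\{0\}$ when $\alpha\in(\alpha_0,\infty)$. (iv) If $\alpha_0\in[1,\infty)$, then $JNQ^{\alpha}_{p,q}(\mathbb{R}^n)=JN^{\mathrm{con}}_{p,q}(\mathbb{R}^n)$ when $\alpha\in(-\infty,0)$; $JNQ^{\alpha}_{p,q}(\mathbb{R}^n)\supset \dot W^{1,(\frac1p+\frac1n)^{-1}}(\mathbb{R}^n)$ when $\alpha\in[0,1)$; and $JNQ^{\alpha}_{p,q}(\mathbb{R}^n)=\{0\}$ when $\alpha\in[1,\infty)$.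
   Context: Here $n\in\mathbb{N}$, $n\ge1$. A measurable function $f$ on $\mathbb{R}^n$ is a Lebesgue measurable function with $|f|<\infty$ almost everywhere. A cube has finite positive edge length and all its edges parallel to the coordinate axes, and need not be open or closed. For $\ell\in(0,\infty)$, $\Pi_\ell$ is the class of all collections $\{Q_j\}_j$ of cubes of $\mathbb{R}^n$ with pairwise disjoint interiors and equal edge length $\ell$. For a bounded measurable set $E$ with $|E|>0$, $f_E:=\frac1{|E|}\int_E f\,dy$. For $p,q\in[1,\infty)$ and $\alpha\in\mathbb{R}$, the space $JNQ^{\alpha}_{p,q}(\mathbb{R}^n)$ is the set of all measurable $f$ on $\mathbb{R}^n$ with $$\|f\|_{JNQ^\alpha_{p,q}(\mathbb{R}^n)}:=\sup_{\ell\in(0,\infty),\,\{Q_j\}_j\in\Pi_\ell}\Big\{\sum_j|Q_j|\Big[|Q_j|^{\frac{q\alpha}{n}-1}\int_{Q_j}\int_{Q_j}\frac{|f(x)-f(y)|^q}{|x-y|^{n+q\alpha}}\,dy\,dx\Big]^{p/q}\Big\}^{1/p}<\infty.$$ The space $JN^{\mathrm{con}}_{p,q}(\mathbb{R}^n)$ is the set of all $f\in L^1_{\mathrm{loc}}(\mathbb{R}^n)$ with $$\|f\|_{JN^{\mathrm{con}}_{p,q}(\mathbb{R}^n)}:=\sup_{\ell\in(0,\infty),\,\{Q_j\}_j\in\Pi_\ell}\Big\{\sum_j|Q_j|\Big[\frac1{|Q_j|}\int_{Q_j}|f(x)-f_{Q_j}|^q\,dx\Big]^{p/q}\Big\}^{1/p}<\infty.$$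 For $s\in\mathbb{R}$ and $p\in[1,\infty)$, $W^{s,p}(\mathbb{R}^n)$ is the set of all measurable $f$ on $\mathbb{R}^n$ with $\|f\|_{W^{s,p}(\mathbb{R}^n)}:=\big[\int_{\mathbb{R}^n}\int_{\mathbb{R}^n}\frac{|f(x)-f(y)|^p}{|x-y|^{n+sp}}\,dx\,dy\big]^{1/p}<\infty$. For $\gamma\in(0,\infty)$, $\dot W^{1,\gamma}(\mathbb{R}^n)$ is the set of all weakly differentiable $f$ on $\mathbb{R}^n$ with $\|f\|_{\dot W^{1,\gamma}(\mathbb{R}^n)}:=\big[\int_{\mathbb{R}^n}|\nabla f(x)|^\gamma\,dx\big]^{1/\gamma}<\infty$. These are regarded as function spaces modulo constants, and $\{0\}$ denotes the set of functions that are constant almost everywhere. *)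

(* Defs.v *)
From HB Require Import structures.
From mathcomp Require Import all_boot all_order all_algebra.
From mathcomp Require Import all_classical all_reals all_analysis.
From mathcomp Require Import measurable_realfun.
Set Implicit Arguments.
Unset Strict Implicit.
Unset Printing Implicit Defensive.
Import Order.TTheory GRing.Theory Num.Theory.
Import numFieldNormedType.Exports.
Local Open Scope classical_set_scope.
Local Open Scope ring_scope.

(* An alias carrying the Borel (product) sigma-algebra: 'rV[R]_n itself gets no
   measurable structure, so that the completed one below is never shadowed. *)
Definition borel_rV (R : realType) (n : nat) : Type := 'rV[R]_n.

Definition borel_rV_display : measure_display.
Proof. exact: default_measure_display. Qed.

Section borel_rV.
Context (R : realType) (n : nat).

Definition borel_rV_coord (i : 'I_n) (x : borel_rV R n) : measurableTypeR R :=
  (x : 'rV[R]_n) ord0 i.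

Let borel_rV0 : g_sigma_preimage borel_rV_coord set0.
Proof. exact: sigma_algebra0. Qed.

Let borel_rVC A :
  g_sigma_preimage borel_rV_coord A -> g_sigma_preimage borel_rV_coord (~` A).
Proof. exact: sigma_algebraC. Qed.

Let borel_rV_bigcup (F : (set (borel_rV R n))^nat) :
  (forall i, g_sigma_preimage borel_rV_coord (F i)) ->
  g_sigma_preimage borel_rV_coord (\bigcup_i (F i)).
Proof. exact: sigma_algebra_bigcup. Qed.

HB.instance Definition _ := Pointed.copy (borel_rV R n) 'rV[R]_n.
HB.instance Definition _ := @isMeasurable.Build borel_rV_display (borel_rV R n)
  (g_sigma_preimage borel_rV_coord) borel_rV0 borel_rVC borel_rV_bigcup.

Lemma measurable_borel_rV_coord i :
  measurable_fun [set: borel_rV R n] (borel_rV_coord i).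
Proof.
move=> _ Y mY; rewrite setTI; apply: sub_sigma_algebra => /=.
rewrite -bigcup_seq/=; exists i => /=; first by rewrite mem_index_enum.
by exists Y => //; rewrite setTI.
Qed.

Lemma measurable_fun_borel_rV d (T : measurableType d) (f : T -> borel_rV R n) :
  (forall i, measurable_fun [set: T] (borel_rV_coord i \o f)) ->
  measurable_fun [set: T] f.
Proof.
move=> mf _ A mA; rewrite setTI.
have : preimage_set_system [set: T] f (g_sigma_preimage borel_rV_coord)
    `<=` measurable.
  rewrite -g_sigma_preimage_comp; apply: smallest_sub.
    exact: sigma_algebra_measurable.
  rewrite -bigcup_seq; apply: bigcup_sub => i _ B [C mC <-].
  exact: mf.
by apply; exists A => //; rewrite setTI.
Qed.

End borel_rV.

Section borel_lebesgue.
Context (R : realType).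

Definition borel_rV_cons n (z : measurableTypeR R * borel_rV R n) :
  borel_rV R n.+1 := row_mx z.1%:M (z.2 : 'rV[R]_n) : 'rV[R]_(1 + n).

Lemma measurable_borel_rV_cons n : measurable_fun setT (@borel_rV_cons n).
Proof.
apply: measurable_fun_borel_rV => i.
have [j ->|j ->] := @fintype.split_ordP 1 n i.
  apply: (eq_measurable_fun fst) => // z _.
  by rewrite /= /borel_rV_coord (@row_mxEl _ 1 1 n) !ord1 mxE eqxx.
apply: (eq_measurable_fun (borel_rV_coord j \o snd)) => [z _|].
  by rewrite /= /borel_rV_coord (@row_mxEr _ 1 1 n).
apply: measurableT_comp => //; exact: measurable_borel_rV_coord.
Qed.

Let uncons n (x : borel_rV R n.+1) : measurableTypeR R * borel_rV R n :=
  (borel_rV_coord ord0 x, rsubmx (x : 'rV[R]_(1 + n))).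

Let measurable_uncons n : measurable_fun setT (@uncons n).
Proof.
apply: measurable_fun_pair; first exact: measurable_borel_rV_coord.
apply: measurable_fun_borel_rV => i.
apply: (eq_measurable_fun (borel_rV_coord (rshift 1 i))) => [x _|].
  by rewrite /= /borel_rV_coord mxE.
exact: measurable_borel_rV_coord.
Qed.

Let consK n : cancel (@borel_rV_cons n) (@uncons n).
Proof.
move=> [a v]; rewrite /uncons /borel_rV_cons row_mxKr; congr pair.
have -> : ord0 = @lshift 1 n ord0 by exact/val_inj.
by rewrite /borel_rV_coord (@row_mxEl _ 1 1 n) mxE eqxx.
Qed.

Section step.
Context (n : nat) (mu : {sigma_finite_measure set (borel_rV R n) -> \bar R}).

Definition borel_lebesgue_step : set (borel_rV R n.+1) -> \bar R :=
  pushforward (lebesgue_measure \x mu)%E (@borel_rV_cons n).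

HB.instance Definition _ := Measure.copy borel_lebesgue_step
  (measure_function_pushforward__canonical__measure_function_Measure
    (lebesgue_measure \x mu)%E (@measurable_borel_rV_cons n)).

Let borel_lebesgue_step_sigma_finite : sigma_finite setT borel_lebesgue_step.
Proof.
have /sigma_finiteP[F [FT ndF Foo]] :=
  sigma_finiteT (@lebesgue_measure R : set (measurableTypeR R) -> \bar R).
have /sigma_finiteP[G [GT ndG Goo]] := sigma_finiteT mu.
exists (fun k => @uncons n @^-1` (F k `*` G k)) => [|k].
  rewrite -preimage_bigcup (_ : \bigcup_k _ = setT) ?preimage_setT//.
  apply/seteqP; split => // -[x y] _.
  have [i _ Fix] : (\bigcup_k F k) x by rewrite -FT.
  have [j _ Gjy] : (\bigcup_k G k) y by rewrite -GT.
  exists (maxn i j) => //; split.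
    by move: x Fix; exact/subsetPset/ndF/leq_maxl.
  by move: y Gjy; exact/subsetPset/ndG/leq_maxr.
have [[mF Fk] [mG Gk]] := (Foo k, Goo k); split.
  rewrite -[X in measurable X]setTI; apply: measurable_uncons => //.
  exact: measurableX.
rewrite /borel_lebesgue_step /pushforward -comp_preimage.
rewrite (_ : _ \o _ = id); last by apply/funext => z; exact: consK.
by rewrite preimage_id product_measure1E// lte_mul_pinfty// ge0_fin_numE.
Qed.

HB.instance Definition _ := Measure_isSigmaFinite.Build _ _ _
  borel_lebesgue_step borel_lebesgue_step_sigma_finite.

End step.

Fixpoint borel_lebesgue (n : nat) :
    {sigma_finite_measure set (borel_rV R n) -> \bar R} :=
  match n with
  | 0 => dirac (point : borel_rV R 0)
  | m.+1 => borel_lebesgue_step (borel_lebesgue m)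
  end.
End borel_lebesgue.

Section lebesgue_rV.
Context (R : realType).
Local Open Scope ereal_scope.

(* The complete Lebesgue measure on R^n: its sigma-algebra is that of the
   Lebesgue measurable sets. *)
Definition lebesgue_rV (n : nat) :=
  @completed_measure_extension _ _ _ (borel_lebesgue R n).

HB.instance Definition _ n := Measure.on (@lebesgue_rV n).

Lemma measurable_borel_rV_box n (A : 'I_n -> set R) :
  (forall i, measurable (A i : set (measurableTypeR R))) ->
  measurable ([set x | forall i, A i (x ord0 i)] : set (borel_rV R n)).
Proof.
move=> mA.
rewrite [X in measurable X](_ : _ =
    \bigcap_(i in [set: 'I_n]) (@borel_rV_coord R n i @^-1` A i)); last first.
  by apply/seteqP; split => x /= Ax i; [move=> _|]; exact: Ax.
apply: fin_bigcap_measurable => // i _; rewrite -[X in measurable X]setTI.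
exact: measurable_borel_rV_coord.
Qed.

Lemma borel_lebesgue_box n (A : 'I_n -> set R) :
  (forall i, measurable (A i : set (measurableTypeR R))) ->
  borel_lebesgue R n [set x | forall i, A i (x ord0 i)] =
  \prod_(i < n) lebesgue_measure (A i).
Proof.
elim: n A => [A _|n IH A mA].
  by rewrite big_ord0 /= diracE mem_set// => -[].
rewrite /= /borel_lebesgue_step /pushforward big_ord_recl.
rewrite -(IH (fun i => A (lift ord0 i))) => [|i]; last exact: mA.
rewrite -product_measure1E//; last first.
  by apply: (@measurable_borel_rV_box n (fun i => A (lift ord0 i))) => i; exact: mA.
congr product_measure1; apply/seteqP; split => -[a v] /=.
  move=> Av; split.
    have := Av ord0; rewrite (_ : ord0 = @lshift 1 n ord0); last exact/val_inj.
    by rewrite (@row_mxEl _ 1 1 n) mxE eqxx.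
  move=> i; have := Av (lift ord0 i).
  rewrite [X in _ X](_ : _ = v ord0 i)// -(@row_mxEr _ 1 1 n a%:M v).
  by congr (fun_of_matrix _ _ _); exact/val_inj.
move=> [Aa Av] i; have [j ij|j ij] := @fintype.split_ordP 1 n i.
  have i0 : i = ord0 by rewrite ij !ord1; exact/val_inj.
  rewrite [X in _ X](_ : _ = a); first by rewrite i0.
  by rewrite ij (@row_mxEl _ 1 1 n) !ord1 mxE eqxx.
rewrite ij [X in _ X](@row_mxEr _ 1 1 n a%:M v).
by rewrite (_ : rshift 1 j = lift ord0 j)//; exact/val_inj.
Qed.

Lemma lebesgue_rV_box n (A : 'I_n -> set R) :
  (forall i, measurable (A i : set (measurableTypeR R))) ->
  lebesgue_rV [set x : 'rV[R]_n | forall i, A i (x ord0 i)] =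
  \prod_(i < n) lebesgue_measure (A i).
Proof.
move=> mA; rewrite -borel_lebesgue_box//.
by apply: measurable_mu_extE; exact: measurable_borel_rV_box.
Qed.

End lebesgue_rV.
Arguments lebesgue_rV : clear implicits.

(* 'rV[R]_n with the Lebesgue sigma-algebra *)
Notation lebesgue_rV_type R n :=
  (caratheodory_type (mu_ext (borel_lebesgue R n))).

Section spaces.
Context (R : realType) (n : nat).
Implicit Types (f : 'rV[R]_n -> \bar R) (Q : set 'rV[R]_n) (l p q s : R).
Local Open Scope ereal_scope.
Local Notation vol := (lebesgue_rV R n).

(* the norm `|x| of 'rV[R]_n in the library is the sup norm *)
Definition euclid_norm (x : 'rV[R]_n) : R :=
  Num.sqrt (\sum_(i < n) x ord0 i ^+ 2)%R.

Definition ae_finite_measurable f : Prop :=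
  measurable_fun setT (f : lebesgue_rV_type R n -> \bar R) /\
  {ae vol, forall x, f x \is a fin_num}.

Definition ae_constant : set ('rV[R]_n -> \bar R) :=
  [set f | exists c : R, {ae vol, forall x, f x = c%:E}].

(* products of n intervals of length l, each end being open or closed *)
Definition cube l : set (set 'rV[R]_n) :=
  [set Q | exists (a : 'rV[R]_n) (b c : 'I_n -> bool),
     Q = [set x : 'rV[R]_n | forall i, x ord0 i \in
       Interval (BSide (b i) (a ord0 i)) (BSide (c i) (a ord0 i + l)%R)]].

Definition cube_collection l : set (set (set 'rV[R]_n)) :=
  [set C | C `<=` cube l /\ trivIset C (@interior 'rV[R]_n)].

Definition sup_over_cubes p (F : set 'rV[R]_n -> \bar R) : \bar R :=
  ereal_sup [set v | exists l (C : set (set 'rV[R]_n)),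
    [/\ (0 < l)%R, cube_collection l C &
        v = (\esum_(Q in C) (vol Q * F Q)) `^ p^-1]].

Definition gagliardo s q f (A : set 'rV[R]_n) : \bar R :=
  \int[vol]_(x in A) \int[vol]_(y in A)
    (`|f x - f y| `^ q / (euclid_norm (x - y) `^ (n%:R + s * q))%:E).

Definition JNQ_norm p q alpha f : \bar R :=
  sup_over_cubes p (fun Q =>
    (vol Q `^ (q * alpha / n%:R - 1) * gagliardo alpha q f Q) `^ (p / q)).

Definition JNQ p q alpha : set ('rV[R]_n -> \bar R) :=
  [set f | ae_finite_measurable f /\ JNQ_norm p q alpha f < +oo].

Definition average f (E : set 'rV[R]_n) : \bar R :=
  (\int[vol]_(y in E) f y) / vol E.

Definition L1loc : set ('rV[R]_n -> \bar R) :=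
  [set f | ae_finite_measurable f /\
    forall K : set 'rV[R]_n, compact K -> \int[vol]_(x in K) `|f x| < +oo].

Definition JNcon_norm p q f : \bar R :=
  sup_over_cubes p (fun Q =>
    ((\int[vol]_(x in Q) (`|f x - average f Q| `^ q)) / vol Q) `^ (p / q)).

Definition JNcon p q : set ('rV[R]_n -> \bar R) :=
  [set f | L1loc f /\ JNcon_norm p q f < +oo].

Definition Ws_norm s p f : \bar R := gagliardo s p f setT `^ p^-1.

Definition Ws s p : set ('rV[R]_n -> \bar R) :=
  [set f | ae_finite_measurable f /\ Ws_norm s p f < +oo].

Definition partial (i : 'I_n) (phi : 'rV[R]_n -> R) : 'rV[R]_n -> R :=
  fun x => 'D_(delta_mx ord0 i) phi x.

Fixpoint C_k (k : nat) (phi : 'rV[R]_n -> R) : Prop :=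
  match k with
  | 0 => continuous phi
  | m.+1 => forall i : 'I_n,
      (forall x, derivable phi x (delta_mx ord0 i)) /\ C_k m (partial i phi)
  end.

Definition test_function (phi : 'rV[R]_n -> R) : Prop :=
  (forall k, C_k k phi) /\ compact (closure [set x | phi x != 0%R]).

Definition weak_gradient f (g : 'rV[R]_n -> 'rV[R]_n) : Prop :=
  forall i : 'I_n, L1loc (fun x => (g x ord0 i)%:E) /\
    forall phi, test_function phi ->
      \int[vol]_x (f x * (partial i phi x)%:E) =
      - \int[vol]_x (g x ord0 i * phi x)%:E.

(* The weak gradient is unique up to a null set, so that the norm does not
   depend on the choice of g. *)
Definition dotW1 gamma : set ('rV[R]_n -> \bar R) :=
  [set f | L1loc f /\ exists2 g, weak_gradient f g &
    (\int[vol]_x (euclid_norm (g x) `^ gamma)%:E) `^ gamma^-1 < +oo].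

End spaces.
Arguments ae_constant : clear implicits.
Arguments JNQ {R} n p q alpha.
Arguments JNcon {R} n p q.
Arguments Ws {R} n s p.
Arguments dotW1 {R} n gamma.

(* Main.v *)
Require Import Defs.
From HB Require Import structures.
From mathcomp Require Import all_boot all_order all_algebra.
From mathcomp Require Import all_classical all_reals all_analysis.
From mathcomp Require Import measurable_realfun lra ring zify.
Set Implicit Arguments.
Unset Strict Implicit.
Unset Printing Implicit Defensive.
Import Order.TTheory GRing.Theory Num.Theory.
Import numFieldNormedType.Exports.
Local Open Scope classical_set_scope.
Local Open Scope ring_scope.

(** Almost every value of f can be taken from a Borel function F, so the norms are studied
    through the energies G_s(Q), the integral of |F x - F y|^q |x - y|^-s over Q x Q, and the
    oscillation osc(Q), which is the case s = 0. On a cube of edge l the term of the JNQ sum is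
    l^(p (alpha - alpha0)) G_s(Q)^(p/q) with s = n + alpha q ([JNQ_term]), and a finite norm
    amounts to a uniform bound on finite sums of such terms ([JNQ_criterion]). In particular
    G_s(Q) <= M l^(q (alpha0 - alpha)) for every cube Q ([JNQ_energy_bound]).

    Two facts relate osc and G_s. Inserting a third point z into F x - F y and averaging over z
    compares oscillations on different cubes ([compare_osc]); choosing z far from both x and y
    gives osc(Q) <= C l^s G_s(Q) for every real s ([osc_le_diffq]).

    The space collapses to constants when osc vanishes on all cubes, for four reasons.
    - If alpha0 < 0, then osc(Q) = O(l^(n + q alpha0)), and a fixed cube K compared with a huge
      one has osc(K) = O(l^(q alpha0)) ([osc_eq0_of_large_cubes]).
    - If alpha > alpha0, then G_s(K) <= G_s(Q) for large Q, and G_s(Q) tends to 0.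
    - If alpha = alpha0 = 0, each dyadic shell around K contributes a fixed multiple of osc(K)
      to the bounded energies of order n ([osc_eq0_of_bounded_diffq]).
    - If alpha >= 1, the energy of order n + q on a cube is finite. Splitting F x - F y at the
      midpoint shows that pairs at distance less than r carry at most the energy of pairs at
      distance less than r / 2 ([near_diffq_halving]), so all of it concentrates on the
      diagonal, and there is none at positive distance ([osc_eq0_of_diffq_finite]).

    If alpha < 0, the kernel |x - y|^-s is locally integrable, and G_s(Q) is comparable, up to
    a power of l, to the q-th power integral of the deviation of F from its mean on Q
    ([diffq_le_average], [osc_ge_average]); the JNQ and JNcon sums are then comparable term by
    term. For alpha0 = 0 one has p = q, which accounts for JNcon p p.

    The inclusions rest on superadditivity of t^r for r >= 1. For W^(alpha0, q) the weight of a
    cube can be made 1 and energies over disjoint cubes add up to at most the energy of the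
    whole space. For the homogeneous Sobolev space, G_s(Q) <= C l^(q (1 - alpha)) times the
    integral of |grad f|^q over Q ([diffq_le_gradient]), and Hoelder's inequality with exponent
    gamma / q cancels the powers of l. The gradient estimate comes from testing the weak
    derivative against products of bumps, one factor of which is swept over [0, T]: in the
    limit one gets, almost everywhere, F (x + T e_i) - F x as the integral of the i-th
    derivative along the segment ([directional_increment]), and two points of a cube are joined
    inside the cube by a path parallel to the axes ([staircase]). *)

(** * Boxes and affine changes of variables *)

Section boxes.
Context (R : realType) (n : nat).
Implicit Types (u v x : 'rV[R]_n).
Local Open Scope ereal_scope.
Local Notation lam := (borel_lebesgue R n).

Definition obox u v : set 'rV[R]_n :=
  [set x | forall i, (u ord0 i < x ord0 i < v ord0 i)%R].

Lemma oboxE u v :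
  obox u v = [set x | forall i, (`]u ord0 i, v ord0 i[%classic : set R) (x ord0 i)].
Proof. by apply/seteqP; split => x xuv i; move: (xuv i); rewrite /= in_itv. Qed.

Lemma measurable_obox u v : measurable (obox u v : set (borel_rV R n)).
Proof.
rewrite oboxE.
by apply: (@measurable_borel_rV_box R n (fun i => `]u ord0 i, v ord0 i[%classic)) => i.
Qed.

Lemma lebesgue_obox u v :
  lam (obox u v) = (\prod_(i < n) Num.max 0 (v ord0 i - u ord0 i)%R)%:E.
Proof.
rewrite oboxE.
rewrite (borel_lebesgue_box (A := fun i => `]u ord0 i, v ord0 i[%classic)) => [|i]; last by [].
rewrite -prodEFin; apply: eq_bigr => i _.
by rewrite lebesgue_measure_itv/= lte_fin -subr_gt0 /Num.max; case: ifP.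
Qed.

Lemma lebesgue_obox_lty u v : lam (obox u v) < +oo.
Proof. by rewrite lebesgue_obox ltry. Qed.

Definition oboxes : set (set (borel_rV R n)) := [set A | exists u v, A = obox u v].

Lemma oboxes_setI : setI_closed oboxes.
Proof.
move=> _ _ [u [v ->]] [u' [v' ->]].
exists (\row_i Num.max (u ord0 i) (u' ord0 i)), (\row_i Num.min (v ord0 i) (v' ord0 i)).
apply/seteqP; split => [x [xuv xuv'] i|x xx].
  move: (xuv i) (xuv' i) => /andP[? ?] /andP[? ?].
  by rewrite !mxE gt_max lt_min; apply/andP; split; apply/andP.
split => i; move: (xx i); rewrite !mxE gt_max lt_min => /andP[/andP[? ?] /andP[? ?]];
  exact/andP.
Qed.

Definition centred_obox (r : R) : set 'rV[R]_n := obox (const_mx (- r)%R) (const_mx r).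

Lemma row_bounded (x : 'rV[R]_n) : exists k : nat, forall i, (`|x ord0 i| < k%:R)%R.
Proof.
exists (Num.truncn (\sum_i `|x ord0 i|)).+1 => i.
apply: le_lt_trans (truncnS_gt _).
by rewrite (bigD1 i)//= lerDl sumr_ge0.
Qed.

Lemma centred_obox_cover : \bigcup_(k : nat) (centred_obox k%:R) = setT.
Proof.
apply/seteqP; split => // x _; have [k xk] := row_bounded x; exists k => // i.
by rewrite !mxE -ltr_norml.
Qed.

(** A half-space x_i > a is the countable union of the boxes with lower corner a in
    coordinate i and -k in the others, and all upper corners k. *)
Lemma oboxes_generate : @measurable _ (borel_rV R n) = <<s oboxes >>.
Proof.
apply/seteqP; split; last first.
  apply: smallest_sub; first exact: sigma_algebra_measurable.
  by move=> _ [u [v ->]]; exact: measurable_obox.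
apply: smallest_sub; first exact: smallest_sigma_algebra.
rewrite -bigcup_seq; apply: bigcup_sub => i _ A [Y mY <-]; rewrite setTI.
have : measurable_fun setT
    (borel_rV_coord i : g_sigma_algebraType oboxes -> measurableTypeR R).
  apply: (measurability _ (@RGenOInfty.measurableE R)) => _ [_ [a ->] <-].
  rewrite setTI (_ : _ @^-1` _ = \bigcup_(k : nat)
      obox (\row_j (if j == i then a else - k%:R)%R) (const_mx k%:R)).
    apply: bigcupT_measurable => k; apply: sub_sigma_algebra.
    by eexists; eexists; reflexivity.
  apply/seteqP; split => [x /=|x [k _ xk] /=]; rewrite in_itv/= ?andbT.
    move=> ax; have [k xk] := row_bounded x; exists k => // j.
    have := xk j; rewrite !mxE ltr_norml => /andP[? ->]; rewrite andbT.
    by case: eqP => [->|].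
  by have := xk i; rewrite !mxE eqxx => /andP[].
by move/(_ measurableT Y mY); rewrite setTI.
Qed.

(** Boxes form a pi-system that generates the Borel sets and exhausts the space, so two
    measures are compared on boxes. This gives the change of variables below and, for measures
    with densities, the almost everywhere identity behind the gradient estimate. *)
Lemma measure_unique_obox (m1 m2 : {measure set (borel_rV R n) -> \bar R}) :
  (forall u v, m1 (obox u v) = m2 (obox u v)) ->
  (forall u v, m1 (obox u v) < +oo) ->
  forall A, measurable A -> m1 A = m2 A.
Proof.
move=> m12 m1oo; apply: (measure_unique oboxes (fun k : nat => centred_obox k%:R)).
- exact: oboxes_generate.
- exact: oboxes_setI.
- by move=> k; eexists; eexists; reflexivity.
- exact: centred_obox_cover.
- by move=> _ [u [v ->]]; exact: m12.
- by move=> k; exact: m1oo.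
Qed.

Lemma measurable_fun_affine (c : R) (a : 'rV[R]_n) :
  measurable_fun setT (fun x : borel_rV R n => c *: x + a : borel_rV R n)%R.
Proof.
apply: measurable_fun_borel_rV => i.
rewrite [X in measurable_fun _ X](_ : _ =
  (fun x => c * borel_rV_coord i x + a ord0 i)%R); last first.
  by apply/funext => x; rewrite /= /borel_rV_coord !mxE.
apply: measurable_funD => //; apply: measurable_funM => //.
exact: measurable_borel_rV_coord.
Qed.

Lemma measurable_translation (a : 'rV[R]_n) :
  measurable_fun setT (fun x : borel_rV R n => x + a : borel_rV R n)%R.
Proof. by have := measurable_fun_affine 1 a; under eq_fun do rewrite scale1r. Qed.

Lemma measurable_translate_fun d (T : measurableType d) (f : borel_rV R n -> T)
    (a : 'rV[R]_n) : measurable_fun setT f ->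
  measurable_fun setT (fun x : borel_rV R n => f (x + a)%R).
Proof. by move=> mf; apply: (measurableT_comp mf); exact: measurable_translation. Qed.

Section affine.
Variables (c : R) (a : 'rV[R]_n).
Hypothesis c0 : c != 0%R.
Let phi (x : borel_rV R n) : borel_rV R n := (c *: x + a)%R.
Let mphi : measurable_fun setT phi := measurable_fun_affine c a.

(** Both sides are measures, and on a box the identity is a product of n scalings of the line.
    The map is inverted on boxes, with opposite corners exchanged when c < 0. *)
Lemma lebesgue_affine (A : set (borel_rV R n)) : measurable A ->
  pushforward lam phi A = (`|c| ^- n)%:E * lam A.
Proof.
have k0 : (0 <= `|c| ^- n)%R by rewrite invr_ge0 exprn_ge0.
pose m1 := measure_function_pushforward__canonical__measure_function_Measure lam mphi.
pose m2 := mscale (NngNum k0) lam.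
have phi_obox u v : phi @^-1` obox u v =
    if (0 < c)%R then obox (c^-1 *: (u - a))%R (c^-1 *: (v - a))%R
    else obox (c^-1 *: (v - a))%R (c^-1 *: (u - a))%R.
  have H (x : 'rV[R]_n) i : (u ord0 i < (c *: x + a) ord0 i < v ord0 i)%R =
      (u ord0 i - a ord0 i < c * x ord0 i < v ord0 i - a ord0 i)%R.
    by rewrite !mxE ltrBlDr ltrBrDr.
  apply/seteqP; case: ifPn => [cp|].
    split => x xuv i; move: (xuv i); rewrite /= H !mxE ltr_pdivrMl// ltr_pdivlMl//.
  rewrite -leNgt le_eqVlt (negbTE c0)/= => cn.
  split => x xuv i; move: (xuv i); rewrite /= H !mxE ltr_ndivrMl// ltr_ndivlMl//.
    by rewrite andbC.
  by rewrite andbC.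
have m1oo u v : m1 (obox u v) < +oo.
  by rewrite /m1/= /pushforward phi_obox; case: ifPn => _; exact: lebesgue_obox_lty.
suff m12 u v : m1 (obox u v) = m2 (obox u v).
  by move=> mA; rewrite -[LHS]/(m1 A) (measure_unique_obox m12 m1oo).
rewrite /m1/= /pushforward phi_obox /m2/= /mscale/= lebesgue_obox -EFinM.
have -> : (`|c| ^- n = \prod_(i < n) `|c|^-1)%R.
  by rewrite prodr_const card_ord exprVn.
rewrite -big_split/=; case: ifPn => [cp|cN]; rewrite lebesgue_obox; congr EFin;
    apply: eq_bigr => i _; rewrite !mxE.
  rewrite gtr0_norm// maxr_pMr ?invr_ge0 ?ltW// mulr0; congr Num.max; ring.
have cn : (c < 0)%R by rewrite lt_neqAle c0 leNgt.
rewrite ltr0_norm// maxr_pMr ?invr_ge0 ?oppr_ge0 ?ltW// mulr0 invrN; congr Num.max; ring.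
Qed.
End affine.
End boxes.

Section affine_integral.
Context (R : realType) (n : nat).
Local Open Scope ereal_scope.
Local Notation lam := (borel_lebesgue R n).

Lemma ge0_integral_affine (c : R) (a : 'rV[R]_n) (A : set (borel_rV R n))
    (f : borel_rV R n -> \bar R) : c != 0%R ->
  measurable A -> measurable_fun A f -> (forall x, A x -> 0 <= f x) ->
  \int[lam]_(x in (fun x => c *: x + a)%R @^-1` A) f (c *: x + a)%R =
  (`|c| ^- n)%:E * \int[lam]_(x in A) f x.
Proof.
move=> c0 mA mf f0; have k0 : (0 <= `|c| ^- n)%R by rewrite invr_ge0 exprn_ge0.
have f0' : {in A, forall x, 0 <= f x} by move=> y /set_mem; exact: f0.
have <- := ge0_integral_pushforward (measurable_fun_affine c a) lam mA mf f0'.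
rewrite -[RHS](ge0_integral_mscale lam mA (NngNum k0) mf f0).
apply: eq_measure_integral => [|mphi B mB _]; first exact: measurable_fun_affine.
exact: (lebesgue_affine a c0 mB).
Qed.

Lemma measurable_preimage_affine (c : R) (a : 'rV[R]_n) (A : set (borel_rV R n)) :
  measurable A -> measurable ((fun x => c *: x + a)%R @^-1` A : set (borel_rV R n)).
Proof.
move=> mA; rewrite -[X in measurable X]setTI.
exact: (measurable_fun_affine c a).
Qed.

Lemma measurable_preimage_translation (a : 'rV[R]_n) (A : set (borel_rV R n)) :
  measurable A -> measurable ((fun x => x + a)%R @^-1` A : set (borel_rV R n)).
Proof. by move=> mA; rewrite -[X in measurable X]setTI; exact: measurable_translation. Qed.

Lemma ge0_integral_translate (a : 'rV[R]_n) (A : set (borel_rV R n))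
    (f : borel_rV R n -> \bar R) :
  measurable A -> measurable_fun A f -> (forall x, A x -> 0 <= f x) ->
  \int[lam]_(x in (fun x => x + a)%R @^-1` A) f (x + a)%R = \int[lam]_(x in A) f x.
Proof.
move=> mA mf f0.
have := ge0_integral_affine a (oner_neq0 R) mA mf f0.
rewrite normr1 expr1n invr1 mul1e.
have -> : (fun x : borel_rV R n => 1 *: x + a)%R = (fun x => x + a)%R.
  by apply/funext => x; rewrite scale1r.
by move=> <-; apply: eq_integral => x _; rewrite scale1r.
Qed.

End affine_integral.

(** * The Euclidean norm and its kernels *)

Section euclid.
Context (R : realType) (n : nat).
Implicit Types x y : 'rV[R]_n.
Local Notation E := (@euclid_norm R n).

Lemma euclid_norm_ge0 x : 0 <= E x. Proof. exact: sqrtr_ge0. Qed.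

Lemma ler_coord_euclid x i : `|x ord0 i| <= E x.
Proof.
rewrite -[X in X <= _]sqrtr_sqr ler_wsqrtr//.
by rewrite (bigD1 i)//= lerDl sumr_ge0// => j _; rewrite sqr_ge0.
Qed.

Lemma euclid_le_sqrtn x r : 0 <= r -> (forall i, `|x ord0 i| <= r) ->
  E x <= Num.sqrt n%:R * r.
Proof.
move=> r0 xr; rewrite -[X in _ * X](ger0_norm r0) -sqrtr_sqr -sqrtrM ?ler0n// ler_wsqrtr//.
have -> : n%:R * r ^+ 2 = \sum_(i < n) r ^+ 2.
  by rewrite sumr_const card_ord mulr_natl.
by apply: ler_sum => i _; rewrite -real_normK ?num_real// lerXn2r ?nnegrE.
Qed.

Lemma euclid_norm_eq0 x : (E x == 0) = (x == 0).
Proof.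
apply/eqP/eqP => [x0|->].
  apply/rowP => i; rewrite mxE; apply/eqP; rewrite -normr_le0 -x0.
  exact: ler_coord_euclid.
by rewrite /euclid_norm big1 ?sqrtr0// => i _; rewrite mxE expr0n.
Qed.

Lemma euclid_norm_gt0 x : (0 < E x) = (x != 0).
Proof. by rewrite lt_neqAle euclid_norm_ge0 andbT eq_sym euclid_norm_eq0. Qed.

Lemma euclid_normZ c x : E (c *: x) = `|c| * E x.
Proof.
rewrite /euclid_norm -sqrtr_sqr -sqrtrM ?sqr_ge0// mulr_sumr.
by congr Num.sqrt; apply: eq_bigr => i _; rewrite mxE exprMn.
Qed.

Lemma euclid_normN x : E (- x) = E x.
Proof. by rewrite -scaleN1r euclid_normZ normrN1 mul1r. Qed.

Lemma euclid_distC x y : E (x - y) = E (y - x).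
Proof. by rewrite -opprB euclid_normN. Qed.

Lemma measurable_euclid_dist d (T : measurableType d) (f g : T -> borel_rV R n) :
  measurable_fun setT f -> measurable_fun setT g ->
  measurable_fun setT (fun t => E ((f t : 'rV[R]_n) - g t)).
Proof.
move=> mf mg; rewrite /euclid_norm.
have ms : measurable_fun setT (@Num.sqrt R).
  by apply: continuous_measurable_fun => x; exact: sqrt_continuous.
apply: (measurableT_comp ms); apply: measurable_sum => i.
under eq_fun do rewrite !mxE.
apply: measurable_funX; apply: measurable_funB.
  exact: (measurableT_comp (measurable_borel_rV_coord i)).
exact: (measurableT_comp (measurable_borel_rV_coord i)).
Qed.

End euclid.

Lemma measurable_powR_comp (R : realType) d (T : measurableType d) (D : set T)
    (f : T -> R) (s : R) :
  measurable_fun D f -> measurable_fun D (fun t => f t `^ s).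
Proof. exact: (@measurableT_comp _ _ _ _ _ _ (@powR R ^~ s)). Qed.

Section kernel.
Context (R : realType) (n : nat).
Local Open Scope ereal_scope.
Local Notation lam := (borel_lebesgue R n).
Local Notation E := (@euclid_norm R n).

Lemma measurable_euclid_ball (x : 'rV[R]_n) r :
  measurable ([set y | E (x - y) < r]%R : set (borel_rV R n)).
Proof.
rewrite [X in measurable X](_ : _ = (fun y => E (x - y)) @^-1` `]-oo, r[).
  rewrite -[X in measurable X]setTI.
  by apply: (@measurable_euclid_dist _ _ _ (borel_rV R n) (cst x) id).
by apply/seteqP; split => y; rewrite /= in_itv.
Qed.

Lemma ball_sub_obox (x : 'rV[R]_n) r :
  [set y | E (x - y) < r]%R `<=` obox (x - const_mx r)%R (x + const_mx r)%R.
Proof.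
move=> y /= xyr i; rewrite !mxE -ltr_distl distrC.
by have := le_lt_trans (ler_coord_euclid (x - y) i) xyr; rewrite !mxE.
Qed.

Lemma lebesgue_obox_centre (x : 'rV[R]_n) r : (0 <= r)%R ->
  lam (obox (x - const_mx r)%R (x + const_mx r)%R) = ((2 * r) ^+ n)%:E.
Proof.
move=> r0; rewrite lebesgue_obox; congr EFin.
rewrite (eq_bigr (fun=> 2 * r)%R) ?prodr_const ?card_ord// => i _.
rewrite !mxE (_ : _ - _ = 2 * r)%R; last by ring.
by rewrite max_r// mulr_ge0.
Qed.

Lemma dyadic_shell (t rho : R) : (0 < t < rho)%R ->
  exists k, (rho / 2 ^+ k.+1 <= t < rho / 2 ^+ k)%R.
Proof.
move=> /andP[t0 trho].
have ex : exists k, (rho / 2 ^+ k.+1 <= t)%R.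
  exists (Num.truncn (rho / t)).
  rewrite ler_pdivrMr ?exprn_gt0// -ler_pdivrMl// mulrC.
  apply: (le_trans (ltW (truncnS_gt _))).
  rewrite -natrX ler_nat; exact/ltnW/ltn_expl.
case: (ex_minnP ex) => k kt kmin; exists k; rewrite kt/=.
case: k kt kmin => [_ _|k kt kmin]; first by rewrite expr0 divr1.
by rewrite ltNge; apply/negP => /kmin; rewrite ltnn.
Qed.

Lemma le0_ger_powR (s x y : R) : (s <= 0)%R -> (0 < x)%R -> (x <= y)%R ->
  (y `^ s <= x `^ s)%R.
Proof.
move=> s0 x0 xy; have y0 := lt_le_trans x0 xy.
rewrite -[s]opprK (powRN x) (powRN y) lef_pV2 ?posrE ?powR_gt0//.
by apply: ge0_ler_powR => //; rewrite ?nnegrE ?oppr_ge0// ltW.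
Qed.

(** One constant serves both signs of s: for s >= 0 the factor 1 suffices, for s < 0 the worst
    point is r / 2. *)
Lemma powR_shell (s t r : R) : (0 < r)%R -> (r / 2 <= t <= r)%R ->
  (t `^ s <= (1 + 2 `^ (- s)) * r `^ s)%R.
Proof.
move=> r0 /andP[rt tr]; have t0 : (0 < t)%R by apply: lt_le_trans rt; rewrite divr_gt0.
have [s0|s0] := leP 0%R s.
  apply: (@le_trans _ _ (r `^ s)%R); first by apply: ge0_ler_powR => //; rewrite nnegrE ltW.
  by rewrite ler_peMl ?powR_ge0// lerDl powR_ge0.
apply: (@le_trans _ _ ((r / 2) `^ s)%R).
  by apply: le0_ger_powR => //; [exact: ltW|rewrite divr_gt0].
rewrite powRM ?invr_ge0// ?(ltW r0)// mulrC ler_pM2r ?powR_gt0//.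
by rewrite -powR_inv1// -powRrM mulN1r lerDr.
Qed.

(** Cut the ball into dyadic shells. On the shell of radius r_k = rho / 2^k the kernel is at
    most C1 * r_k^(b - n), and the shell has measure at most (2 r_k)^n, so the shells contribute
    a geometric series of ratio 2^-b. *)
Lemma kernel_bound (b : R) : (0 < b)%R -> exists2 C : R, (0 < C)%R &
  forall (rho : R) (x : 'rV[R]_n), (0 < rho)%R ->
  \int[lam]_(y in [set y | E (x - y) < rho]%R) (E (x - y)%R `^ (b - n%:R))%:E
    <= (C * rho `^ b)%:E.
Proof.
move=> b0; pose s := (b - n%:R)%R; pose C1 := (1 + 2 `^ (- s) : R)%R.
have C11 : (1 <= C1)%R by rewrite lerDl powR_ge0.
pose z := (2 `^ (- b) : R)%R.
have z1 : (z < 1)%R.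
  rewrite /z powRN invf_lt1 ?powR_gt0//.
  by have := @gt0_ltr_powR R b b0 1%R 2%R; rewrite powR1 !nnegrE; apply; rewrite ?ltr1n.
exists (C1 * 2 ^+ n / (1 - z))%R.
  by rewrite divr_gt0 ?subr_gt0// mulr_gt0 ?exprn_gt0// (lt_le_trans _ C11).
move=> rho x rho0.
pose r k := (rho / 2 ^+ k)%R.
have r0 k : (0 < r k)%R by rewrite divr_gt0 ?exprn_gt0.
pose O k := obox (x - const_mx (r k))%R (x + const_mx (r k))%R.
have mO k : measurable (O k : set (borel_rV R n)) by exact: measurable_obox.
pose h k y := ((C1 * (r k) `^ s) * \1_(O k) y)%:E.
have mh k : measurable_fun setT (h k : borel_rV R n -> _).
  by apply/measurable_EFinP; apply: measurable_funM => //; exact: measurable_indic.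
have h0 k y : 0 <= h k y.
  by rewrite lee_fin mulr_ge0 // mulr_ge0 ?powR_ge0// (le_trans ler01).
have hle k y : h k y <= \sum_(j <oo) h j y.
  rewrite (@nneseriesD1 _ _ k)//.
  by rewrite leeDl//; apply: nneseries_ge0 => j _ _; exact: h0.
have mE : measurable_fun setT (fun y : borel_rV R n => E (x - y)%R).
  by apply: (measurable_euclid_dist (f := cst x)).
have mB := measurable_euclid_ball x rho.
have C0 : (0 <= C1)%R by rewrite (le_trans ler01).
apply: (@le_trans _ _ (\int[lam]_y \sum_(k <oo) h k y)).
  rewrite integral_mkcond; apply: ge0_le_integral => //.
  - by move=> y _; apply: erestrict_ge0 => z' _; rewrite lee_fin powR_ge0.
  - apply/(measurable_restrictT _ mB)/measurable_funTS/measurable_EFinP.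
    exact: measurable_powR_comp.
  - apply: ge0_emeasurable_sum => [k y _ _|k _]; first exact: h0.
    exact: mh.
  - move=> y _; rewrite /patch; case: ifPn => [/set_mem/= yrho|_]; last first.
      by apply: nneseries_ge0 => k _ _; exact: h0.
    (* The diagonal lies in no shell. Since 0 `^ s is 0 for s <> 0 and 1 for s = 0, the kernel
       there is dominated by the outermost box. *)
    have [xy|xy] := eqVneq (E (x - y)%R) 0%R.
      rewrite xy /powR eqxx; case: eqP => [s0|_]; last first.
        by apply: nneseries_ge0 => k _ _; exact: h0.
      apply: (@le_trans _ _ (h 0%N y)).
        rewrite [X in _ <= X](_ : _ = C1%:E) ?lee_fin//.
        rewrite /h indicE mem_set ?mulr1; first by rewrite [s]s0 powRr0 mulr1.
        by apply: ball_sub_obox; rewrite /= xy.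
      exact: hle.
    have [|k /andP[rk kr]] := @dyadic_shell (E (x - y)%R) rho.
      by rewrite yrho andbT lt_neqAle eq_sym xy euclid_norm_ge0.
    apply: (@le_trans _ _ (h k y)).
      rewrite /h indicE mem_set ?mulr1; last exact: ball_sub_obox.
      rewrite lee_fin; apply: powR_shell => //.
      by rewrite (ltW kr) andbT (le_trans _ rk)// /r exprS invfM mulrA mulrAC.
    exact: hle.
rewrite integral_nneseries//.
have hE k : \int[lam]_y h k y = (C1 * 2 ^+ n * rho `^ b * z ^+ k)%:E.
  under eq_integral do rewrite /h EFinM.
  rewrite ge0_integralZl_EFin//; last 2 first.
  - by apply/measurable_EFinP; exact: measurable_indic.
  - by rewrite mulr_ge0 ?powR_ge0.
  have -> : \int[lam]_y (\1_(O k) y)%:E = ((2 * r k) ^+ n)%:E.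
    rewrite integral_indic// setIT; exact: lebesgue_obox_centre (ltW (r0 k)).
  rewrite -EFinM; congr EFin.
  have -> : (z ^+ k = ((2 ^+ k) `^ b)^-1)%R.
    by rewrite -powRN -powR_mulrn ?powR_ge0// /z -powRrM mulrC powRrM powR_mulrn.
  have -> : (r k `^ s = r k `^ b * r k ^- n)%R.
    rewrite /s powRB; last by rewrite (gt_eqF (r0 k)) implybT.
    by rewrite powR_mulrn// (ltW (r0 k)).
  have -> : (r k `^ b = rho `^ b * ((2 ^+ k) `^ b)^-1)%R.
    rewrite /r powRM ?invr_ge0 ?exprn_ge0 ?(ltW rho0)//.
    by rewrite -powR_inv1 ?exprn_ge0// -powRrM mulN1r powRN.
  have rn0 : (r k ^+ n != 0)%R by rewrite gt_eqF// exprn_gt0.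
  have p0 : ((2 ^+ k) `^ b != 0 :> R)%R by rewrite gt_eqF// powR_gt0// exprn_gt0.
  have -> : ((2 * r k) ^+ n = 2 ^+ n * r k ^+ n)%R by exact: exprMn.
  move: rn0 p0.
  move: (r k ^+ n)%R ((2 ^+ k) `^ b)%R (2 ^+ n)%R => u v w u0 v0.
  by field; rewrite v0 u0.
under eq_eseriesr do rewrite hE.
have gsum N : (\sum_(0 <= k < N) z ^+ k <= (1 - z)^-1)%R.
  have : ((1 - z) * \sum_(0 <= k < N) z ^+ k = 1 - z ^+ N)%R.
    by rewrite -[in RHS](expr1n _ N) subrXX big_mkord; congr (_ * _)%R;
      apply: eq_bigr => i _; rewrite expr1n mul1r.
  move=> /(canRL (mulKf _)) -> //; last by rewrite gt_eqF// subr_gt0.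
  by rewrite ler_piMr ?invr_ge0 ?subr_ge0 ?(ltW z1)// gerBl exprn_ge0// powR_ge0.
apply: lime_le.
  by apply: is_cvg_nneseries => k _ _; rewrite lee_fin !mulr_ge0 ?powR_ge0 ?exprn_ge0 ?powR_ge0.
apply: nearW => N /=; rewrite sumEFin lee_fin -mulr_sumr.
rewrite (_ : (C1 * 2 ^+ n / (1 - z) * rho `^ b =
  C1 * 2 ^+ n * rho `^ b * (1 - z)^-1)%R); last by ring.
by rewrite ler_wpM2l// !mulr_ge0 ?powR_ge0 ?exprn_ge0.
Qed.

End kernel.

(** * Borel representatives *)

Section completion.
Context (R : realType) (n : nat).
Local Open Scope ereal_scope.
Local Notation lam := (borel_lebesgue R n).
Local Notation vol := (lebesgue_rV R n).
Local Notation B := (borel_rV R n).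
Local Notation L := (lebesgue_rV_type R n).

Lemma vol_borel (A : set B) : measurable A -> vol A = lam A.
Proof. exact: measurable_mu_extE. Qed.

Lemma measurable_vol (A : set B) : measurable A -> measurable (A : set L).
Proof. exact: caratheodory_measurable_mu_ext. Qed.

Lemma measurable_fun_vol d (T : measurableType d) (D : set B) (f : B -> T) :
  measurable D -> measurable_fun D f -> measurable_fun (D : set L) (f : L -> T).
Proof.
by move=> mD mf _ Y mY; apply: measurable_vol; exact: mf.
Qed.

(** Intersect covers by boxes whose total measure exceeds the outer measure of E by at most
    1 / (k + 1). *)
Lemma borel_hull (E : set 'rV[R]_n) : vol E < +oo ->
  exists F : set B, [/\ measurable F, E `<=` F & lam F = vol E].
Proof.
move=> Eoo.
have Efin : vol E \is a fin_num by rewrite ge0_fin_numE// mu_ext_ge0.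
have cov k : exists A, measurable_cover (E : set B) A /\
    \sum_(i <oo) lam (A i) < vol E + (k.+1%:R^-1)%:E.
  have k0 : (0 < k.+1%:R^-1 :> R)%R by [].
  have [_ /= [A EA <-] lt] := lb_ereal_inf_adherent k0 Efin.
  by exists A.
have {cov}[A covA] := choice cov.
pose F k := \bigcup_i A k i.
have mF k : measurable (F k : set B).
  by apply: bigcupT_measurable => i; exact: (cover_measurable (covA k).1).
exists (\bigcap_k F k); split.
- by apply: bigcapT_measurable => k; exact: mF.
- by move=> x Ex k _; exact: (cover_subset (covA k).1).
have mFF : measurable (\bigcap_k F k : set B).
  by apply: bigcapT_measurable => k; exact: mF.
apply/eqP; rewrite eq_le; apply/andP; split; last first.
  rewrite -vol_borel//; apply: le_mu_ext => x Ex k _.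
  exact: (cover_subset (covA k).1).
apply/lee_addgt0Pr => e e0; near \oo => k.
apply: (@le_trans _ _ (lam (F k))).
  by apply: le_measure; rewrite ?inE//; exact: bigcap_inf.
apply: (@le_trans _ _ (\sum_(i <oo) lam (A k i))).
  apply: generalized_Boole_inequality => //; last exact: mF.
  exact: (cover_measurable (covA k).1).
apply: (le_trans (ltW (covA k).2)); rewrite leeD2l// lee_fin ltW//.
by near: k; exact: (near_infty_natSinv_lt (PosNum e0)).
Unshelve. all: by end_near. Qed.

Definition borel_null (N : set 'rV[R]_n) :=
  measurable (N : set B) /\ lam N = 0.

Lemma borel_null_bigcup (F : (set 'rV[R]_n)^nat) :
  (forall k, borel_null (F k)) -> borel_null (\bigcup_k F k).
Proof.
move=> F0; have mF : measurable (\bigcup_k F k : set B).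
  by apply: bigcupT_measurable => k; exact: (F0 k).1.
split => //; apply/eqP; rewrite -measure_le0.
apply: (le_trans (generalized_Boole_inequality _ _ mF)).
  by move=> k; exact: (F0 k).1.
by rewrite eseries0// => k _ _; exact: (F0 k).2.
Qed.

Lemma borel_nullU (F G : set 'rV[R]_n) :
  borel_null F -> borel_null G -> borel_null (F `|` G).
Proof.
move=> F0 G0; rewrite -bigcup2E; apply: borel_null_bigcup => -[|[|k]]//=.
Qed.

Lemma negligible_borel_null (N : set 'rV[R]_n) :
  vol.-negligible N -> exists2 M, borel_null M & N `<=` M.
Proof.
move=> [A [mA A0 NA]].
have [|F [mF AF FA]] := @borel_hull A; first by rewrite A0 ltry.
by exists F; [split => //; rewrite FA|exact: subset_trans AF].
Qed.

Lemma borel_null_ae (N : set 'rV[R]_n) (P : 'rV[R]_n -> Prop) : borel_null N ->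
  (forall x, ~ N x -> P x) -> {ae vol, forall x, P x}.
Proof.
move=> [mN N0] NP; exists N; split; first exact: measurable_vol.
  by rewrite vol_borel.
by move=> x /= Px; apply: contrapT => /NP.
Qed.

(** The difference of E and a hull of E is null by Caratheodory measurability, hence lies in a
    Borel null set. *)
Lemma borel_approx_fin (E : set L) : measurable E -> vol E < +oo ->
  exists (F : set B) N, [/\ measurable F, borel_null N & forall x, ~ N x -> E x <-> F x].
Proof.
move=> mE Eoo; have [F [mF EF FE]] := borel_hull Eoo.
have [|N N0 FEN] := @negligible_borel_null (F `\` E).
  exists (F `\` E); split => //; first by apply: measurableD => //; exact: measurable_vol.
  rewrite measureD//; last 2 first.
  - exact: measurable_vol.
  - by rewrite -FE -vol_borel// in Eoo.
  rewrite setIidr// -[X in X - _]/(vol F) vol_borel// FE.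
  by rewrite subee// ge0_fin_numE// mu_ext_ge0.
exists F, N; split => // x Nx; split; first exact: EF.
by move=> Fx; apply: contrapT => Ex; apply: Nx; exact: FEN.
Qed.

Lemma borel_approx (E : set L) : measurable E ->
  exists (F : set B) N, [/\ measurable F, borel_null N & forall x, ~ N x -> E x <-> F x].
Proof.
move=> mE; pose O (k : nat) : set 'rV[R]_n := centred_obox k%:R.
have mO k : measurable (O k : set B) by exact: measurable_obox.
have H k : exists FN : set B * set B, [/\ measurable FN.1, borel_null FN.2 &
    forall x, ~ FN.2 x -> (E `&` O k) x <-> FN.1 x].
  have [||F [N [? ? ?]]] := @borel_approx_fin (E `&` O k).
  - by apply: measurableI => //; exact: measurable_vol.
  - apply: (@le_lt_trans _ _ (vol (O k))); first by apply: le_mu_ext; exact: subIsetr.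
    by rewrite vol_borel//; exact: lebesgue_obox_lty.
  by exists (F, N).
have {H}[FN HFN] := choice H.
exists (\bigcup_k (FN k).1), (\bigcup_k (FN k).2); split.
- by apply: bigcupT_measurable => k; have [] := HFN k.
- by apply: borel_null_bigcup => k; have [] := HFN k.
move=> x Nx; have Nxk k : ~ (FN k).2 x by move=> Nk; apply: Nx; exists k.
split => [Ex|[k _ Fx]]; last by have [_ _ /(_ _ (Nxk k))[_ /(_ Fx)[]]] := HFN k.
have [k _ Ok] : (\bigcup_(k : nat) O k) x by rewrite centred_obox_cover.
by exists k => //; have [_ _ /(_ _ (Nxk k))[+ _]] := HFN k; apply.
Qed.

(** The superlevel sets of f at rational heights agree with Borel sets off one null set N; on N
    the value 0 is taken. *)
Lemma borel_representative (f : 'rV[R]_n -> \bar R) : ae_finite_measurable f ->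
  exists (F : 'rV[R]_n -> R) N, [/\ measurable_fun setT (F : B -> R),
    borel_null N & forall x, ~ N x -> f x = (F x)%:E].
Proof.
move=> [mf /negligible_borel_null[N0 N00 fN0]].
have H (r : rat) : exists FN : set B * set B, [/\ measurable FN.1, borel_null FN.2 &
    forall x, ~ FN.2 x -> (f @^-1` `](ratr r)%:E, +oo[) x <-> FN.1 x].
  have [|F [N [? ? ?]]] := @borel_approx (f @^-1` `](ratr r)%:E, +oo[).
    by rewrite -[X in measurable X]setTI; apply: mf => //; exact: emeasurable_itv.
  by exists (F, N).
have {H}[FN HFN] := choice H.
pose N := N0 `|` \bigcup_r (FN r).2.
have Nnull : borel_null N.
  apply: borel_nullU => //.
  have mU : measurable (\bigcup_r (FN r).2 : set B).
    by apply: bigcupT_measurable_rat => r; have [_ []] := HFN r.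
  split => //.
  rewrite (_ : \bigcup_r (FN r).2 = \bigcup_k (if unpickle k is Some r then (FN r).2 else set0)).
    have [] // : borel_null (\bigcup_k (if unpickle k is Some r then (FN r).2 else set0)).
    apply: borel_null_bigcup => k; case: unpickle => [r|]; first by have [_] := HFN r.
    by split => //; rewrite measure0.
  apply/seteqP; split => [x [r _ Nx]|x [k _]].
    by exists (pickle r); [exact: I|rewrite pickleK].
  by case: unpickle => // r Nx; exists r.
pose F x : R := if x \in N then 0%R else fine (f x).
exists F, N; split => //; last first.
  move=> x Nx; rewrite /F memNset// fineK//.
  by apply: contrapT => fx; apply: Nx; left; exact: fN0.
have mN : measurable (N : set B) by have [] := Nnull.
apply: (measurability _ (@RGenOInfty.measurableE R)) => _ [_ [a ->] <-].
(* The exceptional set N is added to the superlevel set exactly when its value 0 exceeds a. *)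
rewrite setTI (_ : _ @^-1` _ = \bigcup_(r : rat) (if (a < ratr r)%R then
    ((FN r).1 `\` N) `|` (if (ratr r < 0 :> R)%R then N else set0) else set0)
    `|` (if (a < 0)%R then N else set0)).
  apply: measurableU; last by case: ifP.
  apply: bigcupT_measurable_rat => r; case: ifP => // _.
  apply: measurableU; last by case: ifP.
  by apply: measurableD => //; have [] := HFN r.
have fE x : ~ N x -> f x = (fine (f x))%:E.
  move=> Nx; rewrite fineK//.
  by apply: contrapT => fx; apply: Nx; left; exact: fN0.
apply/seteqP; split => [x|x [[r _]|]].
- rewrite /= in_itv/= andbT /F; case: ifPn => [/set_mem xN a0|/negP xN ax].
    by right; rewrite a0.
  have {}xN : ~ N x by move=> Nx; apply: xN; exact: mem_set.
  left; have [r /itvP ra] := rat_in_itvoo ax.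
  exists r => //; rewrite ra; left; split => //.
  have [_ _ /(_ x)] := HFN r; case=> [Nx|+ _]; first by apply: xN; right; exists r.
  by apply; rewrite /= in_itv/= andbT fE// lte_fin ra.
- case: ifP => // ar [[Fx Nx]|]; rewrite /= in_itv/= andbT /F.
    rewrite memNset//; have [_ _ /(_ x)] := HFN r.
    case=> [Nx'|_ /(_ Fx)]; first by apply: Nx; right; exists r.
    by rewrite /= in_itv/= andbT fE// lte_fin; exact: lt_trans.
  by case: ifP => // r0 Nx; rewrite mem_set// (lt_trans ar).
- by case: ifP => // a0 Nx; rewrite /= in_itv/= andbT /F mem_set.
Qed.

Lemma ge0_integral_vol_borel (A : set B) (f : B -> \bar R) :
  measurable A -> measurable_fun A f -> (forall x, A x -> 0 <= f x) ->
  \int[vol]_(x in A) f x = \int[lam]_(x in A) f x.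
Proof.
move=> mA mf f0.
have mid : measurable_fun setT (id : L -> B).
  by move=> _ Y mY; rewrite setTI preimage_id; exact: measurable_vol.
have f0' : {in A, forall x, 0 <= f x} by move=> x /set_mem; exact: f0.
have /= := ge0_integral_pushforward mid vol mA mf f0'.
rewrite preimage_id => <-; apply: eq_measure_integral => X mX _.
exact: vol_borel.
Qed.

Lemma integral_vol_borel (A : set B) (f : B -> \bar R) :
  measurable A -> measurable_fun A f ->
  \int[vol]_(x in A) f x = \int[lam]_(x in A) f x.
Proof.
move=> mA mf; rewrite integralE [RHS]integralE; congr (_ - _).
  by apply: ge0_integral_vol_borel => //; exact: measurable_funepos.
by apply: ge0_integral_vol_borel => //; exact: measurable_funeneg.
Qed.

(** Since vol is complete, f is measurable as soon as g is. *)
Lemma integral_vol (A : set B) N (f : L -> \bar R) (g : B -> \bar R) :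
  measurable A -> borel_null N -> measurable_fun A g ->
  (forall x, A x -> ~ N x -> f x = g x) ->
  \int[vol]_(x in A) f x = \int[lam]_(x in A) g x.
Proof.
move=> mA N0 mg fg; rewrite -integral_vol_borel//.
have gf : ae_eq vol A g f.
  have [mN lN0] := N0; exists N; split; first exact: measurable_vol.
    by rewrite -lN0; exact: vol_borel.
  by move=> x /= gfx; apply: contrapT => Nx; apply: gfx => Ax; rewrite fg.
have mgL := measurable_fun_vol mA mg.
apply: ae_eq_integral; [exact: measurable_vol| |exact: mgL|exact: ae_eq_sym].
apply: ae_measurable_fun gf mgL.
exact: measure_is_complete_caratheodory.
Qed.

End completion.

(** * Cubes *)

Section cubes.
Context (R : realType) (n : nat).
Local Notation lam := (borel_lebesgue R n).
Local Notation E := (@euclid_norm R n).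
Implicit Types (l : R) (Q : set 'rV[R]_n).

Lemma measurable_cube l Q : cube l Q -> measurable (Q : set (borel_rV R n)).
Proof.
move=> [a [b [c ->]]].
apply: (@measurable_borel_rV_box R n (fun i => [set` Interval (BSide (b i) (a ord0 i))
  (BSide (c i) (a ord0 i + l))])) => i.
exact: measurable_itv.
Qed.

Lemma lebesgue_cube l Q : 0 < l -> cube l Q -> lam Q = (l ^+ n)%:E.
Proof.
move=> l0 [a [b [c ->]]].
rewrite (borel_lebesgue_box (A := fun i => [set` Interval (BSide (b i) (a ord0 i))
  (BSide (c i) (a ord0 i + l))])); last by move=> i; exact: measurable_itv.
rewrite (eq_bigr (fun=> l%:E)) => [|i _].
  by rewrite prodEFin prodr_const card_ord.
by rewrite lebesgue_measure_itv/= lte_fin ltrDl l0 -EFinD addrAC subrr add0r.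
Qed.

Lemma cube_dist_coord l Q x y i : cube l Q -> Q x -> Q y ->
  `|(x - y) ord0 i| <= l.
Proof.
move=> [a [b [c ->]]] /= /(_ i) + /(_ i); rewrite !in_itv/= !mxE.
move=> /andP[/lteifW ax /lteifW xa] /andP[/lteifW ay /lteifW ya].
by rewrite ler_norml; apply/andP; split; lra.
Qed.

Lemma cube_dist l Q x y : 0 <= l -> cube l Q -> Q x -> Q y ->
  E (x - y) <= Num.sqrt n%:R * l.
Proof.
by move=> l0 cQ Qx Qy; apply: euclid_le_sqrtn => // i; exact: cube_dist_coord cQ Qx Qy.
Qed.

(** A cube is a product of intervals: it contains the segments joining its points, and also the
    corners of the path that changes the coordinates of x into those of y one at a time. *)
Lemma cube_between l Q (x y z : 'rV[R]_n) : cube l Q -> Q x -> Q y ->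
  (forall i, Num.min (x ord0 i) (y ord0 i) <= z ord0 i <= Num.max (x ord0 i) (y ord0 i)) ->
  Q z.
Proof.
move=> [a [b [c ->]]] /= Qx Qy zxy i; move: (zxy i) => /andP[mz zM].
have := Qx i; have := Qy i; rewrite !itv_boundlr => /andP[ay ya] /andP[ax xa].
apply/andP; split.
  apply: (@le_trans _ _ (BLeft (Num.min (x ord0 i) (y ord0 i)))); last by rewrite bnd_simp.
  by rewrite /Num.min; case: ifP.
apply: (@le_trans _ _ (BRight (Num.max (x ord0 i) (y ord0 i)))); first by rewrite bnd_simp.
by rewrite /Num.max; case: ifP.
Qed.

Definition ccube r : set 'rV[R]_n := [set x | forall i, - r <= x ord0 i <= r].

Lemma cube_ccube r : cube (2 * r) (ccube r).
Proof.
exists (const_mx (- r)), (fun=> true), (fun=> false).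
apply/seteqP; split => x xr i; move: (xr i); rewrite /= in_itv/= !mxE.
  by rewrite (_ : - r + 2 * r = r)//; lra.
by rewrite (_ : - r + 2 * r = r)//; lra.
Qed.

Lemma subset_ccube r r' : r <= r' -> ccube r `<=` ccube r'.
Proof.
move=> rr x xr i; move: (xr i) => /andP[? ?]; apply/andP; split; lra.
Qed.

(** The open box O of the same edges turns disjointness of interiors into disjointness, at the
    cost of a null set. *)
Lemma cube_interior l Q : 0 < l -> cube l Q -> exists O : set 'rV[R]_n,
  [/\ measurable (O : set (borel_rV R n)), O `<=` interior Q & lam O = (l ^+ n)%:E].
Proof.
move=> l0 [a [b [c QE]]]; exists (obox a (a + const_mx l)); split.
- exact: measurable_obox.
- move=> x xa; suff : \forall y \near x, forall i,
      (y : 'rV[R]_n) ord0 i \in `]a ord0 i, (a ord0 i + l)[.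
    apply: filterS => y ya; rewrite QE => i; move: (ya i).
    rewrite !in_itv/= => /andP[ay ya']; apply/andP; split; exact: lteifS.
  have H i : nbhs x [set y : 'rV[R]_n | y ord0 i \in `]a ord0 i, (a ord0 i + l)[].
    have xai : x ord0 i \in `]a ord0 i, (a ord0 i + l)[.
      by move: (xa i); rewrite [(a + _) _ _]mxE [const_mx _ _ _]mxE in_itv.
    exact: (@coord_continuous R 1 n ord0 i x _ (near_in_itvoo xai)).
  exact: (filter_forall (nbhs_filter x) H).
- rewrite lebesgue_obox; congr EFin.
  rewrite (eq_bigr (fun=> l)) ?prodr_const ?card_ord// => i _.
  have -> : (a + const_mx l) ord0 i - a ord0 i = l.
    by rewrite !mxE addrAC subrr add0r.
  by rewrite max_r// ltW.
Qed.

End cubes.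

(** * Iterated integrals of nonnegative kernels *)

Section tonelli_subset.
Context d1 d2 (T1 : measurableType d1) (T2 : measurableType d2) (R : realType).
Context (m1 : {sigma_finite_measure set T1 -> \bar R}) (m2 : {sigma_finite_measure set T2 -> \bar R}).
Local Open Scope ereal_scope.

Lemma tonelli_subset (k : T1 -> T2 -> \bar R) A Z : measurable A -> measurable Z ->
  measurable_fun setT (fun z => k z.1 z.2) -> (forall x y, 0 <= k x y) ->
  \int[m1]_(x in A) \int[m2]_(y in Z) k x y = \int[m2]_(y in Z) \int[m1]_(x in A) k x y.
Proof.
move=> mA mZ mk k0; pose kAZ := (fun z => k z.1 z.2) \_ (A `*` Z).
have mkAZ : measurable_fun setT kAZ.
  apply/(measurable_restrictT _ _).1; first exact: measurableX.
  exact: measurable_funS mk.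
have kAZ0 z : 0 <= kAZ z by rewrite /kAZ patchE; case: ifP.
transitivity (\int[m1]_x \int[m2]_y kAZ (x, y)).
  rewrite integral_mkcond; apply: eq_integral => x _; rewrite patchE.
  case: ifPn => xA; last first.
    by apply/esym/integral0_eq => y _; rewrite /kAZ patchE in_setX/= (negbTE xA).
  rewrite integral_mkcond; apply: eq_integral => y _.
  by rewrite /kAZ !patchE in_setX/= xA.
rewrite fubini_tonelli//.
rewrite [RHS]integral_mkcond; apply: eq_integral => y _; rewrite patchE.
case: ifPn => yZ; last first.
  by apply: integral0_eq => x _; rewrite /kAZ patchE in_setX/= (negbTE yZ) andbF.
rewrite [RHS]integral_mkcond; apply: eq_integral => x _.
by rewrite /kAZ !patchE in_setX/= yZ andbT.
Qed.

Lemma measurable_integral_subset (k : T1 -> T2 -> \bar R) Z : measurable Z ->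
  measurable_fun setT (fun z => k z.1 z.2) -> (forall x y, 0 <= k x y) ->
  measurable_fun setT (fun x => \int[m2]_(y in Z) k x y).
Proof.
move=> mZ mk k0.
have mkZ : measurable_fun setT ((fun z => k z.1 z.2) \_ (setT `*` Z)).
  apply/(measurable_restrictT _ _).1; first exact: measurableX.
  exact: measurable_funS mk.
have mkF := @measurable_fun_fubini_tonelli_F _ _ _ _ R m2 _ mkZ.
apply: (eq_measurable_fun _ _ (mkF _)) => [x _|z]; last by rewrite patchE; case: ifP.
rewrite [RHS]integral_mkcond; apply: eq_integral => y _.
by rewrite !patchE in_setX/= in_setT.
Qed.

End tonelli_subset.

Section iterated_integrals.
Context (R : realType) (n : nat).
Local Open Scope ereal_scope.
Local Notation lam := (borel_lebesgue R n).
Local Notation B := (borel_rV R n).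
Implicit Types (k : B -> B -> \bar R) (A Z : set B).

Definition nonneg_kernel k : Prop :=
  measurable_fun setT (fun z : B * B => k z.1 z.2) /\ forall x y, 0 <= k x y.

(** An iterated integral, not one over the product: this is the form of the seminorms. *)
Definition iint k A Z := \int[lam]_(x in A) \int[lam]_(y in Z) k x y.

Lemma nonneg_kernelC k : nonneg_kernel k -> nonneg_kernel (fun x y => k y x).
Proof.
move=> [mk k0]; split => //.
exact: (measurableT_comp mk (@measurable_swap _ _ B B)).
Qed.

Lemma nonneg_kernel1 k x : nonneg_kernel k -> measurable_fun setT (k x).
Proof.
move=> [mk _].
exact: (measurableT_comp mk (measurable_pair1 x)).
Qed.

Lemma nonneg_kernelD k k' : nonneg_kernel k -> nonneg_kernel k' ->
  nonneg_kernel (fun x y => k x y + k' x y).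
Proof.
move=> [mk k0] [mk' k'0]; split => [|x y]; last by rewrite adde_ge0.
exact: emeasurable_funD.
Qed.

Lemma nonneg_kernelZ (c : R) k : (0 <= c)%R -> nonneg_kernel k ->
  nonneg_kernel (fun x y => c%:E * k x y).
Proof.
move=> c0 [mk k0]; split => [|x y]; last by rewrite mule_ge0.
exact: measurable_funeM.
Qed.

Lemma nonneg_kernel_fst (f : B -> \bar R) : measurable_fun setT f ->
  (forall x, 0 <= f x) -> nonneg_kernel (fun x _ => f x).
Proof. by move=> mf f0; split => //; exact: measurableT_comp. Qed.

Lemma measurable_inner k Z : nonneg_kernel k -> measurable Z ->
  measurable_fun setT (fun x => \int[lam]_(y in Z) k x y).
Proof. by move=> [mk k0] mZ; exact: measurable_integral_subset. Qed.

Lemma inner_ge0 k Z x : nonneg_kernel k -> 0 <= \int[lam]_(y in Z) k x y.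
Proof. by move=> [_ k0]; apply: integral_ge0. Qed.

Lemma iint_ge0 k A Z : nonneg_kernel k -> 0 <= iint k A Z.
Proof. by move=> kk; apply: integral_ge0 => x _; exact: inner_ge0. Qed.

Lemma iintC k A Z : nonneg_kernel k -> measurable A -> measurable Z ->
  iint k A Z = iint (fun x y => k y x) Z A.
Proof. by move=> [mk k0] mA mZ; exact: tonelli_subset. Qed.

Lemma le_iint k k' A Z : nonneg_kernel k -> nonneg_kernel k' ->
  measurable A -> measurable Z ->
  (forall x y, A x -> Z y -> k x y <= k' x y) -> iint k A Z <= iint k' A Z.
Proof.
move=> kk kk' mA mZ le; apply: ge0_le_integral => //.
- by move=> x _; exact: inner_ge0.
- by apply: measurable_funTS; exact: measurable_inner.
- by apply: measurable_funTS; exact: measurable_inner.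
- move=> x Ax; apply: ge0_le_integral => //.
  + by move=> y _; exact: kk.2.
  + by apply: measurable_funTS; exact: nonneg_kernel1.
  + by apply: measurable_funTS; exact: nonneg_kernel1.
  + by move=> y; exact: le.
Qed.

Lemma iint_subset k A Z A' Z' : nonneg_kernel k ->
  measurable A -> measurable Z -> measurable A' -> measurable Z' ->
  A `<=` A' -> Z `<=` Z' -> iint k A Z <= iint k A' Z'.
Proof.
move=> kk mA mZ mA' mZ' AA' ZZ'.
apply: (@le_trans _ _ (iint k A' Z)).
  apply: ge0_subset_integral => //.
    by apply: measurable_funTS; exact: measurable_inner.
  by move=> x _; exact: inner_ge0.
apply: ge0_le_integral => //.
- by move=> x _; exact: inner_ge0.
- by apply: measurable_funTS; exact: measurable_inner.
- by apply: measurable_funTS; exact: measurable_inner.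
- move=> x _; apply: ge0_subset_integral => //.
    by apply: measurable_funTS; exact: nonneg_kernel1.
  by move=> y _; exact: kk.2.
Qed.

Lemma iintZ (c : R) k A Z : (0 <= c)%R -> nonneg_kernel k ->
  measurable A -> measurable Z -> iint (fun x y => c%:E * k x y) A Z = c%:E * iint k A Z.
Proof.
move=> c0 kk mA mZ; rewrite /iint -ge0_integralZl_EFin//; last 2 first.
- by move=> x _; exact: inner_ge0.
- by apply: measurable_funTS; exact: measurable_inner.
apply: eq_integral => x _; rewrite ge0_integralZl_EFin//.
- by move=> y _; exact: kk.2.
- by apply: measurable_funTS; exact: nonneg_kernel1.
Qed.

Lemma iintD k k' A Z : nonneg_kernel k -> nonneg_kernel k' ->
  measurable A -> measurable Z ->
  iint (fun x y => k x y + k' x y) A Z = iint k A Z + iint k' A Z.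
Proof.
move=> kk kk' mA mZ; rewrite /iint -ge0_integralD//; last 4 first.
- by move=> x _; exact: inner_ge0.
- by apply: measurable_funTS; exact: measurable_inner.
- by move=> x _; exact: inner_ge0.
- by apply: measurable_funTS; exact: measurable_inner.
apply: eq_integral => x _; rewrite ge0_integralD//.
- by move=> y _; exact: kk.2.
- by apply: measurable_funTS; exact: nonneg_kernel1.
- by move=> y _; exact: kk'.2.
- by apply: measurable_funTS; exact: nonneg_kernel1.
Qed.

Lemma iint_fst (f : B -> \bar R) A Z : measurable_fun setT f -> (forall x, 0 <= f x) ->
  measurable A -> measurable Z ->
  iint (fun x _ => f x) A Z = lam Z * \int[lam]_(x in A) f x.
Proof.
move=> mf f0 mA mZ; rewrite -ge0_integralZl//; last by exact: measurable_funTS.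
apply: eq_integral => x _; by rewrite integral_cst// muleC.
Qed.

End iterated_integrals.

(** * Power inequalities and a weak Hoelder inequality *)

Section powR_inequalities.
Context (R : realType).
Implicit Types a b q : R.

(** Convexity of the power at the midpoint of a and b. The constant 2^(q-1) is sharp, and the
    halving argument for order n + q has room for no other. *)
Lemma powRD_le a b q : 1 <= q -> 0 <= a -> 0 <= b ->
  (a + b) `^ q <= 2 `^ (q - 1) * (a `^ q + b `^ q).
Proof.
move=> q1 a0 b0.
have h0 : 0 <= 2^-1 :> R by rewrite invr_ge0.
have h1 : 2^-1 <= 1 :> R by rewrite invf_le1 ?ler1n.
have : (2^-1 * (2 * a) + unstable.onem 2^-1 * (2 * b)) `^ q <=
       2^-1 * (2 * a) `^ q + unstable.onem 2^-1 * (2 * b) `^ q.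
  by apply: (@convex_powR R q q1 (Itv01 h0 h1) (2 * a) (2 * b));
    rewrite inE/= in_itv/= andbT mulr_ge0.
have -> : unstable.onem 2^-1 = 2^-1 :> R by rewrite /unstable.onem; lra.
rewrite !mulrA mulVf// !mul1r => /le_trans; apply.
rewrite !powRM// powRB ?pnatr_eq0 ?implybT// powRr1//.
by rewrite le_eqVlt; apply/orP; left; apply/eqP; ring.
Qed.

Lemma powR_2M q : 2 * 2 `^ (q - 1) = 2 `^ q :> R.
Proof. by rewrite powRB ?pnatr_eq0 ?implybT// powRr1// mulrCA mulfV ?mulr1. Qed.

(** A monotone function is bounded by the sum of its values at the ends, whichever its sense. *)
Lemma powR_sandwich (a b t s : R) : 0 < a -> a <= t -> t <= b ->
  t `^ s <= a `^ s + b `^ s.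
Proof.
move=> a0 at_ tb; have t0 := lt_le_trans a0 at_.
have [s0|s0] := leP 0 s.
  apply: (@le_trans _ _ (b `^ s)); last by rewrite lerDr powR_ge0.
  by apply: ge0_ler_powR => //; rewrite nnegrE ltW// (lt_le_trans t0).
apply: (@le_trans _ _ (a `^ s)); last by rewrite lerDl powR_ge0.
exact: le0_ger_powR (ltW s0) _ _.
Qed.

End powR_inequalities.

Section weak_hoelder.
Context d (T : measurableType d) (R : realType) (mu : {measure set T -> \bar R}).
Local Open Scope ereal_scope.

(** Integrate s^(r-1) t <= t^r + s^r at t = f x: the left side is at most s^r when f x <= s and
    at most (f x)^r otherwise. With s the r-th mean of f, the two terms on the right become equal. The
    factor 2^r replaces the sharp constant 1. *)
Lemma weak_hoelder (A : set T) (v r : R) (f : T -> R) :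
  measurable A -> mu A = v%:E -> (0 < v)%R -> (1 <= r)%R ->
  measurable_fun A f -> (forall x, A x -> 0 <= f x)%R ->
  (\int[mu]_(x in A) (f x)%:E) `^ r <=
  (2 `^ r * v `^ (r - 1))%:E * \int[mu]_(x in A) (f x `^ r)%:E.
Proof.
move=> mA Av v0 r1 mf f0; have r0 : (0 < r)%R by exact: lt_le_trans r1.
set J := \int[mu]_(x in A) (f x)%:E; set I := \int[mu]_(x in A) (f x `^ r)%:E.
have J0 : 0 <= J by apply: integral_ge0 => x Ax; rewrite lee_fin f0.
have I0 : 0 <= I by apply: integral_ge0 => x Ax; rewrite lee_fin powR_ge0.
have c0 : (0 < 2 `^ r * v `^ (r - 1))%R by rewrite mulr_gt0 ?powR_gt0.
have [Ioo|Ifin] := eqVneq I +oo.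
  by rewrite Ioo gt0_muley ?lte_fin// leey.
have {}Ifin : I \is a fin_num by rewrite ge0_fin_numE// ltey.
have key s : (0 < s)%R -> (s `^ (r - 1))%:E * J <= I + (s `^ r * v)%:E.
  move=> s0; rewrite /J -ge0_integralZl_EFin ?powR_ge0//; last exact/measurable_EFinP.
  have -> : (s `^ r * v)%:E = \int[mu]_(x in A) (s `^ r)%:E.
    by rewrite integral_cst// EFinM Av.
  rewrite /I -ge0_integralD//; last 3 first.
  - by move=> x Ax; rewrite lee_fin powR_ge0.
  - by apply/measurable_EFinP; exact: measurable_powR_comp.
  - by move=> x Ax; rewrite lee_fin powR_ge0.
  apply: ge0_le_integral => //.
  - by move=> x Ax; rewrite lee_fin mulr_ge0 ?powR_ge0 ?f0.
  - by apply: measurable_funeM; exact/measurable_EFinP.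
  - apply: emeasurable_funD => //.
    by apply/measurable_EFinP; exact: measurable_powR_comp.
  move=> x Ax; rewrite -EFinD -EFinM lee_fin.
  have fx0 := f0 x Ax; have [fs|sf] := leP (f x) s.
    rewrite (@le_trans _ _ (s `^ r))%R ?lerDr ?powR_ge0//.
    by rewrite mulrC -(mulr_powRB1 (ltW s0) r0) ler_wpM2r ?powR_ge0.
  rewrite (@le_trans _ _ (f x `^ r))%R ?lerDl ?powR_ge0//.
  rewrite mulrC -(mulr_powRB1 fx0 r0) ler_wpM2l//.
  by apply: ge0_ler_powR; rewrite ?subr_ge0 ?nnegrE ?(ltW s0) ?(ltW sf).
have Jfin : J \is a fin_num.
  rewrite ge0_fin_numE//; have := key 1%R ltr01.
  rewrite powR1 mul1e => /le_lt_trans; apply.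
  by rewrite lte_add_pinfty ?ltry// -ge0_fin_numE.
move: key; rewrite -(fineK Ifin) -(fineK Jfin); set i := fine I; set j := fine J => key.
have i0 : (0 <= i)%R by rewrite fine_ge0.
have j0 : (0 <= j)%R by rewrite fine_ge0.
rewrite poweR_EFin -EFinM lee_fin; apply/ler_addgt0Pr => e e0.
pose e' := (e / (2 `^ r * v `^ (r - 1)))%R.
have e'0 : (0 < e')%R by rewrite divr_gt0.
have -> : (2 `^ r * v `^ (r - 1) * i + e = 2 `^ r * v `^ (r - 1) * (i + e'))%R.
  by rewrite mulrDr /e' mulrCA mulfV ?mulr1// gt_eqF.
(* The r-th mean of f, made positive by e'. *)
pose s := (((i + e') / v) `^ r^-1)%R.
have iv0 : (0 < (i + e') / v)%R by rewrite divr_gt0// ltr_wpDl.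
have s0 : (0 < s)%R by rewrite powR_gt0.
have sr : (s `^ r = (i + e') / v)%R.
  by rewrite /s -powRrM mulVf ?gt_eqF// powRr1// ltW.
have := key s s0; rewrite -EFinM -EFinD lee_fin sr divfK ?gt_eqF// => k1.
have k2 : (s `^ (r - 1) * j <= s `^ (r - 1) * (2 * s * v))%R.
  apply: (le_trans k1); have -> : (s `^ (r - 1) * (2 * s * v) = 2 * (s * s `^ (r - 1)) * v)%R by ring.
  rewrite mulr_powRB1 ?(ltW s0)// sr -mulrA divfK ?gt_eqF//.
  by rewrite mulr_natl mulr2n lerD2r lerDl ltW.
have k3 : (j <= 2 * s * v)%R by rewrite -(ler_pM2l (powR_gt0 (r - 1) s0)).
apply: (@le_trans _ _ ((2 * s * v) `^ r)%R).
  by apply: ge0_ler_powR; rewrite ?nnegrE ?(ltW r0) ?mulr_ge0 ?(ltW s0) ?(ltW v0).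
rewrite !powRM ?mulr_ge0 ?(ltW s0) ?(ltW v0)// sr.
rewrite -(mulr_powRB1 (ltW v0) r0).
by rewrite le_eqVlt; apply/orP; left; apply/eqP; field; rewrite gt_eqF.
Qed.

End weak_hoelder.

(** * Oscillation and difference quotients *)

Section oscillation.
Context (R : realType) (n : nat) (q : R) (F : 'rV[R]_n -> R).
Local Open Scope ereal_scope.
Local Notation lam := (borel_lebesgue R n).
Local Notation E := (@euclid_norm R n).
Local Notation B := (borel_rV R n).

Definition osc (x y : 'rV[R]_n) : R := (`|F x - F y| `^ q)%R.

Definition oscE : B -> B -> \bar R := fun x y => (osc x y)%:E.

(** The integrand of the seminorms, of order s = n + alpha q. It vanishes on the diagonal
    whatever the power of 0 is, since osc does. *)
Definition diffq (s : R) : B -> B -> \bar R := fun x y => (osc x y * E (x - y) `^ (- s))%:E.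

Hypothesis q1 : (1 <= q)%R.
Hypothesis mF : measurable_fun setT (F : B -> R).

Let q0 : (0 < q)%R. Proof. exact: lt_le_trans q1. Qed.

Lemma osc_EFin x y : oscE x y = (osc x y)%:E.
Proof. by []. Qed.

Lemma diffqE s x y : diffq s x y = (osc x y * E (x - y) `^ (- s))%:E.
Proof. by []. Qed.

Lemma osc_ge0 x y : (0 <= osc x y)%R. Proof. exact: powR_ge0. Qed.

Lemma oscC x y : osc x y = osc y x. Proof. by rewrite /osc distrC. Qed.

Lemma osc_xx x : osc x x = 0%R.
Proof. by rewrite /osc subrr normr0 powR0// gt_eqF. Qed.

Lemma osc_eq0 x y : osc x y = 0%R -> F x = F y.
Proof. by move/powR_eq0_eq0/eqP; rewrite normr_eq0 subr_eq0 => /eqP. Qed.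

Lemma osc_triangle x y z : (osc x y <= 2 `^ (q - 1) * (osc x z + osc z y))%R.
Proof.
apply: le_trans (powRD_le q1 (normr_ge0 _) (normr_ge0 _)).
apply: ge0_ler_powR; rewrite ?nnegrE ?(ltW q0) ?addr_ge0//.
by rewrite (le_trans _ (ler_normD _ _))// addrA subrK.
Qed.

Lemma nonneg_kernel_EFin (h : B -> B -> R) :
  measurable_fun setT (fun z : B * B => h z.1 z.2) -> (forall x y, 0 <= h x y)%R ->
  nonneg_kernel (fun x y => (h x y)%:E).
Proof. by move=> mh h0; split => [|x y]; [exact/measurable_EFinP|rewrite lee_fin]. Qed.

Lemma measurable_osc : measurable_fun setT (fun z : B * B => osc z.1 z.2).
Proof.
apply: measurable_powR_comp; apply: measurableT_comp => //.
by apply: measurable_funB; exact: measurableT_comp.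
Qed.

Lemma measurable_dist : measurable_fun setT (fun z : B * B => E (z.1 - z.2)).
Proof. exact: measurable_euclid_dist. Qed.

Lemma nonneg_kernel_osc : nonneg_kernel oscE.
Proof. by apply: nonneg_kernel_EFin => [|x y]; [exact: measurable_osc|exact: osc_ge0]. Qed.

Lemma nonneg_kernel_diffq s : nonneg_kernel (diffq s).
Proof.
apply: nonneg_kernel_EFin => [|x y]; last by rewrite mulr_ge0 ?powR_ge0.
apply: measurable_funM; first exact: measurable_osc.
by apply: measurable_powR_comp; exact: measurable_dist.
Qed.

(** A bound of osc x y by a function of x plus the same function of y, such as a choice of third
    point provides, integrates to a bound by a single integral over K. *)
Lemma averaging (K : set B) (phi : B -> \bar R) (c v : R) :
  measurable K -> measurable_fun setT phi -> (forall x, 0 <= phi x) ->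
  (0 <= c)%R -> (0 <= v)%R ->
  (forall x y, K x -> K y -> (v * osc x y)%:E <= c%:E * (phi x + phi y)) ->
  v%:E * iint oscE K K <= (2 * c)%:E * (lam K * \int[lam]_(x in K) phi x).
Proof.
move=> mK mphi phi0 c0 v0 le.
have k1 := nonneg_kernel_fst mphi phi0; have k2 := nonneg_kernelC k1.
rewrite -iintZ//; last exact: nonneg_kernel_osc.
apply: (@le_trans _ _ (iint (fun x y => c%:E * (phi x + phi y)) K K)).
  apply: le_iint => //.
  - by apply: nonneg_kernelZ => //; exact: nonneg_kernel_osc.
  - by apply: nonneg_kernelZ => //; exact: nonneg_kernelD.
rewrite iintZ//; last exact: nonneg_kernelD.
rewrite iintD// -[iint (fun x y => phi y) K K](iintC k1)//.
rewrite iint_fst// (_ : 2 * c = c + c)%R; last by rewrite mulr_natl mulr2n.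
have X0 : 0 <= lam K * \int[lam]_(x in K) phi x by rewrite mule_ge0// integral_ge0.
by rewrite EFinD ge0_muleDl// ge0_muleDr.
Qed.

(** Average |F x - F y|^q <= 2^(q-1) (|F x - F z|^q + |F z - F y|^q) over the third point z in Z. *)
Lemma compare_osc (K Z : set B) v : measurable K -> measurable Z ->
  lam Z = v%:E -> v%:E * iint oscE K K <= (2 `^ q)%:E * (lam K * iint oscE K Z).
Proof.
move=> mK mZ Zv.
have v0 : (0 <= v)%R by rewrite -lee_fin -Zv.
rewrite -powR_2M; apply: averaging => //; try exact: powR_ge0.
- by apply: measurable_inner => //; exact: nonneg_kernel_osc.
- by move=> x; apply: inner_ge0; exact: nonneg_kernel_osc.
have mo x : measurable_fun Z (oscE x).
  by apply: measurable_funTS; apply: nonneg_kernel1; exact: nonneg_kernel_osc.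
have o0 x y : 0 <= oscE x y by rewrite lee_fin osc_ge0.
move=> x y Kx Ky; rewrite -ge0_integralD//.
rewrite -ge0_integralZl_EFin ?powR_ge0//; last 2 first.
- by move=> z _; rewrite adde_ge0.
- exact: emeasurable_funD.
rewrite mulrC EFinM -Zv -integral_cst//; apply: ge0_le_integral => //.
- by move=> z _; rewrite lee_fin osc_ge0.
- by apply: measurable_funeM; exact: emeasurable_funD.
- by move=> z _; rewrite -EFinD -EFinM lee_fin (oscC y z); exact: osc_triangle.
Qed.

Definition far (r : R) : B -> B -> \bar R := fun x y =>
  (osc x y * \1_[set z : B * B | (r <= E (z.1 - z.2))%R] (x, y))%:E.

Lemma measurable_far r : measurable [set z : B * B | (r <= E (z.1 - z.2))%R].
Proof.
rewrite [X in measurable X](_ : _ = (fun z : B * B => E (z.1 - z.2)) @^-1` `[r, +oo[).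
  by rewrite -[X in measurable X]setTI; exact: measurable_dist.
by apply/seteqP; split => y; rewrite /= in_itv/= andbT.
Qed.

Lemma measurable_far1 r w : measurable ([set z | (r <= E (w - z))%R] : set B).
Proof.
rewrite [X in measurable X](_ : _ = (fun z : B => E (w - z)) @^-1` `[r, +oo[).
  rewrite -[X in measurable X]setTI.
  by apply: (@measurable_euclid_dist _ _ _ B (cst w) id).
by apply/seteqP; split => y; rewrite /= in_itv/= andbT.
Qed.

Lemma nonneg_kernel_far r : nonneg_kernel (far r).
Proof.
apply: nonneg_kernel_EFin => [|x y]; last by rewrite mulr_ge0 ?powR_ge0.
rewrite [X in measurable_fun _ X](_ : _ = (fun z : B * B => osc z.1 z.2 *
  \1_[set z : B * B | (r <= E (z.1 - z.2))%R] z)%R); last by apply/funext => -[].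
apply: measurable_funM; first exact: measurable_osc.
by apply: measurable_indic; exact: measurable_far.
Qed.

Hypothesis n1 : (0 < n)%N.

(** The points of Q at distance less than l / 8 from x or from y lie in two boxes of edge l / 4,
    of total volume at most half that of Q. *)
Lemma far_volume l Q (x y : 'rV[R]_n) : (0 < l)%R -> cube l Q ->
  (l ^+ n / 2)%:E <= lam (Q `&` [set z | l / 8 <= E (x - z)]%R
                            `&` [set z | l / 8 <= E (y - z)]%R).
Proof.
move=> l0 cQ; have mQ := measurable_cube cQ.
pose b w : set B := obox (w - const_mx (l / 8))%R (w + const_mx (l / 8))%R.
have mb w : measurable (b w) by exact: measurable_obox.
have mfar w := measurable_far1 (l / 8)%R w.
set S := _ `&` _ `&` _; have mS : measurable (S : set B).
  by apply: measurableI => //; apply: measurableI.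
have lb w : lam (b w) <= (l ^+ n / 4)%:E.
  have -> : lam (b w) = ((2 * (l / 8)) ^+ n)%:E.
    by apply: lebesgue_obox_centre; rewrite divr_ge0// ltW.
  rewrite lee_fin (_ : 2 * (l / 8) = l * 4^-1)%R; last by field.
  rewrite exprMn ler_wpM2l ?exprn_ge0 ?(ltW l0)// -[leRHS]expr1.
  by rewrite ler_wiXn2l// invf_le1 ?ler1n.
have QS : Q `<=` S `|` (b x `|` b y).
  move=> z Qz; have [xz|xz] := leP (l / 8)%R (E (x - z)); last first.
    by right; left; exact: ball_sub_obox.
  have [yz|yz] := leP (l / 8)%R (E (y - z)); last first.
    by right; right; exact: ball_sub_obox.
  by left.
have : lam Q <= lam S + (lam (b x) + lam (b y)).
  apply: (@le_trans _ _ (lam (S `|` (b x `|` b y)))).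
    by apply: le_measure; rewrite ?inE//; apply: measurableU => //; exact: measurableU.
  apply: (le_trans (measureU2 _ mS _)); first exact: measurableU.
  by rewrite leeD2l// measureU2.
have -> : lam Q = (l ^+ n)%:E := lebesgue_cube l0 cQ.
have Sfin : lam S \is a fin_num.
  rewrite ge0_fin_numE//; apply: (@le_lt_trans _ _ (lam Q)).
    by apply: le_measure; rewrite ?inE// => z [[]].
  by rewrite [lam Q](lebesgue_cube l0 cQ) ltry.
move=> /le_trans/(_ (leeD2l _ (leeD (lb x) (lb y)))).
rewrite -(fineK Sfin) -!EFinD !lee_fin; lra.
Qed.

Lemma farE r x y : far r x y = (osc x y * \1_[set z : B * B | (r <= E (z.1 - z.2))%R] (x, y))%:E.
Proof. by []. Qed.

(** Average over third points z that are far from both x and y; far_volume says that they fill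
    half of Q. *)
Lemma osc_le_far l Q : (0 < l)%R -> cube l Q ->
  iint oscE Q Q <= (2 * 2 `^ q)%:E * iint (far (l / 8)) Q Q.
Proof.
move=> l0 cQ; have mQ := measurable_cube cQ.
have kf := nonneg_kernel_far (l / 8)%R.
have mphi := measurable_inner kf mQ.
have ln0 : (0 < l ^+ n)%R by exact: exprn_gt0.
have := @averaging Q (fun x => \int[lam]_(y in Q) far (l / 8)%R x y)
  (2 `^ (q - 1))%R (l ^+ n / 2)%R mQ mphi (fun x => inner_ge0 Q x kf) (powR_ge0 _ _)
  (ltW (divr_gt0 ln0 (ltr0n _ 2))).
rewrite powR_2M [lam Q](lebesgue_cube l0 cQ) -/(iint _ _ _) => H.
suff H' : (l ^+ n / 2)%:E * iint oscE Q Q <=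
           (2 `^ q)%:E * ((l ^+ n)%:E * iint (far (l / 8)) Q Q).
  rewrite -(@lee_pmul2l _ (l ^+ n / 2)%:E) ?lte_fin ?divr_gt0//.
  apply: (le_trans H'); rewrite !muleA -!EFinM.
  by rewrite (_ : l ^+ n / 2 * (2 * 2 `^ q) = 2 `^ q * l ^+ n)%R//; field.
apply: H => x y Qx Qy; set S := Q `&` [set z | l / 8 <= E (x - z)]%R
                            `&` [set z | l / 8 <= E (y - z)]%R.
have mS : measurable (S : set B).
  have mfar w := measurable_far1 (l / 8)%R w.
  by apply: measurableI => //; apply: measurableI.
have mk w D : measurable D -> measurable_fun D (far (l / 8)%R w).
  by move=> _; apply: measurable_funTS; exact: nonneg_kernel1.
have k0 w z : 0 <= far (l / 8)%R w z by exact: kf.2.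
apply: (@le_trans _ _ (\int[lam]_(z in S) (osc x y)%:E)).
  rewrite integral_cst// mulrC EFinM lee_wpmul2l ?lee_fin ?osc_ge0//.
  exact: far_volume.
rewrite -ge0_integralD//; [|exact: mk|exact: mk].
rewrite -ge0_integralZl_EFin ?powR_ge0//; last 2 first.
- by move=> z _; rewrite adde_ge0.
- by apply: emeasurable_funD; exact: mk.
apply: (@le_trans _ _ (\int[lam]_(z in S)
   ((2 `^ (q - 1))%:E * (far (l / 8)%R x z + far (l / 8)%R y z)))).
  apply: ge0_le_integral => //.
  - by move=> z _; rewrite lee_fin osc_ge0.
  - by apply: measurable_funeM; apply: emeasurable_funD; exact: mk.
  move=> z [[Qz /= xz] /= yz]; rewrite /far !indicE !mem_set//= !mulr1.
  by rewrite -EFinD -EFinM lee_fin (oscC y z); exact: osc_triangle.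
apply: ge0_subset_integral => //.
- by apply: measurable_funeM; apply: emeasurable_funD; exact: mk.
- by move=> z _; apply: mule_ge0; [rewrite lee_fin powR_ge0|exact: adde_ge0].
- by move=> z [[]].
Qed.

End oscillation.

Lemma ge0_integral_eq0_ae d (T : measurableType d) (R : realType)
    (mu : {measure set T -> \bar R}) (D : set T) (f : T -> \bar R) :
  measurable D -> measurable_fun D f -> (forall x, D x -> 0 <= f x)%E ->
  (\int[mu]_(x in D) f x = 0 -> {ae mu, forall x, D x -> f x = 0})%E.
Proof.
move=> mD mf f0 fD; apply/(ae_eq_integral_abs mu mD mf).
by rewrite -fD; apply: eq_integral => x /set_mem Dx; rewrite gee0_abs// f0.
Qed.

Lemma eq0_of_bounded_multiples (R : realType) (D M : \bar R) :
  (0 <= D -> M < +oo -> (forall J : nat, J%:R%:E * D <= M) -> D = 0)%E.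
Proof.
move=> D0 Moo H.
have Dfin : D \is a fin_num.
  by rewrite ge0_fin_numE// (le_lt_trans _ Moo)// -[leLHS]mul1e; exact: (H 1%N).
have Mfin : M \is a fin_num.
  by rewrite ge0_fin_numE// -(mul0e D); exact: (H 0%N).
apply/eqP; rewrite eq_le D0 andbT leNgt; apply/negP => Dgt0.
have d0 : (0 < fine D)%R by rewrite fine_gt0// Dgt0 -ge0_fin_numE.
have := H (Num.truncn (fine M / fine D)).+1.
rewrite -(fineK Dfin) -(fineK Mfin) -EFinM lee_fin -ler_pdivlMr// leNgt.
by rewrite truncnS_gt.
Qed.

Lemma eq0_of_decay (R : realType) (D : \bar R) (c e r : R) : (0 <= D)%E -> 0 < r -> e < 0 ->
  (forall l, r <= l -> (D <= (c * l `^ e)%:E)%E) -> D = 0%E.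
Proof.
move=> D0 r0 e0 key.
have c0 : 0 <= c.
  have := le_trans D0 (key r (lexx r)); rewrite lee_fin pmulr_lge0// powR_gt0//.
have Dfin : D \is a fin_num.
  by rewrite ge0_fin_numE// (le_lt_trans (key _ (lexx _)))// ltry.
apply/eqP; rewrite eq_le D0 andbT leNgt; apply/negP => Dgt0.
have d0 : (0 < fine D) by rewrite fine_gt0// Dgt0 -ge0_fin_numE.
(* At this l the factor l^e is at most D / (c + 1), so the bound is below D. *)
pose l := Num.max r (((c + 1) / fine D) `^ (- e^-1)).
have cD0 : (0 < (c + 1) / fine D) by rewrite divr_gt0// ltr_wpDl.
have l0 : (0 < l) by rewrite lt_max r0.
have := key l; rewrite le_max lexx => /(_ isT).
rewrite -(fineK Dfin) lee_fin leNgt => /negP; apply.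
have : (l `^ e <= fine D / (c + 1)).
  have -> : (fine D / (c + 1) = (((c + 1) / fine D) `^ (- e^-1)) `^ e).
    rewrite -powRrM mulNr mulVf ?lt_eqF// powRN powRr1 ?(ltW cD0)//.
    by rewrite invf_div.
  apply: le0_ger_powR; [exact: ltW|by rewrite powR_gt0|by rewrite le_max lexx orbT].
move=> /(ler_wpM2l c0)/le_lt_trans; apply.
by rewrite mulrCA gtr_pMr// ltr_pdivrMr ?ltr_wpDl// mul1r ltrDl ltr01.
Qed.


(** * Vanishing of the oscillation *)

Section vanishing.
Context (R : realType) (n : nat) (q : R) (F : 'rV[R]_n -> R).
Local Open Scope ereal_scope.
Local Notation lam := (borel_lebesgue R n).
Local Notation E := (@euclid_norm R n).
Local Notation B := (borel_rV R n).
Local Notation osc := (osc q F).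
Local Notation oscE := (oscE q F).
Local Notation diffq := (diffq q F).
Local Notation far := (far q F).
Hypothesis q1 : (1 <= q)%R.
Hypothesis mF : measurable_fun setT (F : B -> R).
Hypothesis n1 : (0 < n)%N.

Let q0 : (0 < q)%R. Proof. exact: lt_le_trans q1. Qed.
Let kosc := nonneg_kernel_osc q mF.
Let kdiff s := nonneg_kernel_diffq q mF s.
Let kfar r := nonneg_kernel_far q mF r.

Let sqn : R := Num.sqrt n%:R.
Let sqn0 : (0 < sqn)%R. Proof. by rewrite sqrtr_gt0 ltr0n. Qed.

(** On pairs of Q at distance at least l / 8 the weight E (x - y)^-s is comparable to l^-s, for
    either sign of s. *)
Lemma far_le_diffq l Q s : (0 < l)%R -> cube l Q ->
  iint (far (l / 8)) Q Q <= ((8^-1 `^ s + sqn `^ s) * l `^ s)%:E * iint (diffq s) Q Q.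
Proof.
move=> l0 cQ; have mQ := measurable_cube cQ.
have c0 : (0 <= (8^-1 `^ s + sqn `^ s) * l `^ s)%R.
  by rewrite mulr_ge0 ?addr_ge0 ?powR_ge0.
rewrite -iintZ//; apply: le_iint => //; first exact: nonneg_kernelZ.
move=> x y Qx Qy; rewrite farE diffqE -EFinM lee_fin indicE.
have [|_] := boolP ((x, y) \in _); last first.
  by rewrite mulr0 !mulr_ge0 ?addr_ge0 ?powR_ge0.
rewrite inE/= => lE; rewrite mulr1 mulrCA ler_peMr ?powR_ge0//.
have El := cube_dist (ltW l0) cQ Qx Qy.
have l80 : (0 < l / 8)%R by rewrite divr_gt0.
have E0 := lt_le_trans l80 lE.
rewrite powRN ler_pdivlMr ?powR_gt0// mul1r.
apply: (le_trans (powR_sandwich s l80 lE El)).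
by rewrite mulrDl (mulrC l) !powRM ?(ltW l0) ?(ltW sqn0) ?invr_ge0.
Qed.

Definition osc_const s : R := (2 * 2 `^ q * (8^-1 `^ s + sqn `^ s))%R.

Lemma osc_const_ge0 s : (0 <= osc_const s)%R.
Proof. by rewrite !mulr_ge0 ?addr_ge0 ?powR_ge0. Qed.

(** For s < 0 the weight of the difference quotient is small near the diagonal, so a pointwise
    comparison fails; restricting to far pairs first makes the bound valid for every s. *)
Lemma osc_le_diffq l Q s : (0 < l)%R -> cube l Q ->
  iint oscE Q Q <= (osc_const s * l `^ s)%:E * iint (diffq s) Q Q.
Proof.
move=> l0 cQ; apply: (le_trans (osc_le_far q1 mF n1 l0 cQ)).
have -> : (osc_const s * l `^ s)%:E =
    (2 * 2 `^ q)%:E * ((8^-1 `^ s + sqn `^ s) * l `^ s)%:E.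
  by rewrite -EFinM /osc_const mulrA.
rewrite -muleA.
by apply: lee_wpmul2l; [rewrite lee_fin mulr_ge0 ?powR_ge0|exact: far_le_diffq].
Qed.

(** Distances in Q are at most sqn * l, so lowering the order costs a power of sqn * l. *)
Lemma diffq_le l Q t s x y : (0 < l)%R -> cube l Q -> (t <= s)%R -> Q x -> Q y ->
  (osc x y * E (x - y) `^ (- t) <=
   (sqn * l) `^ (s - t) * (osc x y * E (x - y) `^ (- s)))%R.
Proof.
move=> l0 cQ ts Qx Qy.
have [->|xy] := eqVneq x y; first by rewrite osc_xx// !mul0r mulr0.
rewrite mulrCA ler_wpM2l ?osc_ge0//.
have E0 : (0 < E (x - y))%R by rewrite euclid_norm_gt0 subr_eq0.
have -> : (E (x - y) `^ (- t) = E (x - y) `^ (s - t) * E (x - y) `^ (- s))%R.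
  rewrite -powRD; last by rewrite (gt_eqF E0) implybT.
  by congr powR; ring.
rewrite ler_wpM2r ?powR_ge0//; apply: ge0_ler_powR.
- by rewrite subr_ge0.
- by rewrite nnegrE ltW.
- by rewrite nnegrE mulr_ge0 ?(ltW l0) ?(ltW sqn0).
- exact: cube_dist (ltW l0) cQ Qx Qy.
Qed.

Lemma diffq_mono l Q t s : (0 < l)%R -> cube l Q -> (t <= s)%R ->
  iint (diffq t) Q Q <= ((sqn * l) `^ (s - t))%:E * iint (diffq s) Q Q.
Proof.
move=> l0 cQ ts; have mQ := measurable_cube cQ.
rewrite -iintZ ?powR_ge0//; apply: le_iint => //.
  by apply: nonneg_kernelZ; rewrite ?powR_ge0.
by move=> x y Qx Qy; rewrite diffqE -EFinM lee_fin; exact: diffq_le cQ _ _ _.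
Qed.

Definition near_diffq (s r : R) : B -> B -> \bar R := fun x y =>
  (osc x y * E (x - y) `^ (- s) * \1_[set z : B * B | (E (z.1 - z.2) < r)%R] (x, y))%:E.

Lemma nonneg_kernel_near_diffq s r : nonneg_kernel (near_diffq s r).
Proof.
apply: nonneg_kernel_EFin => [|x y]; last by rewrite !mulr_ge0 ?powR_ge0.
rewrite [X in measurable_fun _ X](_ : _ = (fun z : B * B => osc z.1 z.2 *
  E (z.1 - z.2) `^ (- s) * \1_[set z : B * B | (E (z.1 - z.2) < r)%R] z)%R); last first.
  by apply/funext => -[].
apply: measurable_funM.
  apply: measurable_funM; first exact: measurable_osc.
  by apply: measurable_powR_comp; exact: measurable_dist.
apply: measurable_indic.
rewrite [X in measurable X](_ : _ = (fun z : B * B => E (z.1 - z.2)) @^-1` `]-oo, r[).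
  by rewrite -[X in measurable X]setTI; exact: measurable_dist.
by apply/seteqP; split => y; rewrite /= in_itv.
Qed.

Definition midpoint (x y : 'rV[R]_n) : 'rV[R]_n := (2^-1 *: y + 2^-1 *: x)%R.

Lemma midpointC x y : midpoint x y = midpoint y x.
Proof. by rewrite /midpoint addrC. Qed.

Lemma dist_midpoint x y : (E (x - midpoint x y) = E (x - y) / 2)%R.
Proof.
have -> : (x - midpoint x y = 2^-1 *: (x - y))%R.
  rewrite /midpoint opprD scalerBr addrCA addrC; congr (_ - _)%R.
  by rewrite -[X in (X - _)%R](scale1r x) -scalerBl; congr (_ *: _)%R; field.
by rewrite euclid_normZ ger0_norm ?invr_ge0// mulrC.
Qed.

Lemma measurable_midpoint :
  measurable_fun setT (fun z : B * B => midpoint z.1 z.2 : B).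
Proof.
apply: measurable_fun_borel_rV => i.
rewrite [X in measurable_fun _ X](_ : _ = (fun z : B * B =>
  2^-1 * borel_rV_coord i z.2 + 2^-1 * borel_rV_coord i z.1)%R); last first.
  by apply/funext => z; rewrite /= /borel_rV_coord !mxE.
by apply: measurable_funD; apply: measurable_funM => //;
  apply: (measurableT_comp (measurable_borel_rV_coord i)).
Qed.

Lemma nonneg_kernel_midpoint (k : B -> B -> \bar R) : nonneg_kernel k ->
  nonneg_kernel (fun x y => k x (midpoint x y)).
Proof.
move=> [mk k0]; split => //.
have mp : measurable_fun setT (fun z : B * B => (z.1, midpoint z.1 z.2 : B)).
  by apply: measurable_fun_pair => //; exact: measurable_midpoint.
exact: (measurableT_comp mk mp).
Qed.

(** For fixed x the midpoint map is a contraction of Q into Q with Jacobian 2^-n. *)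
Lemma iint_midpoint (k : B -> B -> \bar R) l Q : nonneg_kernel k -> cube l Q ->
  iint (fun x y => k x (midpoint x y)) Q Q <= (2 ^+ n)%:E * iint k Q Q.
Proof.
move=> kk cQ; have mQ := measurable_cube cQ.
have km := nonneg_kernel_midpoint kk.
rewrite /iint -ge0_integralZl_EFin ?exprn_ge0//; last 2 first.
- by move=> x _; exact: inner_ge0.
- by apply: measurable_funTS; exact: measurable_inner.
apply: ge0_le_integral => //.
- by move=> x _; exact: (inner_ge0 Q x km).
- by apply: measurable_funTS; exact: measurable_inner.
- apply: measurable_funTS; apply: measurable_funeM; exact: measurable_inner.
move=> x Qx.
have h0 : (2^-1 != 0 :> R)%R by rewrite invr_eq0.
have mkx : measurable_fun (Q : set B) (k x) by apply: measurable_funTS; exact: nonneg_kernel1.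
have kx0 y : Q y -> 0 <= k x y by move=> _; exact: kk.2.
have := ge0_integral_affine (2^-1 *: x)%R h0 mQ mkx kx0.
rewrite ger0_norm ?invr_ge0// exprVn invrK => <-.
apply: ge0_subset_integral => //.
- exact: measurable_preimage_affine.
- by apply: measurable_funTS; apply: nonneg_kernel1 km.
- by move=> y _; exact: kk.2.
- move=> y Qy; apply: (cube_between cQ Qx Qy) => i; rewrite !mxE.
  rewrite ge_min le_max.
  have [xy|yx] := leP (x ord0 i) (y ord0 i); first by apply/andP; split; apply/orP; [left|right]; lra.
  by apply/andP; split; apply/orP; [right|left]; lra.
Qed.

(** Split F x - F y at the midpoint m of x and y. Halving the distance multiplies the kernel by
    2^(n+q), the power inequality costs 2^(q-1), there are two halves, and the change of
    variables costs 2^n; the exponent n + q is the one at which these combine to the factor 1. *)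
Lemma near_diffq_halving l Q r : cube l Q ->
  iint (near_diffq (n%:R + q) r) Q Q <= iint (near_diffq (n%:R + q) (r / 2)) Q Q.
Proof.
move=> cQ; have mQ := measurable_cube cQ.
set s := (n%:R + q)%R; set k := near_diffq s (r / 2)%R.
have kk : nonneg_kernel k by exact: nonneg_kernel_near_diffq.
have km := nonneg_kernel_midpoint kk; have km' := nonneg_kernelC km.
pose c : R := (2^-1 * 2 ^- n)%R.
have c0 : (0 <= c)%R by rewrite mulr_ge0 ?invr_ge0 ?exprn_ge0.
apply: (@le_trans _ _ (iint (fun x y => c%:E * (k x (midpoint x y) + k y (midpoint y x))) Q Q)).
  apply: le_iint => //; first exact: nonneg_kernel_near_diffq.
    by apply: nonneg_kernelZ => //; exact: nonneg_kernelD.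
  move=> x y Qx Qy; rewrite /k /near_diffq -EFinD -EFinM lee_fin !indicE.
  have -> : (x, midpoint x y) \in [set z : B * B | (E (z.1 - z.2) < r / 2)%R] =
            ((x, y) \in [set z : B * B | (E (z.1 - z.2) < r)%R]).
    apply/idP/idP; rewrite !inE/= dist_midpoint ltr_pM2r ?invr_gt0//.
  have -> : (y, midpoint y x) \in [set z : B * B | (E (z.1 - z.2) < r / 2)%R] =
            ((x, y) \in [set z : B * B | (E (z.1 - z.2) < r)%R]).
    by apply/idP/idP; rewrite !inE/= dist_midpoint (euclid_distC y) ltr_pM2r ?invr_gt0.
  rewrite !dist_midpoint (euclid_distC y) -mulrDl mulrA ler_wpM2r//.
  rewrite -mulrDl mulrA powRM ?euclid_norm_ge0 ?invr_ge0//.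
  rewrite mulrA mulrAC ler_wpM2r ?powR_ge0//.
  have -> : (2^-1 `^ (- s) = 2 ^+ n * 2 `^ q :> R)%R.
    rewrite -powR_inv1// -powRrM mulN1r opprK /s powRD ?pnatr_eq0 ?implybT//.
    by rewrite powR_mulrn.
  rewrite (midpointC y x) (oscC _ _ y); apply: (le_trans (osc_triangle F q1 x y (midpoint x y))).
  rewrite -(powR_2M q) /c le_eqVlt; apply/orP; left; apply/eqP.
  have : (2 ^+ n != 0 :> R)%R by rewrite expf_neq0.
  by move: (2 ^+ n)%R => w w0; field.
rewrite iintZ//; last exact: nonneg_kernelD.
rewrite iintD// -[X in _ + X](iintC km)//.
have := iint_midpoint kk cQ; set X := iint (fun x y => k x (midpoint x y)) Q Q => le.
have X0 : 0 <= X by exact: iint_ge0.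
have -> : X + X = 2%:E * X.
  by rewrite (_ : 2%:E = 1 + 1)// ge0_muleDl// mul1e.
apply: (@le_trans _ _ (c%:E * (2%:E * ((2 ^+ n)%:E * iint k Q Q)))).
  apply: lee_wpmul2l; first by rewrite lee_fin.
  by apply: lee_wpmul2l.
have c2 : (c * (2 * 2 ^+ n) = 1)%R.
  have : (2 ^+ n != 0 :> R)%R by rewrite expf_neq0.
  by rewrite /c; move: (2 ^+ n)%R => w w0; field.
by move: (iint k Q Q) => Y; rewrite [2%:E * _]muleA -EFinM muleA -EFinM c2 mul1e.
Qed.

(** Iterating the halving, the energy of order n + q is carried by pairs at distance less than
    l / 8. As it is finite, the far pairs carry none, so F does not oscillate. *)
Lemma osc_eq0_of_diffq_finite l Q : (0 < l)%R -> cube l Q ->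
  iint (diffq (n%:R + q)) Q Q < +oo -> iint oscE Q Q = 0.
Proof.
move=> l0 cQ Goo; have mQ := measurable_cube cQ; set s := (n%:R + q)%R in Goo *.
(* Twice the bound on the distances in Q, because near pairs are defined by a strict inequality. *)
pose r0 := (2 * sqn * l)%R.
have r00 : (0 < r0)%R by rewrite !mulr_gt0.
have kn r := nonneg_kernel_near_diffq s r.
have H k : iint (diffq s) Q Q <= iint (near_diffq s (r0 / 2 ^+ k)) Q Q.
  elim: k => [|k IH].
    apply: le_iint => // x y Qx Qy; rewrite diffqE /near_diffq expr0 divr1 indicE mem_set ?mulr1//=.
    apply: (le_lt_trans (cube_dist (ltW l0) cQ Qx Qy)).
    by rewrite /r0 -mulrA ltr_pMl ?ltr1n// mulr_gt0.
  apply: (le_trans IH); have := @near_diffq_halving l Q (r0 / 2 ^+ k) cQ.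
  by rewrite exprSr invfM mulrA.
have [k hk] : exists k : nat, (r0 / 2 ^+ k <= l / 8)%R.
  exists (Num.truncn (r0 / (l / 8))).
  rewrite ler_pdivrMr ?exprn_gt0// -ler_pdivrMl ?divr_gt0// mulrC.
  apply: (le_trans (ltW (truncnS_gt _))).
  by rewrite -natrX ler_nat ltn_expl.
have G0 : 0 <= iint (diffq s) Q Q by exact: iint_ge0.
pose c := ((8^-1 `^ s + sqn `^ s) * l `^ s)%R.
have c0 : (0 < c)%R by rewrite mulr_gt0 ?powR_gt0// addr_gt0 ?powR_gt0// invr_gt0.
(* Far pairs and pairs closer than r0 / 2^k are disjoint sets of pairs. *)
have split : c^-1%:E * iint (far (l / 8)) Q Q + iint (near_diffq s (r0 / 2 ^+ k)) Q Q
     <= iint (diffq s) Q Q.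
  rewrite -iintZ ?invr_ge0 ?(ltW c0)// -iintD//; last first.
    by apply: nonneg_kernelZ; rewrite ?invr_ge0 ?(ltW c0).
  apply: le_iint => //.
    apply: nonneg_kernelD => //.
    by apply: nonneg_kernelZ; rewrite ?invr_ge0 ?(ltW c0).
  move=> x y Qx Qy; rewrite farE /near_diffq diffqE -EFinM -EFinD lee_fin !indicE.
  have [|_] := boolP ((x, y) \in [set z : B * B | (l / 8 <= E (z.1 - z.2))%R]); last first.
    rewrite !mulr0 add0r ler_piMr ?mulr_ge0 ?powR_ge0//.
    by case: (_ \in _).
  rewrite inE/= => lE; rewrite memNset/= ?mulr0 ?addr0 ?mulr1; last first.
    by apply/negP; rewrite -leNgt (le_trans hk).
  rewrite mulrC ler_wpM2l ?osc_ge0//.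
  have El := cube_dist (ltW l0) cQ Qx Qy.
  have l80 : (0 < l / 8)%R by rewrite divr_gt0.
  have E0 := lt_le_trans l80 lE.
  rewrite powRN lef_pV2 ?posrE ?powR_gt0//.
  apply: (le_trans (powR_sandwich s l80 lE El)).
  by rewrite /c mulrDl (mulrC l) !powRM ?(ltW l0) ?(ltW sqn0) ?invr_ge0.
have far0 : iint (far (l / 8)) Q Q = 0.
  have Gfin : iint (diffq s) Q Q \is a fin_num by rewrite ge0_fin_numE.
  have : c^-1%:E * iint (far (l / 8)) Q Q <= 0.
    have := le_trans (leeD2l _ (H k)) split.
    by rewrite -leeBrDr// subee.
  rewrite pmule_rle0 ?lte_fin ?invr_gt0// => f0.
  by apply/eqP; rewrite eq_le f0 iint_ge0.
apply/eqP; rewrite eq_le iint_ge0// andbT.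
by have := osc_le_far q1 mF n1 l0 cQ; rewrite far0 mule0.
Qed.

(** For almost every x0, F y = F x0 for almost every y of each cube; one x0 in the smallest cube
    serves for all cubes at once. *)
Lemma ae_constant_of_osc_eq0 :
  (forall k : nat, iint oscE (ccube k.+1%:R) (ccube k.+1%:R) = 0) ->
  exists c N, borel_null N /\ forall x, ~ N x -> F x = c.
Proof.
move=> H; pose K (k : nat) : set B := ccube k.+1%:R.
have mK k : measurable (K k) by exact: measurable_cube (cube_ccube _ _).
have H1 : {ae lam, forall x (k : nat), K k x -> \int[lam]_(y in K k) oscE x y = 0}.
  apply: ae_foralln => k; apply: ge0_integral_eq0_ae => //.
  - by apply: measurable_funTS; exact: measurable_inner.
  - by move=> x _; exact: inner_ge0.
  - exact: H.
have [A [mA A0 HA]] := H1.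
have [x0 Kx0 Ax0] : exists2 x0, K 0%N x0 & ~ A x0.
  apply: contrapT => nex; have KA : K 0%N `<=` A.
    by move=> x Kx; apply: contrapT => Ax; apply: nex; exists x.
  have : lam (K 0%N) <= lam A by apply: le_measure; rewrite ?inE//.
  rewrite A0 (_ : lam (K 0%N) = ((2 * 1) ^+ n)%:E); last first.
    exact: (lebesgue_cube _ (cube_ccube n 1%R)).
  by rewrite lee_fin leNgt exprn_gt0.
have Hx0 k : K k x0 -> \int[lam]_(y in K k) oscE x0 y = 0.
  by move: k; apply: contrapT => nH; apply: Ax0; exact: HA.
have H2 : {ae lam, forall y (k : nat), K k y -> oscE x0 y = 0}.
  apply: ae_foralln => k; apply: ge0_integral_eq0_ae => //.
  - by apply: measurable_funTS; exact: nonneg_kernel1.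
  - by move=> x _; exact: kosc.2.
  - by apply: Hx0; move: Kx0; apply: subset_ccube; rewrite ler_nat.
have [N [mN N0 HN]] := H2.
exists (F x0), N; split => // y Ny.
have [k yk] := row_bounded y.
have Kky : K k y.
  by move=> i; rewrite -ler_norml (le_trans (ltW (yk i)))// ler_nat.
have : oscE x0 y = 0.
  by apply: contrapT => o0; apply: Ny; apply: HN => /(_ k Kky).
by move=> [] /osc_eq0.
Qed.

(** Compare a fixed cube K with a cube Z around it of edge l. By compare_osc, l^n times the
    oscillation on K is at most a constant times that on Z, so the former is O(l^e). *)
Lemma osc_eq0_of_large_cubes (M e r : R) : (0 < r)%R -> (e < 0)%R ->
  (forall l Q, (0 < l)%R -> cube l Q -> iint oscE Q Q <= (M * l `^ (n%:R + e))%:E) ->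
  iint oscE (ccube r) (ccube r) = 0.
Proof.
move=> r0 e0 H; set K := ccube r; set D := iint oscE K K.
have D0 : 0 <= D by exact: iint_ge0.
have mK : measurable (K : set B) by exact: measurable_cube (cube_ccube _ _).
have M0 : (0 <= M)%R.
  have := H _ _ (mulr_gt0 (ltr0n _ 2) r0) (cube_ccube n r).
  move/(le_trans D0); rewrite lee_fin pmulr_lge0// powR_gt0// mulr_gt0//.
have lK : lam K = ((2 * r) ^+ n)%:E.
  by apply: (lebesgue_cube _ (cube_ccube n r)); rewrite mulr_gt0.
pose c := (2 `^ q * ((2 * r) ^+ n * M))%R.
have key l : (2 * r <= l)%R -> D <= (c * l `^ e)%:E.
  move=> rl; have l0 : (0 < l)%R by rewrite (lt_le_trans _ rl)// mulr_gt0.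
  have cZ := cube_ccube n (l / 2); rewrite (_ : 2 * (l / 2) = l)%R in cZ; last by field.
  set Z := ccube (l / 2) in cZ; have mZ := measurable_cube cZ.
  have := compare_osc q1 mF mK mZ (lebesgue_cube l0 cZ).
  rewrite -/D => le1.
  have le2 : iint oscE K Z <= (M * l `^ (n%:R + e))%:E.
    apply: (le_trans _ (H _ _ l0 cZ)); apply: iint_subset => //.
    by apply: subset_ccube; lra.
  rewrite -(@lee_pmul2l _ (l ^+ n)%:E) ?lte_fin ?exprn_gt0//.
  apply: (le_trans le1); rewrite lK.
  apply: (@le_trans _ _ ((2 `^ q)%:E * (((2 * r) ^+ n)%:E * (M * l `^ (n%:R + e))%:E))).
    apply: lee_wpmul2l; first by rewrite lee_fin powR_ge0.
    by apply: lee_wpmul2l => //; rewrite lee_fin exprn_ge0// mulr_ge0// ltW.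
  rewrite -!EFinM lee_fin powRD; last by rewrite (gt_eqF l0) implybT.
  rewrite powR_mulrn ?(ltW l0)// /c le_eqVlt; apply/orP; left; apply/eqP; ring.
exact: eq0_of_decay D0 (mulr_gt0 (ltr0n _ 2) r0) e0 key.
Qed.

End vanishing.

Section shells_and_averages.
Context (R : realType) (n : nat) (q : R) (F : 'rV[R]_n -> R).
Local Open Scope ereal_scope.
Local Notation lam := (borel_lebesgue R n).
Local Notation E := (@euclid_norm R n).
Local Notation B := (borel_rV R n).
Local Notation osc := (osc q F).
Local Notation oscE := (oscE q F).
Local Notation diffq := (diffq q F).
Hypothesis q1 : (1 <= q)%R.
Hypothesis mF : measurable_fun setT (F : B -> R).
Hypothesis n1 : (0 < n)%N.

Let q0 : (0 < q)%R. Proof. exact: lt_le_trans q1. Qed.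
Let kosc := nonneg_kernel_osc q mF.
Let kdiff s := nonneg_kernel_diffq q mF s.
Let sqn : R := Num.sqrt n%:R.
Let sqn0 : (0 < sqn)%R. Proof. by rewrite sqrtr_gt0 ltr0n. Qed.

Lemma iint_setUr (k : B -> B -> \bar R) (A Z W : set B) : nonneg_kernel k ->
  measurable A -> measurable Z -> measurable W -> [disjoint Z & W] ->
  iint k A (Z `|` W) = iint k A Z + iint k A W.
Proof.
move=> kk mA mZ mW dZW; rewrite /iint -ge0_integralD//; last 4 first.
- by move=> x _; exact: inner_ge0.
- by apply: measurable_funTS; exact: measurable_inner.
- by move=> x _; exact: inner_ge0.
- by apply: measurable_funTS; exact: measurable_inner.
apply: eq_integral => x _; rewrite ge0_integral_setU//.
- by apply: measurable_funTS; exact: nonneg_kernel1.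
- by move=> y _; exact: kk.2.
Qed.

(** Pairs of a point of K and a point of the dyadic shell between two concentric cubes carry an
    energy of order n bounded below by a multiple of the oscillation D on K: the shell has
    volume of order l^n and the kernel is of order l^-n. Since J shells give at least J times
    that amount, a uniform bound forces D = 0. *)
Lemma osc_eq0_of_bounded_diffq (M r : R) : (0 < r)%R ->
  (forall l Q, (0 < l)%R -> cube l Q -> iint (diffq n%:R) Q Q <= M%:E) ->
  iint oscE (ccube r) (ccube r) = 0.
Proof.
move=> r0 H; pose Q (j : nat) : set B := ccube (2 ^+ j * r)%R.
set K := ccube r; set D := iint oscE K K.
have mQ j : measurable (Q j) by exact: measurable_cube (cube_ccube _ _).
have mK : measurable (K : set B) by exact: measurable_cube (cube_ccube _ _).
have D0 : 0 <= D by exact: iint_ge0.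
have r2 j : (0 < 2 ^+ j * r)%R by rewrite mulr_gt0 ?exprn_gt0.
have lQ j : lam (Q j) = ((2 * (2 ^+ j * r)) ^+ n)%:E.
  by apply: (lebesgue_cube _ (cube_ccube n _)); rewrite mulr_gt0.
have lK : lam K = ((2 * r) ^+ n)%:E.
  by apply: (lebesgue_cube _ (cube_ccube n r)); rewrite mulr_gt0.
have QS j : Q j `<=` Q j.+1.
  by apply: subset_ccube; rewrite exprS ler_pM2r// ler_pMl ?exprn_gt0// ler1n.
have KQ j : K `<=` Q j.
  by apply: subset_ccube; rewrite ler_pMl// -natrX ler1n expn_gt0.
pose c : R := (2 * (2 `^ q * (2 * r) ^+ n * sqn ^+ n))%R.
have c0 : (0 <= c)%R.
  by rewrite !mulr_ge0 ?powR_ge0 ?exprn_ge0 ?mulr_ge0 ?(ltW r0) ?(ltW sqn0).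
have shell j : D <= c%:E * iint (diffq n%:R) K (Q j.+1 `\` Q j).
  pose l := (2 * (2 ^+ j.+1 * r))%R; have l0 : (0 < l)%R by rewrite mulr_gt0.
  have mZ : measurable (Q j.+1 `\` Q j) by exact: measurableD.
  have lZ : lam (Q j.+1 `\` Q j) = (l ^+ n - (l / 2) ^+ n)%:E.
    have Qoo : lam (Q j.+1) < +oo by rewrite lQ ltry.
    rewrite measureD// setIidr// EFinB; congr (_ - _); first exact: lQ.
    have -> : (l / 2 = 2 * (2 ^+ j * r))%R by rewrite /l exprS; field.
    exact: lQ.
  have lZ2 : (l ^+ n / 2 <= l ^+ n - (l / 2) ^+ n)%R.
    have : ((l / 2) ^+ n <= l ^+ n / 2)%R.
      rewrite exprMn ler_wpM2l ?exprn_ge0 ?(ltW l0)// -[leRHS]expr1.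
      by rewrite ler_wiXn2l// invf_le1 ?ler1n.
    lra.
  have ln0 : (0 < l ^+ n)%R by rewrite exprn_gt0.
  rewrite -(@lee_pmul2l _ (l ^+ n / 2)%:E) ?lte_fin ?divr_gt0//.
  apply: (@le_trans _ _ ((l ^+ n - (l / 2) ^+ n)%:E * D)).
    by apply: lee_wpmul2r; rewrite ?lee_fin.
  apply: (le_trans (compare_osc q1 mF mK mZ lZ)); rewrite lK.
  have cl : (l ^+ n / 2 * c = 2 `^ q * ((2 * r) ^+ n * (sqn * l) ^+ n))%R.
    by rewrite (exprMn _ sqn) /c; field.
  rewrite [in leRHS]muleA -[in leRHS]EFinM cl EFinM -[in leRHS]muleA.
  apply: lee_wpmul2l; first by rewrite lee_fin powR_ge0.
  rewrite EFinM -[in leRHS]muleA; apply: lee_wpmul2l.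
    by rewrite lee_fin exprn_ge0// mulr_ge0// ltW.
  have sl0 : (0 <= (sqn * l) ^+ n)%R by rewrite exprn_ge0// mulr_ge0// ltW.
  have kz := nonneg_kernelZ sl0 (kdiff n%:R).
  rewrite -(iintZ sl0 (kdiff _) mK mZ); apply: (le_iint kosc kz mK mZ).
  move=> x y Kx [Qy _]; rewrite osc_EFin diffqE -EFinM lee_fin.
  have := @diffq_le R n q F q1 n1 l _ 0%R n%:R x y l0 (cube_ccube n (2 ^+ j.+1 * r)%R) (ler0n _ n) (KQ _ _ Kx) Qy.
  by rewrite oppr0 powRr0 mulr1 addr0 powR_mulrn// mulr_ge0 ?(ltW l0) ?sqrtr_ge0.
have step J : J%:R%:E * D <= c%:E * iint (diffq n%:R) K (Q J).
  elim: J => [|J IH]; first by rewrite mul0e mule_ge0// ?iint_ge0.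
  have -> : Q J.+1 = Q J `|` (Q J.+1 `\` Q J) by rewrite setDUK.
  rewrite iint_setUr//; last 2 first.
  - exact: measurableD.
  - by rewrite disj_set2E setDIK.
  have J1 : (J.+1%:R = J%:R + 1 :> R)%R by rewrite natr1.
  rewrite J1 EFinD ge0_muleDl ?lee_fin// mul1e.
  rewrite (ge0_muleDr _ (iint_ge0 _ _ (kdiff _)) (iint_ge0 _ _ (kdiff _))).
  by apply: leeD.
apply: (@eq0_of_bounded_multiples _ D (c%:E * M%:E)) => // [|J].
  by rewrite -EFinM ltry.
apply: (le_trans (step J)); apply: lee_wpmul2l; first by rewrite lee_fin.
apply: (@le_trans _ _ (iint (diffq n%:R) (Q J) (Q J))); first exact: iint_subset.
by apply: H (cube_ccube n _); rewrite mulr_gt0.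
Qed.

(** * Comparison with averages *)

(** Some x0 has a finite integral of osc x0 over Q, and |F y| <= |F x0| + 1 + |F x0 - F y|^q. *)
Lemma L1_of_osc_finite l Q : (0 < l)%R -> cube l Q -> iint oscE Q Q < +oo ->
  \int[lam]_(x in Q) (`|F x|)%:E < +oo.
Proof.
move=> l0 cQ Goo; have mQ := measurable_cube cQ.
have lQ := lebesgue_cube l0 cQ.
have [x0 [Qx0 x0oo]] : exists x0, Q x0 /\ \int[lam]_(y in Q) oscE x0 y < +oo.
  apply: contrapT => /forallNP nex; move: Goo; rewrite ltNge => /negP; apply.
  rewrite /iint (eq_integral (cst +oo)) => [|x /set_mem Qx]; last first.
    apply/eqP; rewrite eq_le leey/= leNgt; apply/negP => xoo.
    by apply: (nex x); split.
  by rewrite integral_cst// [X in _ * X]lQ gt0_mulye// lte_fin exprn_gt0.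
have mf : measurable_fun (Q : set B) (oscE x0).
  by apply: measurable_funTS; exact: nonneg_kernel1.
apply: (@le_lt_trans _ _ (\int[lam]_(y in Q) ((`|F x0| + 1)%:E + oscE x0 y))).
  apply: ge0_le_integral => //.
  - by apply/measurable_EFinP; apply: measurableT_comp => //; exact: measurable_funTS.
  - exact: emeasurable_funD.
  - move=> y _; rewrite -EFinD lee_fin.
    have : (`|F x0 - F y| <= 1 + osc x0 y)%R.
      have [h|h] := leP `|F x0 - F y|%R 1%R.
        by rewrite (le_trans h)// lerDl powR_ge0.
      rewrite (@le_trans _ _ (osc x0 y))// ?lerDr ?ler01//.
      by apply: le1r_powR => //; exact: ltW.
    have := ler_normB (F x0) (F x0 - F y)%R; rewrite subKr; lra.
rewrite ge0_integralD//; last by move=> y _; exact: kosc.2.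
apply: lte_add_pinfty => //.
by rewrite (integral_cst _ mQ) [X in _ * X]lQ -EFinM ltry.
Qed.

(** F x minus the average of F is the average of F x - F y over y; apply weak_hoelder in y. *)
Lemma osc_ge_average l Q : (0 < l)%R -> cube l Q ->
  \int[lam]_(x in Q) (`|F x|)%:E < +oo ->
  \int[lam]_(x in Q) (`|F x - fine (\int[lam]_(y in Q) (F y)%:E) / l ^+ n| `^ q)%:E <=
  (2 `^ q / l ^+ n)%:E * iint oscE Q Q.
Proof.
move=> l0 cQ Foo; have mQ := measurable_cube cQ.
have lQ := lebesgue_cube l0 cQ.
have ln0 : (0 < l ^+ n)%R by rewrite exprn_gt0.
have mFQ : measurable_fun (Q : set B) F by exact: measurable_funTS.
have iF : lam.-integrable (Q : set B) (EFin \o F).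
  by apply/integrableP; split; [exact/measurable_EFinP|].
set I := \int[lam]_(y in Q) (F y)%:E; set m := (fine I / l ^+ n)%R.
have Ifin : I \is a fin_num by exact: integrable_fin_num.
have point x : (`|F x - m| `^ q)%:E <= (2 `^ q / l ^+ n)%:E * \int[lam]_(y in Q) oscE x y.
  have h1 : (l ^+ n * `|F x - m|)%:E <= \int[lam]_(y in Q) (`|F x - F y|)%:E.
    have -> : (l ^+ n * `|F x - m|)%:E = `| \int[lam]_(y in Q) (F x - F y)%:E |.
      rewrite integralB_EFin//; last first.
        apply/integrableP; split; first exact: measurable_cst.
        by rewrite (integral_cst _ mQ) [X in _ * X]lQ -EFinM ltry.
      rewrite (integral_cst _ mQ) -/I [X in _ * X - _]lQ -(fineK Ifin) -EFinM -EFinB abse_EFin; congr EFin.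
      rewrite -[X in (X * _)%R](gtr0_norm ln0) -normrM; congr (`|_|)%R.
      by rewrite /m mulrBr mulrCA mulfV ?gt_eqF// mulr1 mulrC.
    apply: le_abse_integral => //; apply/measurable_EFinP.
    exact: measurable_funB.
  have h2 := @weak_hoelder _ _ _ lam Q _ q (fun y => `|F x - F y|%R) mQ lQ ln0 q1.
  have {}h2 := h2 (measurableT_comp (@normr_measurable _ _) (measurable_funB (measurable_cst _) mFQ)) (fun _ _ => normr_ge0 _).
  have h3 : ((l ^+ n * `|F x - m|) `^ q)%:E <=
    (2 `^ q * (l ^+ n) `^ (q - 1))%:E * \int[lam]_(y in Q) oscE x y.
    apply: le_trans h2; rewrite -poweR_EFin.
    apply: gt0_ler_poweR => //; rewrite ?(ltW q0) ?in_itv/= ?leey ?andbT//.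
      by rewrite lee_fin mulr_ge0// ltW.
    by apply: integral_ge0 => y _; rewrite lee_fin.
  rewrite -(@lee_pmul2l _ ((l ^+ n) `^ q)%:E) ?lte_fin ?powR_gt0//.
  rewrite -EFinM -powRM ?(ltW ln0)//; apply: (le_trans h3).
  rewrite muleA -EFinM -(mulr_powRB1 (ltW ln0) q0).
  rewrite (_ : l ^+ n * (l ^+ n) `^ (q - 1) * (2 `^ q / l ^+ n) =
     2 `^ q * (l ^+ n) `^ (q - 1))%R//.
  by move: (l ^+ n)%R ln0 => w w0; field; rewrite gt_eqF.
rewrite /iint -ge0_integralZl_EFin//; last 3 first.
- by move=> x _; exact: inner_ge0.
- by apply: measurable_funTS; exact: measurable_inner.
- by rewrite divr_ge0 ?powR_ge0 ?(ltW ln0).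
apply: ge0_le_integral => //.
- apply/measurable_EFinP; apply: measurable_powR_comp; apply: measurableT_comp => //.
  exact: measurable_funB.
- by apply: measurable_funTS; apply: measurable_funeM; exact: measurable_inner.
Qed.

(** Split F x - F y = (F x - a) - (F y - a). By symmetry one summand suffices, and its kernel
    E (x - y)^(b - n) is integrable in y over Q. *)
Lemma diffq_le_average (b : R) : (0 < b)%R -> exists2 C : R, (0 < C)%R &
  forall a l Q, (0 < l)%R -> cube l Q ->
  iint (diffq (n%:R - b)) Q Q <= (C * l `^ b)%:E * \int[lam]_(x in Q) (`|F x - a| `^ q)%:E.
Proof.
move=> b0; have [C C0 HC] := kernel_bound n b0.
exists (2 `^ q * (C * (2 * sqn) `^ b))%R.
  by rewrite !mulr_gt0 ?powR_gt0 ?mulr_gt0.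
move=> a l Q l0 cQ; have mQ := measurable_cube cQ.
pose k : B -> B -> \bar R := fun x y => (`|F x - a| `^ q * E (x - y) `^ (b - n%:R))%:E.
have mFa : measurable_fun setT (fun x : B => `|F x - a| `^ q)%R.
  apply: measurable_powR_comp; apply: measurableT_comp => //.
  exact: measurable_funB.
have kk : nonneg_kernel k.
  apply: nonneg_kernel_EFin => [|x y]; last by rewrite mulr_ge0 ?powR_ge0.
  apply: measurable_funM; first exact: (measurableT_comp mFa).
  by apply: measurable_powR_comp; exact: measurable_dist.
have kk' := nonneg_kernelC kk.
have le1 : iint (diffq (n%:R - b)) Q Q <= (2 `^ q)%:E * iint k Q Q.
  apply: (@le_trans _ _ (iint (fun x y => (2 `^ (q - 1))%:E * (k x y + k y x)) Q Q)).
    apply: le_iint; [exact: kdiff| |exact: mQ|exact: mQ|].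
      by apply: nonneg_kernelZ; [exact: powR_ge0|exact: nonneg_kernelD].
    move=> x y Qx Qy; rewrite /k diffqE -EFinD -EFinM lee_fin opprB.
    rewrite (euclid_distC y) -mulrDl mulrA ler_wpM2r ?powR_ge0//.
    apply: le_trans (powRD_le q1 (normr_ge0 _) (normr_ge0 _)).
    apply: ge0_ler_powR; rewrite ?nnegrE ?(ltW q0) ?addr_ge0//.
    by have := ler_normB (F x - a)%R (F y - a)%R; rewrite opprB addrA subrK.
  rewrite (iintZ (powR_ge0 _ _) (nonneg_kernelD kk kk') mQ mQ).
  rewrite (iintD kk kk' mQ mQ) -[X in _ + X](iintC kk mQ mQ).
  set X := iint k Q Q; have X0 : 0 <= X by exact: iint_ge0.
  have -> : X + X = 2%:E * X by rewrite (_ : 2%:E = 1 + 1)// ge0_muleDl// mul1e.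
  by rewrite muleA -EFinM mulrC powR_2M.
apply: (le_trans le1); rewrite -mulrA EFinM -muleA; apply: lee_wpmul2l.
  by rewrite lee_fin powR_ge0.
rewrite -ge0_integralZl_EFin; last 4 first.
- by [].
- by move=> x _; rewrite lee_fin powR_ge0.
- by apply/measurable_EFinP; exact: measurable_funTS.
- by rewrite !mulr_ge0 ?powR_ge0 ?(ltW C0).
have mEx x : measurable_fun setT (fun y : B => (E (x - y) `^ (b - n%:R))%:E).
  apply/measurable_EFinP; apply: measurable_powR_comp.
  by apply: (@measurable_euclid_dist _ _ _ B (cst x) id).
rewrite /iint; apply: ge0_le_integral => //.
- by move=> x _; exact: inner_ge0.
- by apply: measurable_funTS; exact: measurable_inner.
- by apply: measurable_funTS; apply: measurable_funeM; apply/measurable_EFinP.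
move=> x Qx; rewrite /k; under eq_integral do rewrite EFinM.
rewrite (ge0_integralZl_EFin _ mQ); last 3 first.
- by move=> y _; rewrite lee_fin powR_ge0.
- exact: measurable_funTS.
- exact: powR_ge0.
rewrite muleC; apply: lee_wpmul2r; first by rewrite lee_fin powR_ge0.
have r0 : (0 < 2 * sqn * l)%R by rewrite !mulr_gt0.
have := HC (2 * sqn * l)%R x r0.
rewrite (_ : C * (2 * sqn) `^ b * l `^ b = C * (2 * sqn * l) `^ b)%R; last first.
  by rewrite (powRM _ _ (ltW l0)) ?mulrA// mulr_ge0 ?(ltW sqn0).
apply: le_trans; apply: ge0_subset_integral => //.
- exact: measurable_euclid_ball.
- exact: measurable_funTS.
- by move=> y _; rewrite lee_fin powR_ge0.
- move=> y Qy /=; apply: (le_lt_trans (cube_dist (ltW l0) cQ Qx Qy)).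
  by rewrite -mulrA ltr_pMl ?ltr1n// mulr_gt0.
Qed.

End shells_and_averages.

(** * Smooth bumps *)

Section smooth1.
Context (R : realType).
Implicit Types (f g : R -> R) (m : nat).

Fixpoint smooth_upto m f : Prop :=
  match m with
  | 0 => continuous f
  | m'.+1 => exists2 f' : R -> R, forall x : R, is_derive x 1 f (f' x) & smooth_upto m' f'
  end.

(** A function comes with its successive derivatives, so that closure under products and affine
    substitutions is an induction on the order without iterated derivative operators. *)
Definition smooth f := forall m, smooth_upto m f.

Lemma is_derive_continuous f f' : (forall x : R, is_derive x 1 f (f' x)) -> continuous f.
Proof.
move=> df x; apply/differentiable_continuous/derivable1_diffP.
by have [] := df x.
Qed.

Lemma smooth_uptoW m f : smooth_upto m.+1 f -> smooth_upto m f.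
Proof.
elim: m f => [|m IH] f [f' df cf']; first exact: is_derive_continuous df.
by exists f' => //; exact: IH.
Qed.

Lemma smooth_cst c : smooth (cst c).
Proof.
move=> m; elim: m c => [|m IH] c; first by move=> x; exact: cst_continuous.
exists (cst 0) => [x|]; [exact: is_derive_cst|exact: IH].
Qed.

Lemma smooth_upto_ext m f g : f =1 g -> smooth_upto m f -> smooth_upto m g.
Proof. by move=> /funext ->. Qed.

Lemma smooth_uptoD m f g : smooth_upto m f -> smooth_upto m g ->
  smooth_upto m (fun x => f x + g x).
Proof.
elim: m f g => [|m IH] f g.
  by move=> cf cg x; apply: cvgD; [exact: cf|exact: cg].
move=> [f' df sf] [g' dg sg]; exists (fun x => f' x + g' x); last exact: IH.
by move=> x; exact: is_deriveD.
Qed.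

Lemma smooth_uptoM m f g : smooth_upto m f -> smooth_upto m g ->
  smooth_upto m (fun x => f x * g x).
Proof.
elim: m f g => [|m IH] f g.
  by move=> cf cg x; apply: cvgM; [exact: cf|exact: cg].
move=> sf sg; have sf0 := smooth_uptoW sf; have sg0 := smooth_uptoW sg.
case: sf sg => f' df sf [g' dg sg].
exists (fun x => f x * g' x + g x * f' x).
  by move=> x; exact: is_deriveM.
by apply: smooth_uptoD; exact: IH.
Qed.

Lemma is_derive_affine (a b x : R) : is_derive x 1 (fun t => a * t + b) a.
Proof.
have := @is_deriveD _ _ _ (fun t => a * t) (cst b) x 1 a 0.
rewrite addr0; apply.
by have := @is_deriveZ _ _ _ id a x 1 1; rewrite /GRing.scale/= mulr1; apply.
Qed.

Lemma smooth_upto_affine m f (a b : R) : smooth_upto m f ->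
  smooth_upto m (fun x => f (a * x + b)).
Proof.
have ca : continuous (fun x : R => a * x + b).
  by apply: is_derive_continuous => x; exact: is_derive_affine.
elim: m f => [|m IH] f.
  by move=> cf x; apply: continuous_comp; [exact: ca|exact: cf].
move=> [f' df sf]; exists (fun x => f' (a * x + b) * a).
  move=> x; have dfx := df (a * x + b); have dax := is_derive_affine a b x.
  exact: is_derive1_comp.
apply: smooth_uptoM; [exact: IH|exact: smooth_cst].
Qed.

(** The derivatives of exp (-1/t), extended by 0 to t <= 0, are combinations of these functions. *)
Definition flat (k : nat) (t : R) : R :=
  if 0 < t then t ^- k * expR (- t^-1) else 0.

Lemma flat_ge0 k t : 0 <= flat k t.
Proof.
by rewrite /flat; case: ifP => // t0; rewrite mulr_ge0 ?expR_ge0// invr_ge0 exprn_ge0 ?ltW.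
Qed.

Lemma flat_le k (t : R) : flat k t <= (k.+2)`!%:R * t ^+ 2.
Proof.
rewrite /flat; case: ifPn => t0; last by rewrite mulr_ge0 ?sqr_ge0.
have u0 : 0 < t^-1 by rewrite invr_gt0.
have h := @expR_ge1Dxn R t^-1 k.+1 (ltW u0).
rewrite expRN ler_pdivrMr ?expR_gt0//.
have f0 : (0 < (k.+2)`!%:R :> R) by rewrite ltr0n fact_gt0.
have h2 : t^-1 ^+ k.+2 <= (k.+2)`!%:R * expR t^-1.
  by rewrite mulrC -ler_pdivrMr// (le_trans _ h)// lerDr.
rewrite -mulrA mulrCA -ler_pdivrMl ?exprn_gt0//.
by rewrite (le_trans _ h2)// -invfM -exprD add2n -exprVn.
Qed.

(** This covers the junction point 0, where no closed formula for flat is valid on both sides. *)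
Lemma is_derive0_sqr_bound f (C : R) : f 0 = 0 -> (forall t, `|f t| <= C * t ^+ 2) ->
  is_derive (0 : R) 1 f 0.
Proof.
move=> f0 fC.
have Ch : (fun h : R => `|C| * `|h|) @ 0^' --> (0 : R).
  have N0 : (fun h : R => `|h|) @ 0^' --> (`|0 : R| : R).
    apply: (cvg_trans _ (@norm_continuous R R 0)).
    by apply: cvg_app; exact: cvg_within.
  rewrite [X in _ --> X](_ : _ = `|C| * `|0 : R|); last by rewrite normr0 mulr0.
  by apply: cvgM; [exact: cvg_cst|exact: N0].
have H : (fun h : R => h^-1 *: ((f \o shift 0) (h *: 1) - f 0)) @ 0^' --> (0 : R).
  have -> : (fun h : R => h^-1 *: ((f \o shift 0) (h *: 1) - f 0)) = (fun h => h^-1 * f h).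
    by apply/funext => h; rewrite /= addr0 f0 subr0 [h *: 1]mulr1.
  apply: (@squeeze_cvgr _ _ _ _ (fun h : R => - (`|C| * `|h|)) (fun h : R => `|C| * `|h|)).
  - near=> h; rewrite -ler_norml normrM normfV.
    have h0 : h != 0 by near: h; exact: nbhs_dnbhs_neq.
    rewrite ler_pdivrMl ?normr_gt0//; apply: (le_trans (fC h)).
    have -> : `|h| * (`|C| * `|h|) = `|C| * h ^+ 2.
      by rewrite mulrCA -expr2 real_normK ?num_real.
    by rewrite ler_wpM2r ?sqr_ge0 ?ler_norm.
  - rewrite [X in _ --> X](_ : _ = - (0 : R)); last by rewrite oppr0.
    exact: (cvgN Ch).
  - exact: Ch.
apply: DeriveDef; first by apply/cvg_ex; exists 0.
exact: (cvg_lim _ H).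
Unshelve. all: by end_near. Qed.

Lemma is_derive_flat k (x : R) : is_derive x 1 (flat k) (flat k.+2 x - k%:R * flat k.+1 x).
Proof.
have [x0|x0|->] := ltgtP x 0.
- have -> : flat k.+2 x - k%:R * flat k.+1 x = 0.
    by rewrite /flat ltNge (ltW x0)/= mulr0 subr0.
  apply: (@near_eq_is_derive _ _ _ (cst 0)).
  near=> t; rewrite /flat ltNge/= ifF//; apply/negbTE; rewrite negbK ltW//.
  by near: t; exact: lt_nbhsl.
- have nearE : \near x, x ^- k * expR (- x^-1) = flat k x.
    by near=> t; rewrite /flat ifT//; near: t; exact: lt_nbhsr.
  have xn0 : x != 0 by rewrite gt_eqF.
  have dV : is_derive x 1 (fun t : R => t^-1) (- x ^- 2).
    have := @is_deriveV R id x 1 1 xn0 (is_derive_id x 1).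
    by rewrite /GRing.scale/= mulr1.
  have dE : is_derive x 1 (fun t : R => expR (- t^-1)) (expR (- x^-1) * x ^- 2).
    have := @is_derive1_comp R expR (fun t => - t^-1) x _ (x ^- 2) (is_derive_expR _).
    apply; have := @is_deriveN _ _ _ (fun t : R => t^-1) x 1 _ dV.
    by rewrite opprK.
  have dX : is_derive x 1 (fun t : R => t ^- k) (- k%:R * x ^- k.+1).
    have -> : (fun t : R => t ^- k) = (fun t : R => t^-1) ^+ k.
      by apply/funext => t; rewrite exprfctE exprVn.
    have := @is_deriveX _ _ (fun t : R => t^-1) k x 1 _ dV.
    rewrite /GRing.scale/= => dX; apply: (is_derive_eq dX).
    case: k {dX nearE} => [|k]/=; first by rewrite mul0r mul0r oppr0 mul0r.
    have e : x^-1 ^+ k * x ^- 2 = x ^- k.+2 by rewrite exprVn -invfM -exprD addn2.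
    by rewrite mulrN -mulrA e mulNr.
  have := @is_deriveM _ _ (fun t : R => t ^- k) (fun t : R => expR (- t^-1)) x 1 _ _ dX dE.
  rewrite /GRing.scale/= => dM; apply: (near_eq_is_derive nearE); apply: (is_derive_eq dM).
  rewrite /flat x0 mulrA (mulrC _ (expR _)) -mulrA -invfM -exprD addn2.
  by ring.
- have -> : flat k.+2 0 - k%:R * flat k.+1 0 = 0.
    by rewrite /flat ltxx mulr0 subr0.
  apply: (@is_derive0_sqr_bound _ ((k.+2)`!%:R)); first by rewrite /flat ltxx.
  by move=> t; rewrite ger0_norm ?flat_ge0// flat_le.
Unshelve. all: by end_near. Qed.

(** The derivative of flat k is a combination of flat (k + 2) and flat (k + 1), so the family
    is closed under differentiation. *)
Lemma smooth_flat k : smooth (flat k).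
Proof.
move=> m; elim: m k => [|m IH] k.
  by apply: is_derive_continuous => x; exact: is_derive_flat.
exists (fun x => flat k.+2 x - k%:R * flat k.+1 x); first exact: is_derive_flat.
apply: (@smooth_upto_ext _ (fun x => flat k.+2 x + (- k%:R) * flat k.+1 x)).
  by move=> x; rewrite mulNr.
by apply: smooth_uptoD => //; apply: smooth_uptoM => //; exact: smooth_cst.
Qed.


(** An approximation from below of the indicator of ]a, b[, sharper as k grows. *)
Definition box_bump (a b : R) (k : nat) (t : R) : R :=
  flat 0 (k.+1%:R * (t - a)) * flat 0 (k.+1%:R * (b - t)).

Lemma smooth_bump a b k : smooth (box_bump a b k).
Proof.
move=> m; apply: smooth_uptoM.
  apply: (@smooth_upto_ext _ (fun x => flat 0 (k.+1%:R * x + - (k.+1%:R * a)))).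
    by move=> x; rewrite mulrBr.
  by apply: (@smooth_upto_affine m (flat 0)); exact: smooth_flat.
apply: (@smooth_upto_ext _ (fun x => flat 0 (- k.+1%:R * x + k.+1%:R * b))).
  by move=> x; rewrite mulrBr addrC mulNr.
by apply: (@smooth_upto_affine m (flat 0)); exact: smooth_flat.
Qed.

Lemma flat0_le1 t : flat 0 t <= 1.
Proof.
rewrite /flat; case: ifPn => // t0; rewrite expr0 invr1 mul1r expR_le1.
by rewrite oppr_le0 invr_ge0 ltW.
Qed.

Lemma box_bump_ge0 a b k t : 0 <= box_bump a b k t.
Proof. by rewrite mulr_ge0 ?flat_ge0. Qed.

Lemma box_bump_le1 a b k t : box_bump a b k t <= 1.
Proof. by rewrite mulr_ile1 ?flat_ge0 ?flat0_le1. Qed.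

Lemma box_bump_out a b k t : ~~ (a < t < b) -> box_bump a b k t = 0.
Proof.
rewrite negb_and -!leNgt => /orP[ta|bt]; rewrite /box_bump /flat.
  by rewrite pmulr_rgt0// subr_gt0 ltNge ta/= mul0r.
have -> : (0 < k.+1%:R * (b - t)) = false.
  by rewrite pmulr_rgt0// subr_gt0 ltNge bt.
by rewrite mulr0.
Qed.

Lemma flat_cvg1 (t : R) : 0 < t -> (fun k : nat => flat 0 (k.+1%:R * t)) @ \oo --> (1 : R).
Proof.
move=> t0.
have -> : (fun k : nat => flat 0 (k.+1%:R * t)) = (fun k => expR (- (k.+1%:R^-1 * t^-1))).
  by apply/funext => k; rewrite /flat pmulr_rgt0// t0 expr0 invr1 mul1r invfM.
have H : (fun k : nat => expR (- (k.+1%:R^-1 * t^-1))) @ \oo --> expR (- (0 * t^-1)).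
  apply: (@continuous_cvg _ _ _ _ _ _ expR); first exact: continuous_expR.
  by apply: cvgN; apply: cvgMl; exact: cvg_harmonic.
by rewrite mul0r oppr0 expR0 in H.
Qed.

Lemma box_bump_cvg a b t : (fun k => box_bump a b k t) @ \oo --> ((a < t < b)%R%:R : R).
Proof.
have [atb|] := boolP (a < t < b); last first.
  by move=> atb; apply: cvg_near_cst; apply: nearW => k; rewrite box_bump_out.
case/andP: atb => at_ tb.
rewrite -(mulr1 (1%:R)); apply: cvgM; apply: flat_cvg1; rewrite subr_gt0//.
Qed.

End smooth1.

Section tensor.
Context (R : realType) (n : nat).
Implicit Types (psi : 'I_n -> R -> R).

Definition tensor psi (x : 'rV[R]_n) : R := \prod_(i < n) psi i (x ord0 i).

Definition replace psi (i : 'I_n) (f : R -> R) : 'I_n -> R -> R :=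
  fun j => if j == i then f else psi j.

Lemma continuous_tensor psi : (forall i, continuous (psi i)) -> continuous (tensor psi).
Proof.
move=> cpsi; rewrite /tensor; elim: (index_enum _) => [|i s IH].
  under eq_fun do rewrite big_nil; exact: cst_continuous.
under eq_fun do rewrite big_cons.
move=> x; apply: (@continuousM _ _ (fun x : 'rV[R]_n => psi i (x ord0 i))); last exact: IH.
apply: (@continuous_comp _ _ _ (fun x : 'rV[R]_n => x ord0 i) (psi i)).
  exact: coord_continuous.
exact: cpsi.
Qed.

Lemma is_derive_tensor psi (i : 'I_n) (f' : R -> R) (x : 'rV[R]_n) :
  is_derive (x ord0 i) 1 (psi i) (f' (x ord0 i)) ->
  is_derive x (delta_mx ord0 i) (tensor psi) (tensor (replace psi i f') x).
Proof.
move=> [df dfE].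
pose c := \prod_(j < n | j != i) psi j (x ord0 j).
have rE : tensor (replace psi i f') x = f' (x ord0 i) * c.
  rewrite /tensor (bigD1 i)//= /replace eqxx; congr (_ * _).
  by apply: eq_bigr => j /negbTE ->.
have H : (fun h : R => h^-1 *: ((tensor psi \o shift x) (h *: delta_mx ord0 i) - tensor psi x)) =
  (fun h : R => h^-1 *: ((psi i \o shift (x ord0 i)) (h *: 1) - psi i (x ord0 i)) * c).
  apply/funext => h; rewrite /tensor/= (bigD1 i)//= [X in _ - X](bigD1 i)//=.
  rewrite !mxE !eqxx [h *: 1]mulr1 mulr1.
  have -> : \prod_(j < n | j != i) psi j ((h *: delta_mx ord0 i + x) ord0 j) = c.
    apply: eq_bigr => j ji; rewrite !mxE eqxx/= (negbTE ji) mulr0 add0r//.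
  by rewrite -mulrBl -scalerAl.
have cv : (fun h : R => h^-1 *: ((tensor psi \o shift x) (h *: delta_mx ord0 i) - tensor psi x))
    @ 0^' --> tensor (replace psi i f') x.
  rewrite H rE; apply: cvgMl; rewrite -dfE; exact: df.
apply: DeriveDef; first by apply/cvg_ex; eexists; exact: cv.
exact: (cvg_lim _ cv).
Qed.

Lemma C_k_tensor k psi : (forall i, smooth_upto k (psi i)) -> C_k k (tensor psi).
Proof.
elim: k psi => [|k IH] psi sm /=; first exact: continuous_tensor.
move=> i; have [f' df sf'] := sm i.
have d (x : 'rV[R]_n) := is_derive_tensor (df (x ord0 i)).
split => [x|]; first by have [] := d x.
have -> : partial i (tensor psi) = tensor (replace psi i f').
  by apply/funext => x; rewrite /partial; have [] := d x.
apply: IH => j; rewrite /replace; case: ifP => // _; exact: smooth_uptoW.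
Qed.

End tensor.

(** * Sweeps of bumps *)

Section sweep.
Context (R : realType).
Implicit Types (f : R -> R).
Local Notation mu := (@lebesgue_measure R).

Let int1 (T : R) : 0 < T -> (\int[mu]_(t in `[0%R, T]) (cst 1%E) t)%E = T%:E.
Proof.
move=> T0; rewrite integral_cst//.
by rewrite mul1e [LHS]lebesgue_measure_itv/= lte_fin T0 oppr0 adde0.
Qed.

(** The primitive starts at a - 1, where f still vanishes, so that it is differentiable also at
    and to the left of a. *)
Lemma primitive f (a : R) : continuous f -> (forall t, t <= a -> f t = 0) ->
  exists Psi : R -> R, forall s : R, is_derive s 1 Psi (f s).
Proof.
move=> cf f0.
pose Psi s := Rintegral mu `[a - 1, s] f.
exists Psi => s; have [sa|as_] := ltP s a.
  rewrite f0 ?ltW//; apply: (@near_eq_is_derive _ _ _ (cst 0)).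
  near=> t; apply/esym; rewrite /Psi /Rintegral integral0_eq// => u.
  rewrite /= in_itv/= => /andP[_ ut]; rewrite f0//; apply: (le_trans ut).
  by apply: ltW; near: t; exact: lt_nbhsl.
have H := @continuous_FTC1_closed R f (a - 1) s (s + 1).
have [||||d <-] := H; last by apply: DeriveDef; [exact: d|rewrite derive1E].
- lra.
- apply: continuous_compact_integrable; first exact: segment_compact.
  exact: continuous_subspaceT.
- lra.
- exact: cf.
Unshelve. all: by end_near. Qed.

(** A bump swept over the distance T. Its derivative f s - f (s - T) is what produces the
    increment of a function from its weak derivative. *)
Definition sweep (T : R) f s : R := Rintegral mu `[0, T] (fun t => f (s - t)).

Lemma continuous_reflect f s : continuous f -> continuous (fun t : R => f (s - t)).
Proof.
move=> cf x; apply: (@continuous_comp _ _ _ (fun t : R => s - t) f); last exact: cf.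
by apply: continuousB; [exact: cst_continuous|move=> ?; exact: cvg_id].
Qed.

Lemma sweep_primitive T f Psi s : 0 < T -> continuous f ->
  (forall s : R, is_derive s 1 Psi (f s)) -> sweep T f s = Psi s - Psi (s - T).
Proof.
move=> T0 cf dPsi.
have dG (t : R) : is_derive t 1 (fun t => - Psi (s - t)) (f (s - t)).
  have d1 := dPsi (s - t).
  have d2 : is_derive t 1 (fun t : R => s - t) (- 1).
    have := @is_derive_affine R (- 1) s t.
    by under eq_fun do rewrite mulN1r addrC.
  have d3 := @is_derive1_comp R Psi (fun t => s - t) t _ _ d1 d2.
  have := @is_deriveN _ _ _ (Psi \o (fun t => s - t)) t 1 _ d3.
  by rewrite mulrN1 opprK.
have cG := is_derive_continuous dG.
rewrite /sweep /Rintegral (@continuous_FTC2 R _ (fun t => - Psi (s - t)) _ _ T0).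
- by rewrite -EFinB/= subr0 opprK addrC.
- by apply: continuous_subspaceT; exact: continuous_reflect.
- split.
  + by move=> x _; have [] := dG x.
  + by apply: cvg_at_right_filter; exact: cG.
  + by apply: cvg_at_left_filter; exact: cG.
- by move=> x _; rewrite derive1E; have [] := dG x.
Qed.

Lemma is_derive_sweep T f (a s : R) : 0 < T -> continuous f ->
  (forall t, t <= a -> f t = 0) -> is_derive s 1 (sweep T f) (f s - f (s - T)).
Proof.
move=> T0 cf f0; have [Psi dPsi] := primitive cf f0.
have -> : sweep T f = (fun s => Psi s - Psi (s - T)).
  by apply/funext => u; exact: sweep_primitive.
have d1 := dPsi (s - T).
have d2 : is_derive s 1 (fun t : R => t - T) 1.
  have := @is_derive_affine R 1 (- T) s.
  by under eq_fun do rewrite mul1r.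
have d3 := @is_derive1_comp R Psi (fun t => t - T) s _ _ d1 d2.
have d4 := @is_deriveB _ _ _ Psi (Psi \o (fun t => t - T)) s 1 _ _ (dPsi s) d3.
by rewrite mulr1 in d4.
Qed.

Lemma smooth_sweep T f (a : R) : 0 < T -> (forall t, t <= a -> f t = 0) ->
  smooth f -> smooth (sweep T f).
Proof.
move=> T0 f0 sf m; apply: smooth_uptoW.
exists (fun s => f s - f (s - T)) => [s|].
  by apply: (is_derive_sweep _ T0 _ f0); exact: (sf 0%N).
apply: smooth_uptoD => //.
apply: (@smooth_upto_ext _ _ (fun x => cst (- 1) x * f (1 * x + - T))).
  by move=> x; rewrite mul1r mulN1r.
by apply: smooth_uptoM; [exact: smooth_cst|exact: smooth_upto_affine].
Qed.

Lemma sweep_out T f (a b s : R) : (forall t, ~~ (a < t < b) -> f t = 0) ->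
  ~~ (a < s < b + T) -> sweep T f s = 0.
Proof.
move=> f0 sab; rewrite /sweep /Rintegral integral0_eq// => t.
rewrite /= in_itv/= => /andP[t0 tT]; rewrite f0//.
apply: contra sab => /andP[h1 h2]; apply/andP; split; lra.
Qed.

Lemma sweep_ge0_le T f (s : R) : 0 < T -> continuous f ->
  (forall t, 0 <= f t) -> (forall t, f t <= 1) -> 0 <= sweep T f s <= T.
Proof.
move=> T0 cf f0 f1; have cr := @continuous_reflect f s cf.
apply/andP; split; first by apply: Rintegral_ge0 => //.
have : (\int[mu]_(t in `[0%R, T]) (f (s - t))%:E <= T%:E)%E.
  apply: (@le_trans _ _ (\int[mu]_(t in `[0%R, T]) (cst 1%E) t)%E).
    apply: ge0_le_integral => //.
    - by move=> t _; rewrite lee_fin.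
    - by apply/measurable_EFinP; apply: measurable_funTS; exact: continuous_measurable_fun.
    - by move=> t _; rewrite lee_fin.
  by rewrite int1.
rewrite /sweep /Rintegral => h; rewrite -lee_fin fineK//.
rewrite ge0_fin_numE; first by rewrite (le_lt_trans h) ?ltry.
by apply: integral_ge0 => t _; rewrite lee_fin.
Qed.

(** The limit of the sweeps of box_bump a b k as k grows. *)
Definition dwell (a b T s : R) : \bar R :=
  \int[mu]_(t in `[0, T]) ((a < s - t < b)%R%:R)%:E.

Lemma sweep_bump_cvg T (a b s : R) : 0 < T -> dwell a b T s \is a fin_num /\
  (fun k => (sweep T (box_bump a b k) s)%:E) @ \oo --> dwell a b T s.
Proof.
move=> T0; have cb k : continuous (box_bump a b k) by exact: (@smooth_bump R a b k 0%N).
have cr k := @continuous_reflect (box_bump a b k) s (cb k).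
have E k : (sweep T (box_bump a b k) s)%:E = (\int[mu]_(t in `[0%R, T]) (box_bump a b k (s - t))%:E)%E.
  rewrite /sweep /Rintegral fineK// ge0_fin_numE; last first.
    by apply: integral_ge0 => t _; rewrite lee_fin box_bump_ge0.
  apply: (@le_lt_trans _ _ (\int[mu]_(t in `[0%R, T]) (cst 1%E) t)%E).
    apply: ge0_le_integral => //.
    - by move=> t _; rewrite lee_fin box_bump_ge0.
    - by apply/measurable_EFinP; apply: measurable_funTS; exact: continuous_measurable_fun.
    - by move=> t _; rewrite lee_fin box_bump_le1.
  by rewrite int1// ltry.
under eq_fun do rewrite E.
have mfk k : measurable_fun (`[0%R, T] : set R) (fun t : R => (box_bump a b k (s - t))%:E).
  by apply/measurable_EFinP; apply: measurable_funTS; exact: continuous_measurable_fun.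
have cvb (t : R) : (fun k => (box_bump a b k (s - t))%:E) @ \oo --> ((a < s - t < b)%R%:R%:E : \bar R).
  by apply: cvg_EFin; [exact: nearW|exact: box_bump_cvg].
have [] := @dominated_convergence _ _ R mu (`[0%R, T] : set R) _
  (fun k t => (box_bump a b k (s - t))%:E) (fun t => ((a < s - t < b)%R%:R)%:E) (cst 1%E).
- exact: measurable_itv.
- exact: mfk.
- apply: (emeasurable_fun_cvg _ _ mfk) => t _; exact: cvb.
- by apply: aeW => t _; exact: cvb.
- apply/integrableP; split => //.
  rewrite (eq_integral (cst 1%E)); last by move=> t _; rewrite /= normr1.
  by rewrite int1// ltry.
- by apply: aeW => t k _; rewrite /= lee_fin ger0_norm ?box_bump_ge0 ?box_bump_le1.
- by move=> H _ h; split; [exact: integrable_fin_num H|exact: h].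
Qed.

End sweep.

(** * Test functions and weak derivatives *)

Section test_functions.
Context (R : realType) (n : nat) (i : 'I_n).
Local Notation B := (borel_rV R n).
Local Notation lam := (borel_lebesgue R n).
Local Notation mu := (@lebesgue_measure R).
Local Notation e := (delta_mx ord0 i : 'rV[R]_n).
Implicit Types (psi : 'I_n -> R -> R) (u v x : 'rV[R]_n).

Lemma compact_ccube r : compact (@ccube R n r).
Proof.
have -> : @ccube R n r = [set x | forall j, `[- r, r]%classic (x ord0 j)].
  by apply/seteqP; split => x xr j; move: (xr j); rewrite /= in_itv.
by apply: (@rV_compact R n (fun=> `[- r, r]%classic)) => j; exact: segment_compact.
Qed.

Lemma compact_support (phi : 'rV[R]_n -> R) r : (forall x, ~ ccube r x -> phi x = 0) ->
  compact (closure [set x | phi x != 0]).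
Proof.
move=> phi0; have cr := @compact_ccube r.
apply: (subclosed_compact (@closed_closure _ _) cr).
rewrite (closure_id (ccube r)).1; last exact: compact_closed (@norm_hausdorff _ _) cr.
apply: closure_subset => x /= px; apply: contrapT => xr.
by move: px; rewrite phi0 ?eqxx.
Qed.

Lemma measurable_coord (f : R -> R) j : measurable_fun setT f ->
  measurable_fun setT (fun x : B => f ((x : 'rV[R]_n) ord0 j)).
Proof. by move=> mf; apply: measurableT_comp => //; exact: measurable_borel_rV_coord. Qed.

Lemma measurable_tensor psi : (forall j, measurable_fun setT (psi j)) ->
  measurable_fun setT (tensor psi : B -> R).
Proof.
move=> mpsi; rewrite /tensor; elim: (index_enum _) => [|j s IH].
  by under eq_fun do rewrite big_nil; exact: measurable_cst.
under eq_fun do rewrite big_cons.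
by apply: measurable_funM => //; exact: measurable_coord.
Qed.

Lemma tensor_bound psi (j : 'I_n) (c : R) x : (forall l, l != j -> 0 <= psi l (x ord0 l) <= 1) ->
  0 <= psi j (x ord0 j) <= c -> 0 <= tensor psi x <= c.
Proof.
move=> h /andP[p0 pc]; rewrite /tensor (bigD1 j)//=.
have h0 : 0 <= \prod_(l < n | l != j) psi l (x ord0 l).
  by apply: prodr_ge0 => l /h/andP[].
have h1 : \prod_(l < n | l != j) psi l (x ord0 l) <= 1 by apply: prodr_ile1.
by rewrite mulr_ge0//= (le_trans _ pc)// ler_piMr.
Qed.

Lemma tensor_eq0 psi j x : psi j (x ord0 j) = 0 -> tensor psi x = 0.
Proof. by move=> h; rewrite /tensor (bigD1 j)//= h mul0r. Qed.

Lemma cvg_bigprod (P : pred 'I_n) (f : nat -> 'I_n -> R) (l : 'I_n -> R) :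
  (forall j, P j -> (fun k => f k j) @ \oo --> l j) ->
  (fun k => \prod_(j < n | P j) f k j) @ \oo --> \prod_(j < n | P j) l j.
Proof.
move=> fl; elim: (index_enum _) => [|j s IH].
  by under eq_fun do rewrite big_nil; rewrite big_nil; exact: cvg_cst.
under eq_fun do rewrite big_cons; rewrite big_cons.
by case: ifP => // Pj; apply: cvgM; [exact: fl|exact: IH].
Qed.

Definition in_box u v : 'I_n -> R -> R := fun j t => (u ord0 j < t < v ord0 j)%R%:R.

Lemma tensor_in_box u v x : tensor (in_box u v) x = (x \in obox u v)%:R.
Proof.
have [|] := boolP (x \in obox u v) => xuv.
  move/set_mem: xuv => xuv; rewrite /tensor big1// => j _.
  by rewrite /in_box xuv.
have /existsNP[j xj] : ~ obox u v x by move/mem_set; exact/negP.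
by apply: (@tensor_eq0 _ j); rewrite /in_box (negbTE (introN idP xj)).
Qed.

Definition bumps u v k : 'I_n -> R -> R := fun j => box_bump (u ord0 j) (v ord0 j) k.

(** A test function whose derivative along e_i approximates the difference of the indicators of
    a box and of its translate by T e_i. *)
Definition sweep_test T u v k := tensor (replace (bumps u v k) i (sweep T (bumps u v k i))).

Lemma smooth_bumps u v k j : smooth (bumps u v k j).
Proof. exact: smooth_bump. Qed.

Lemma tensor_replace psi f x : tensor (replace psi i f) x =
  f (x ord0 i) * \prod_(j < n | j != i) psi j (x ord0 j).
Proof.
rewrite /tensor (bigD1 i)//= /replace eqxx; congr (_ * _).
by apply: eq_bigr => j /negbTE ->.
Qed.

Lemma tensor_shift psi t x : tensor psi (x - t *: e) =
  tensor (replace psi i (fun s => psi i (s - t))) x.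
Proof.
rewrite tensor_replace /tensor (bigD1 i)//= !mxE !eqxx mulr1; congr (_ * _).
by apply: eq_bigr => j ji; rewrite !mxE eqxx/= (negbTE ji) mulr0 subr0.
Qed.

Lemma bounding_radius u v T : exists r : R, forall x,
  (forall j, u ord0 j < x ord0 j < v ord0 j + T) -> ccube r x.
Proof.
have [k uk] := row_bounded u; have [l vl] := row_bounded v.
exists (k%:R + l%:R + `|T|) => x xuv j.
move: (uk j) (vl j) (xuv j) (ler_norm T) (normr_ge0 T).
rewrite !ltr_norml => /andP[? ?] /andP[? ?] /andP[? ?] ? ?.
have k0 : 0 <= k%:R :> R by []. have l0 : 0 <= l%:R :> R by [].
apply/andP; split; lra.
Qed.

Section fixed_box.
Variables (u v : 'rV[R]_n) (T r : R).
Hypothesis T0 : 0 < T.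
Hypothesis box_r : forall x, (forall j, u ord0 j < x ord0 j < v ord0 j + T) -> ccube r x.
Local Notation A := (obox u v).

Lemma obox_r x : A x -> ccube r x.
Proof.
move=> xA; apply: box_r => j; have /andP[-> h] := xA j; rewrite (lt_le_trans h)//.
by rewrite lerDl ltW.
Qed.

Lemma obox_shift_r t x : 0 <= t <= T -> A (x - t *: e) -> ccube r x.
Proof.
move=> /andP[t0 tT] xA; apply: box_r => j; have := xA j; rewrite !mxE eqxx/=.
by case: (j == i) => /=; rewrite ?mulr1 ?mulr0 => /andP[? ?]; apply/andP; split; lra.
Qed.

Lemma bumps_out k x : ~ A x -> tensor (bumps u v k) x = 0.
Proof.
by move=> /existsNP[j /negP xj]; apply: (@tensor_eq0 _ j); exact: box_bump_out.
Qed.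

Lemma bumps_bound k x : 0 <= tensor (bumps u v k) x <= 1.
Proof.
apply: (@tensor_bound _ i) => [l _|]; by rewrite box_bump_ge0 box_bump_le1.
Qed.

Lemma sweep_test_out k x : ~ ccube r x -> sweep_test T u v k x = 0.
Proof.
move=> xr; have [j /negP xj] : exists j, ~ (u ord0 j < x ord0 j < v ord0 j + T).
  by apply/existsNP => H; apply: xr; exact: box_r.
apply: (@tensor_eq0 _ j); rewrite /replace; have [ji|ji] := eqVneq j i.
  by rewrite ji in xj *; apply: (sweep_out _ xj) => t; exact: box_bump_out.
apply: box_bump_out; apply: contra xj => /andP[-> h]; rewrite (lt_le_trans h)//.
by rewrite lerDl ltW.
Qed.

Lemma sweep_test_bound k x : 0 <= sweep_test T u v k x <= T.
Proof.
apply: (@tensor_bound _ i) => [l li|].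
  by rewrite /replace (negbTE li) box_bump_ge0 box_bump_le1.
rewrite /replace eqxx; apply: sweep_ge0_le => // [|t|t].
- exact: (@smooth_bumps u v k i 0%N).
- exact: box_bump_ge0.
- exact: box_bump_le1.
Qed.

Lemma bumps_left k t : t <= u ord0 i -> bumps u v k i t = 0.
Proof. by move=> tu; apply: box_bump_out; rewrite negb_and -leNgt tu. Qed.

Lemma sweep_test_function k : test_function (sweep_test T u v k).
Proof.
split => [m|]; last exact: (compact_support (@sweep_test_out k)).
apply: C_k_tensor => j; rewrite /replace; case: ifP => _; last exact: smooth_bumps.
apply: (smooth_sweep T0 (bumps_left k)); exact: smooth_bumps.
Qed.

Lemma partial_sweep_test k x : partial i (sweep_test T u v k) x =
  tensor (bumps u v k) x - tensor (bumps u v k) (x - T *: e).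
Proof.
have ds : is_derive (x ord0 i) 1 (replace (bumps u v k) i (sweep T (bumps u v k i)) i)
   (bumps u v k i (x ord0 i) - bumps u v k i (x ord0 i - T)).
  rewrite /replace eqxx; apply: (is_derive_sweep _ T0 _ (bumps_left k)).
  exact: (@smooth_bumps u v k i 0%N).
have [_] := @is_derive_tensor _ _ _ i (fun s => bumps u v k i s - bumps u v k i (s - T)) x ds.
rewrite /partial => ->; rewrite tensor_shift !tensor_replace -[X in tensor X x]/(bumps u v k).
rewrite /tensor [in RHS](bigD1 i)//= mulrBl; congr (_ * _ - _ * _);
  by apply: eq_bigr => j /negbTE ji; rewrite /replace ji.
Qed.

Lemma bumps_cvg x : (fun k => tensor (bumps u v k) x) @ \oo --> ((x \in A)%:R : R).
Proof.
rewrite -tensor_in_box /tensor; apply: cvg_bigprod => j _; exact: box_bump_cvg.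
Qed.

(** The time that x - t e_i spends in the box for t in [0, T]: the limit of the test functions. *)
Definition sweep_weight x : \bar R := \int[mu]_(t in `[0%R, T]) ((x - t *: e \in A)%:R)%:E.

Lemma sweep_test_cvg x : sweep_weight x \is a fin_num /\
  (fun k => (sweep_test T u v k x)%:E) @ \oo --> sweep_weight x.
Proof.
have [df dc] := sweep_bump_cvg (u ord0 i) (v ord0 i) (x ord0 i) T0.
pose c : R := \prod_(j < n | j != i) in_box u v j (x ord0 j).
have wE : sweep_weight x = (c%:E * dwell (u ord0 i) (v ord0 i) T (x ord0 i))%E.
  rewrite /dwell -ge0_integralZl_EFin//.
  - by apply: eq_integral => t _; rewrite -tensor_in_box tensor_shift tensor_replace -EFinM mulrC.
  - apply/measurable_EFinP; apply: measurable_funTS.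
    have -> : (fun t : R => (u ord0 i < x ord0 i - t < v ord0 i)%R%:R : R) =
        \1_(`]u ord0 i, v ord0 i[%classic) \o (fun t : R => x ord0 i - t).
      apply/funext => t; rewrite /= indicE; congr (nat_of_bool _)%:R.
      by apply/idP/idP => [h|/set_mem]; [rewrite mem_set//= in_itv|rewrite /= in_itv].
    apply: measurableT_comp; first exact: measurable_indic.
    by apply: measurable_funB => //; exact: measurable_cst.
  - by apply: prodr_ge0 => j _; rewrite /in_box.
rewrite wE; split; first by rewrite fin_numM.
have -> : (fun k => (sweep_test T u v k x)%:E) = (fun k =>
    (\prod_(j < n | j != i) bumps u v k j (x ord0 j))%:E * (sweep T (bumps u v k i) (x ord0 i))%:E)%E.
  by apply/funext => k; rewrite /sweep_test tensor_replace mulrC EFinM.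
apply: cvgeM; last 2 first.
- apply: cvg_EFin; first exact: nearW.
  by apply: cvg_bigprod => j _; exact: box_bump_cvg.
- exact: dc.
by rewrite mule_def_fin.
Qed.

End fixed_box.
End test_functions.

Section weak_partial.
Context (R : realType) (n : nat) (i : 'I_n).
Local Open Scope ereal_scope.
Local Notation B := (borel_rV R n).
Local Notation lam := (borel_lebesgue R n).
Local Notation mu := (@lebesgue_measure R).
Local Notation e := (delta_mx ord0 i : 'rV[R]_n).
Implicit Types (F G : 'rV[R]_n -> R).

Definition integrable_on_cubes F := measurable_fun setT (F : B -> R) /\
  forall r, \int[lam]_(x in ccube r) `|F x|%:E < +oo.

(** Only Borel test functions with a Borel derivative are used, so that both sides are integrals
    against the Borel measure. *)
Definition weak_partial F G := forall phi, test_function phi ->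
  measurable_fun setT (phi : B -> R) -> measurable_fun setT (partial i phi : B -> R) ->
  \int[lam]_x (F x * partial i phi x)%:E = - \int[lam]_x (G x * phi x)%:E.

Lemma integrable_ccube F r : integrable_on_cubes F ->
  lam.-integrable (ccube r) (fun x => (F x)%:E).
Proof.
move=> [mF Foo]; apply/integrableP; split; last exact: Foo.
by apply/measurable_EFinP; exact: measurable_funTS.
Qed.

Lemma integral_support (D : set B) (f : B -> \bar R) : (forall x, ~ D x -> f x = 0) ->
  \int[lam]_x f x = \int[lam]_(x in D) f x.
Proof.
move=> f0; rewrite [RHS]integral_mkcond; apply: eq_integral => x _.
by rewrite patchE; case: ifPn => // /negP xD; rewrite f0// => /mem_set.
Qed.

Section fixed_box.
Variables (u v : 'rV[R]_n) (T r : R) (F G : 'rV[R]_n -> R).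
Hypothesis T0 : (0 < T)%R.
Hypothesis box_r : forall x : 'rV[R]_n,
  (forall j, (u ord0 j < x ord0 j < v ord0 j + T)%R) -> ccube r x.
Hypotheses (iF : integrable_on_cubes F) (iG : integrable_on_cubes G).
Hypothesis FG : weak_partial F G.
Local Notation A := (obox u v).
Let mF : measurable_fun setT (F : B -> R) := iF.1.
Let mG : measurable_fun setT (G : B -> R) := iG.1.
Let mD : measurable (ccube r : set B) := measurable_cube (cube_ccube n r).

Lemma measurable_bumps k : measurable_fun setT (tensor (bumps u v k) : B -> R).
Proof.
apply: measurable_tensor => j; apply: continuous_measurable_fun.
exact: (@smooth_bumps R n u v k j 0%N).
Qed.

Lemma measurable_sweep_test k : measurable_fun setT (sweep_test i T u v k : B -> R).
Proof.
apply: measurable_tensor => j; apply: continuous_measurable_fun.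
rewrite /replace; case: ifP => _; last exact: (@smooth_bumps R n u v k j 0%N).
apply: (smooth_sweep T0 (@bumps_left R n i u v k)) (0%N); exact: smooth_bumps.
Qed.

Lemma measurable_partial_sweep_test k :
  measurable_fun setT (partial i (sweep_test i T u v k) : B -> R).
Proof.
have -> : partial i (sweep_test i T u v k) =
   (fun x => tensor (bumps u v k) x - tensor (bumps u v k) (x - T *: e))%R.
  by apply/funext => x; rewrite partial_sweep_test.
apply: measurable_funB; first exact: measurable_bumps.
by apply: (measurableT_comp (measurable_bumps k)); exact: measurable_translation.
Qed.

(** Pass to the limit in the identity for sweep_test by dominated convergence: the test functions
    are at most T, their derivatives at most 1, and all are supported in one cube. *)
Lemma weak_sweep :
  lam.-integrable (ccube r) (fun x => (G x)%:E * sweep_weight i u v T x) /\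
  \int[lam]_(x in ccube r) (F x * ((x \in A)%:R - (x - T *: e \in A)%:R))%:E =
  - \int[lam]_(x in ccube r) ((G x)%:E * sweep_weight i u v T x).
Proof.
have iabs H : integrable_on_cubes H -> lam.-integrable (ccube r) (fun x => `|H x|%:E).
  by move=> iH; have := integrable_abse (integrable_ccube r iH).
have mf k : measurable_fun (ccube r : set B) (fun x => (F x * partial i (sweep_test i T u v k) x)%:E).
  apply/measurable_EFinP; apply: measurable_funTS; apply: measurable_funM => //.
  exact: measurable_partial_sweep_test.
have cf x : (fun k => (F x * partial i (sweep_test i T u v k) x)%:E) @ \oo -->
    (F x * ((x \in A)%:R - (x - T *: e \in A)%:R))%:E.
  apply: cvg_EFin; first exact: nearW.
  apply: cvgMr; under eq_fun do rewrite partial_sweep_test//.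
  by apply: cvgB; exact: bumps_cvg.
have [] := @dominated_convergence _ _ R lam (ccube r) mD
  (fun k x => (F x * partial i (sweep_test i T u v k) x)%:E)
  (fun x => (F x * ((x \in A)%:R - (x - T *: e \in A)%:R))%:E) (fun x => `|F x|%:E).
- exact: mf.
- by apply: (emeasurable_fun_cvg _ _ mf) => x _; exact: cf.
- by apply: aeW => x _; exact: cf.
- exact: iabs.
- apply: aeW => x k _; rewrite lee_fin normrM ler_piMr// partial_sweep_test//.
  have := bumps_bound i u v k x; have := bumps_bound i u v k (x - T *: e)%R.
  move=> /andP[? ?] /andP[? ?]; rewrite ler_norml; apply/andP; split; lra.
move=> _ _ cvF.
have mg k : measurable_fun (ccube r : set B) (fun x => (G x * sweep_test i T u v k x)%:E).
  apply/measurable_EFinP; apply: measurable_funTS; apply: measurable_funM => //.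
  exact: measurable_sweep_test.
have cg x : (fun k => (G x * sweep_test i T u v k x)%:E) @ \oo -->
    (G x)%:E * sweep_weight i u v T x.
  under eq_fun do rewrite EFinM.
  have [wf wc] := sweep_test_cvg i u v T0 x.
  by apply: cvgeM => //; [rewrite mule_def_fin|exact: cvg_cst].
have [] := @dominated_convergence _ _ R lam (ccube r) mD
  (fun k x => (G x * sweep_test i T u v k x)%:E)
  (fun x => (G x)%:E * sweep_weight i u v T x) (fun x => T%:E * `|G x|%:E).
- exact: mg.
- by apply: (emeasurable_fun_cvg _ _ mg) => x _; exact: cg.
- by apply: aeW => x _; exact: cg.
- by apply: integrableZl => //; exact: iabs.
- apply: aeW => x k _; rewrite lee_fin normrM mulrC ler_wpM2r//.
  by have /andP[h0 h1] := sweep_test_bound i u v T0 k x; rewrite ger0_norm.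
move=> iGw _ cvG; split => //.
have E k : \int[lam]_(x in ccube r) (F x * partial i (sweep_test i T u v k) x)%:E =
   - \int[lam]_(x in ccube r) (G x * sweep_test i T u v k x)%:E.
  rewrite -integral_support => [|x xr].
    rewrite (FG (sweep_test_function i T0 box_r k)).
    - congr (- _); apply: integral_support => x xr.
      by rewrite (sweep_test_out i T0 box_r)// mulr0.
    - exact: measurable_sweep_test.
    - exact: measurable_partial_sweep_test.
  rewrite partial_sweep_test// !bumps_out ?subr0 ?mulr0//.
    by move=> xA; apply: xr; apply: (obox_shift_r box_r _ xA); rewrite lexx ltW.
  by move=> xA; apply: xr; exact: (obox_r T0 box_r).
apply: (cvg_unique _ cvF) => //.
by rewrite /= (eq_cvg _ _ E); exact: cvgeN.
Qed.

Section nonneg.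
Variable f : 'rV[R]_n -> R.
Hypotheses (mf : measurable_fun setT (f : B -> R)) (f0 : forall x, (0 <= f x)%R).
Let mA : measurable (A : set B) := measurable_obox u v.

Lemma integral_mask (D : set B) (g : B -> R) (h : B -> R) : measurable D ->
  (forall x, D x -> h x = 1%R) -> (forall x, ~ D x -> h x = 0%R) ->
  \int[lam]_x (g x * h x)%:E = \int[lam]_(x in D) (g x)%:E.
Proof.
move=> mD1 h1 h0; rewrite (integral_support (D := D)) => [|x xD]; last by rewrite h0// mulr0.
by apply: eq_integral => x /set_mem xD; rewrite h1// mulr1.
Qed.

Lemma integral_indic_shift (g : 'rV[R]_n -> R) (t : R) : measurable_fun setT (g : B -> R) ->
  (forall x, 0 <= g x)%R ->
  \int[lam]_x (g x * (x - t *: e \in A)%:R)%:E = \int[lam]_(x in A) (g (x + t *: e))%:E.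
Proof.
move=> mg g0; have mg' : measurable_fun setT (fun x : B => (g (x + t *: e))%:E).
  apply/measurable_EFinP; apply: (measurableT_comp mg).
  exact: measurable_translation.
rewrite -(@ge0_integral_translate R n (- (t *: e))%R A (fun x => (g (x + t *: e))%:E) mA); last 2 first.
- exact: measurable_funTS.
- by move=> x _; rewrite lee_fin.
rewrite (@integral_mask ((fun x => x + - (t *: e))%R @^-1` A)).
- by apply: eq_integral => x _; rewrite subrK.
- exact: measurable_preimage_translation.
- by move=> x /= xA; rewrite mem_set.
- by move=> x /= xA; rewrite memNset.
Qed.

Lemma measurable_translate2 (c : R) : measurable_fun setT
  (fun z : measurableTypeR R * B => (z.2 : 'rV[R]_n) + (c * z.1) *: e : B)%R.
Proof.
apply: measurable_fun_borel_rV => j.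
rewrite [X in measurable_fun _ X](_ : _ =
  (fun z => borel_rV_coord j z.2 + (c * z.1) * e ord0 j)%R); last first.
  by apply/funext => z; rewrite /= /borel_rV_coord !mxE.
apply: measurable_funD; first by apply: measurableT_comp => //; exact: measurable_borel_rV_coord.
by apply: measurable_funM => //; apply: measurable_funM.
Qed.

(** Exchange the integrals in t and x, then translate by t e_i. *)
Lemma integral_sweep_weight :
  \int[lam]_x ((f x)%:E * sweep_weight i u v T x) =
  \int[lam]_(x in A) \int[mu]_(t in `[0%R, T]) (f (x + t *: e))%:E.
Proof.
have mIA : measurable_fun setT (fun x : B => (x \in A)%:R : R).
  have -> : (fun x : B => (x \in A)%:R : R) = \1_A by apply/funext => t; rewrite indicE.
  exact: measurable_indic.
have mA2 : measurable_fun setT (fun z : measurableTypeR R * B => (z.2 - z.1 *: e \in A)%:R : R)%R.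
  under eq_fun do rewrite -scaleNr -mulN1r.
  exact: (measurableT_comp mIA (measurable_translate2 (- 1)%R)).
have mf1 : measurable_fun setT (fun z : measurableTypeR R * B => f z.2).
  exact: (measurableT_comp mf measurable_snd).
have mf2 : measurable_fun setT (fun z : measurableTypeR R * B => f (z.2 + z.1 *: e)%R).
  have := measurableT_comp mf (measurable_translate2 1%R).
  by under eq_fun do rewrite /= mul1r.
transitivity (\int[lam]_x \int[mu]_(t in `[0%R, T]) (f x * (x - t *: e \in A)%:R)%:E).
  apply: eq_integral => x _; rewrite /sweep_weight -ge0_integralZl_EFin//.
  apply: measurable_funTS; apply/measurable_EFinP.
  exact: (measurableT_comp mA2 (measurable_pair2 x)).
rewrite -(@tonelli_subset _ _ _ _ R mu lam
  (fun t x => (f x * (x - t *: e \in A)%:R)%:E) `[0%R, T]%classic setT); last 4 first.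
- exact: measurable_itv.
- exact: measurableT.
- by apply/measurable_EFinP; exact: measurable_funM.
- by move=> t x; rewrite lee_fin mulr_ge0.
transitivity (\int[mu]_(t in `[0%R, T]) \int[lam]_(x in A) (f (x + t *: e))%:E).
  by apply: eq_integral => t _; exact: integral_indic_shift.
apply: (@tonelli_subset _ _ _ _ R mu lam (fun t x => (f (x + t *: e))%:E)) => //.
- exact/measurable_EFinP.
- by move=> t x; rewrite lee_fin.
Qed.

End nonneg.

Definition pos_part (f : 'rV[R]_n -> R) : 'rV[R]_n -> R := fun x => Num.max (f x) 0%R.

Lemma pos_part_ge0 f x : (0 <= pos_part f x)%R.
Proof. by rewrite /pos_part le_max lexx orbT. Qed.

Lemma measurable_pos_part f : measurable_fun setT (f : B -> R) ->
  measurable_fun setT (pos_part f : B -> R).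
Proof. by move=> mf; apply: measurable_maxr. Qed.

Lemma measurable_opp_fun f : measurable_fun setT (f : B -> R) ->
  measurable_fun setT (\- f : B -> R)%R.
Proof. by move=> mf; apply: measurableT_comp. Qed.

Lemma integral_pos_neg (D : set B) (g : B -> R) (w : B -> \bar R) :
  measurable D -> (forall x, 0 <= w x) ->
  lam.-integrable D (fun x => (g x)%:E * w x) ->
  exists p m : R, [/\ \int[lam]_(x in D) ((pos_part g x)%:E * w x) = p%:E,
    \int[lam]_(x in D) ((pos_part (\- g)%R x)%:E * w x) = m%:E &
    \int[lam]_(x in D) ((g x)%:E * w x) = (p - m)%:E].
Proof.
move=> mD1 w0 igw.
have posE x : (pos_part g x)%:E * w x = (fun x => (g x)%:E * w x)^\+ x.
  rewrite funeposE /pos_part; have [g0|g0] := leP 0%R (g x).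
    by rewrite max_l// mule_ge0.
  by rewrite mul0e max_r// mule_le0_ge0// lee_fin ltW.
have negE x : (pos_part (\- g)%R x)%:E * w x = (fun x => (g x)%:E * w x)^\- x.
  rewrite funenegE /pos_part -mulNe; have [g0|g0] := leP 0%R (- g x)%R.
    by rewrite EFinN max_l// mule_ge0// -EFinN lee_fin.
  by rewrite mul0e max_r// mule_le0_ge0// -EFinN lee_fin ltW.
have pf := integrable_pos_fin_num mD1 igw; have nf := integrable_neg_fin_num mD1 igw.
exists (fine (\int[lam]_(x in D) (fun x => (g x)%:E * w x)^\+ x)).
exists (fine (\int[lam]_(x in D) (fun x => (g x)%:E * w x)^\- x)).
have -> : \int[lam]_(x in D) ((pos_part g x)%:E * w x) =
    \int[lam]_(x in D) (fun x => (g x)%:E * w x)^\+ x by apply: eq_integral => x _; exact: posE.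
have -> : \int[lam]_(x in D) ((pos_part (\- g)%R x)%:E * w x) =
    \int[lam]_(x in D) (fun x => (g x)%:E * w x)^\- x by apply: eq_integral => x _; exact: negE.
by split; rewrite ?EFinB ?fineK// [LHS]integralE.
Qed.

(** One side of the identity F (x + T e) - F x = the integral of G on [x, x + T e], with negative
    parts moved across so that every term is nonnegative. The other side is
    increment (-f) (-g). Both are then densities of measures, whether or not the line integral
    of G converges absolutely. *)
Definition increment (f g : 'rV[R]_n -> R) x : \bar R :=
  (pos_part f (x + T *: e))%:E + (pos_part (\- f)%R x)%:E +
    \int[mu]_(t in `[0%R, T]) (pos_part (\- g)%R (x + t *: e))%:E.

Lemma measurable_line_integral f : measurable_fun setT (f : B -> R) -> (forall x, 0 <= f x)%R ->
  measurable_fun setT (fun x : B => \int[mu]_(t in `[0%R, T]) (f (x + t *: e))%:E).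
Proof.
move=> mf f0.
have H := @measurable_fun_fubini_tonelli_G _ _ _ _ R mu
  (fun z : measurableTypeR R * B => (\1_(`[0%R, T]%classic) z.1 * f (z.2 + z.1 *: e))%:E).
apply: (eq_measurable_fun _ _ (H _ _)) => [x _| |z].
- rewrite [RHS]integral_mkcond; apply: eq_integral => t _.
  by rewrite patchE indicE; case: ifPn; rewrite ?mul1r ?mul0r.
- apply/measurable_EFinP; apply: measurable_funM.
    by apply: (measurableT_comp _ measurable_fst); exact: measurable_indic.
  have := measurableT_comp mf (measurable_translate2 1%R).
  by under eq_fun do rewrite /= mul1r.
- by rewrite lee_fin mulr_ge0.
Qed.

Lemma measurable_increment f g : measurable_fun setT (f : B -> R) ->
  measurable_fun setT (g : B -> R) -> measurable_fun setT (increment f g : B -> \bar R).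
Proof.
move=> mf mg; apply: emeasurable_funD.
  apply: emeasurable_funD; apply/measurable_EFinP.
    exact: measurable_translate_fun (measurable_pos_part mf).
  exact: (measurable_pos_part (measurable_opp_fun mf)).
apply: measurable_line_integral; last exact: pos_part_ge0.
exact: (measurable_pos_part (measurable_opp_fun mg)).
Qed.

Lemma increment_ge0 f g x : 0 <= increment f g x.
Proof.
rewrite /increment; apply: adde_ge0; first by rewrite adde_ge0 ?lee_fin ?pos_part_ge0.
by apply: integral_ge0 => t _; rewrite lee_fin pos_part_ge0.
Qed.

Lemma integral_increment f g : measurable_fun setT (f : B -> R) ->
  measurable_fun setT (g : B -> R) ->
  \int[lam]_(x in A) increment f g x =
  \int[lam]_(x in ccube r) ((pos_part f x)%:E * (x - T *: e \in A)%:R%:E) +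
  \int[lam]_(x in ccube r) ((pos_part (\- f)%R x)%:E * (x \in A)%:R%:E) +
  \int[lam]_(x in ccube r) ((pos_part (\- g)%R x)%:E * sweep_weight i u v T x).
Proof.
move=> mf mg; have mA := measurable_obox u v.
have mpf := measurable_pos_part mf; have mnf := measurable_pos_part (measurable_opp_fun mf).
have mng := measurable_pos_part (measurable_opp_fun mg).
have D0 x : ~ ccube r x -> ~ A x by move=> xr xA; apply: xr; exact: (obox_r T0 box_r).
have Dt t x : (0 <= t <= T)%R -> ~ ccube r x -> ~ A (x - t *: e)%R.
  by move=> tT xr xA; apply: xr; exact: (obox_shift_r box_r tT xA).
have -> : \int[lam]_(x in ccube r) ((pos_part f x)%:E * (x - T *: e \in A)%:R%:E) =
    \int[lam]_(x in A) (pos_part f (x + T *: e))%:E.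
  rewrite -(integral_support (D := ccube r)) => [|x xr]; last first.
    by rewrite memNset ?mule0//; apply: Dt => //; rewrite lexx ltW.
  under eq_integral do rewrite -EFinM.
  by rewrite integral_indic_shift//; exact: pos_part_ge0.
have -> : \int[lam]_(x in ccube r) ((pos_part (\- f)%R x)%:E * (x \in A)%:R%:E) =
    \int[lam]_(x in A) (pos_part (\- f)%R x)%:E.
  rewrite -(integral_support (D := ccube r)) => [|x /D0 xA]; last first.
    by rewrite memNset ?mule0.
  under eq_integral do rewrite -EFinM.
  by rewrite (@integral_mask A)// => x xA; [rewrite mem_set|rewrite memNset].
have -> : \int[lam]_(x in ccube r) ((pos_part (\- g)%R x)%:E * sweep_weight i u v T x) =
    \int[lam]_(x in A) \int[mu]_(t in `[0%R, T]) (pos_part (\- g)%R (x + t *: e))%:E.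
  rewrite -(integral_support (D := ccube r)) => [|x xr]; last first.
    rewrite /sweep_weight integral0_eq ?mule0// => t.
    by rewrite /= in_itv/= => tT; rewrite memNset//; exact: Dt.
  by rewrite integral_sweep_weight//; exact: pos_part_ge0.
rewrite -ge0_integralD//; last 4 first.
- by move=> x _; rewrite lee_fin pos_part_ge0.
- by apply: measurable_funTS; apply/measurable_EFinP; exact: measurable_translate_fun.
- by move=> x _; rewrite lee_fin pos_part_ge0.
- by apply: measurable_funTS; exact/measurable_EFinP.
rewrite -ge0_integralD//.
- by move=> x _; rewrite adde_ge0// lee_fin pos_part_ge0.
- apply: measurable_funTS; apply: emeasurable_funD; apply/measurable_EFinP => //.
  exact: measurable_translate_fun.
- by move=> x _; apply: integral_ge0 => t _; rewrite lee_fin pos_part_ge0.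
- by apply: measurable_funTS; apply: measurable_line_integral => // x; exact: pos_part_ge0.
Qed.

Lemma pos_part_oppK f : pos_part (\- (\- f))%R = pos_part f.
Proof. by apply/funext => x; rewrite /pos_part/= opprK. Qed.

(** The identity of weak_sweep with its negative parts moved across. *)
Lemma balance_obox :
  \int[lam]_(x in A) increment F G x = \int[lam]_(x in A) increment (\- F)%R (\- G)%R x
  /\ \int[lam]_(x in A) increment F G x < +oo.
Proof.
have [iGw wsw] := weak_sweep.
have iFh (h : B -> bool) : measurable_fun setT (fun x => (h x)%:R : R) ->
    lam.-integrable (ccube r) (fun x => (F x)%:E * (h x)%:R%:E).
  move=> mh; apply: (le_integrable mD _ _ (integrable_ccube r iF)).
    apply: measurable_funTS; apply/measurable_EFinP; exact: measurable_funM.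
  by move=> x _; rewrite -EFinM lee_fin normrM; case: (h x); rewrite ?normr1 ?mulr1 ?normr0 ?mulr0.
have mIA : measurable_fun setT (fun x : B => (x \in A)%:R : R).
  have -> : (fun x : B => (x \in A)%:R : R) = \1_A by apply/funext => t; rewrite indicE.
  by apply: measurable_indic; exact: measurable_obox.
have mIB : measurable_fun setT (fun x : B => (x - T *: e \in A)%:R : R)%R.
  by apply: (measurableT_comp mIA); exact: measurable_translation.
have [||pa [ma [Ea Na Fa]]] := @integral_pos_neg (ccube r) F (fun x => (x \in A)%:R%:E) mD.
- by move=> x; rewrite lee_fin.
- exact: iFh.
have [||pb [mb [Eb Nb Fb]]] := @integral_pos_neg (ccube r) F (fun x => (x - T *: e \in A)%:R%:E) mD.
- by move=> x; rewrite lee_fin.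
- exact: iFh.
have [||pg [mg [Eg Ng Fg]]] := @integral_pos_neg (ccube r) G (sweep_weight i u v T) mD.
- by move=> x; apply: integral_ge0 => t _; rewrite lee_fin.
- exact: iGw.
have := wsw; rewrite Fg.
under eq_integral do rewrite mulrBr EFinB 2!EFinM.
rewrite integralB; [|exact: mD|exact: iFh|exact: iFh].
rewrite Fa Fb -EFinB -EFinN => -[bal].
rewrite !integral_increment//; try exact: measurable_opp_fun.
rewrite Eb Na Ng -!EFinD ltry; split => //.
rewrite !pos_part_oppK.
by rewrite Nb Ea Eg -!EFinD; congr EFin; lra.
Qed.

End fixed_box.
End weak_partial.

(** * Increments of functions with a weak gradient *)

Section density.
Context d (T : measurableType d) (R : realType) (mu : {measure set T -> \bar R}).
Variable h : T -> \bar R.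
Hypotheses (mh : measurable_fun setT h) (h0 : forall x, (0 <= h x)%E).
Local Open Scope ereal_scope.

(** The hypotheses are arguments, so that the measure structure is inferred from the term. *)
Definition density of measurable_fun setT h & (forall x, 0 <= h x) : set T -> \bar R :=
  fun A => \int[mu]_(x in A) h x.

Local Notation nu := (density mh h0).

Let density0 : nu set0 = 0.
Proof. exact: integral_set0. Qed.

Let density_ge0 A : 0 <= nu A.
Proof. by apply: integral_ge0. Qed.

Let density_sigma_additive : semi_sigma_additive nu.
Proof.
move=> A mA tA mbA; rewrite /density ge0_integral_bigcup//; last exact: measurable_funTS.
by apply: is_cvg_nneseries => k _ _; exact: integral_ge0.
Qed.

HB.instance Definition _ := isMeasure.Build _ _ _ nu
  density0 density_ge0 density_sigma_additive.

End density.

Section density_unique.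
Context (R : realType) (n : nat).
Local Open Scope ereal_scope.
Local Notation B := (borel_rV R n).
Local Notation lam := (borel_lebesgue R n).

(** The two densities define measures that agree on boxes, hence on all Borel sets. *)
Lemma ae_eq_of_obox (h1 h2 : B -> \bar R) :
  measurable_fun setT h1 -> measurable_fun setT h2 ->
  (forall x, 0 <= h1 x) -> (forall x, 0 <= h2 x) ->
  (forall u v, \int[lam]_(x in obox u v) h1 x = \int[lam]_(x in obox u v) h2 x) ->
  (forall u v, \int[lam]_(x in obox u v) h1 x < +oo) ->
  exists2 N, borel_null N & forall x, ~ N x -> h1 x = h2 x.
Proof.
move=> mh1 mh2 h10 h20 h12 h1oo.
have E A : measurable A -> \int[lam]_(x in A) h1 x = \int[lam]_(x in A) h2 x.
  exact: (measure_unique_obox (m1 := density lam mh1 h10) (m2 := density lam mh2 h20)).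
have ae k : ae_eq lam (centred_obox k%:R : set B) h1 h2.
  apply: integral_ae_eq.
  - exact: measurable_obox.
  - apply/integrableP; split; first exact: measurable_funTS.
    by under eq_integral do rewrite gee0_abs//; exact: h1oo.
  - exact: measurable_funTS.
  - by move=> D _ mD; exact: E.
have [N [mN N0 hN]] := ae_foralln ae.
exists N => // x Nx.
have [k _ kx] : (\bigcup_(k : nat) @centred_obox R n k%:R) x by rewrite centred_obox_cover.
by apply: contrapT => h12x; apply: Nx; apply: hN => /(_ k kx).
Qed.

End density_unique.

Section directional.
Context (R : realType) (n : nat) (i : 'I_n).
Local Open Scope ereal_scope.
Local Notation B := (borel_rV R n).
Local Notation lam := (borel_lebesgue R n).
Local Notation mu := (@lebesgue_measure R).
Local Notation e := (delta_mx ord0 i : 'rV[R]_n).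
Variables (F G : 'rV[R]_n -> R).
Hypotheses (iF : integrable_on_cubes F) (iG : integrable_on_cubes G).
Hypothesis FG : weak_partial i F G.
Let mF : measurable_fun setT (F : B -> R) := iF.1.
Let mG : measurable_fun setT (G : B -> R) := iG.1.

(** Equality of the two increments almost everywhere is F (x + T e) - F x = the integral of G
    along the segment; where that integral is not absolutely convergent the bound is trivial. *)
Lemma directional_increment T : (0 < T)%R -> exists2 N : set B, borel_null N & forall x, ~ N x ->
  `|F (x + T *: e) - F x|%:E <= \int[mu]_(t in `[0%R, T]) `|G (x + t *: e)|%:E.
Proof.
move=> T0.
have bal u v : \int[lam]_(x in obox u v) increment i T F G x =
    \int[lam]_(x in obox u v) increment i T (\- F)%R (\- G)%R x /\
    \int[lam]_(x in obox u v) increment i T F G x < +oo.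
  by have [r box_r] := bounding_radius u v T; exact: (balance_obox T0 box_r).
have [||||N N0 hN] := @ae_eq_of_obox R n (increment i T F G) (increment i T (\- F)%R (\- G)%R)
  _ _ _ _ (fun u v => (bal u v).1) (fun u v => (bal u v).2).
- exact: measurable_increment.
- by apply: measurable_increment; exact: measurable_opp_fun.
- exact: increment_ge0.
- exact: increment_ge0.
exists N => // x /hN; rewrite /increment !pos_part_oppK.
have mGx (H : 'rV[R]_n -> R) : measurable_fun setT (H : B -> R) ->
    measurable_fun (`[0%R, T] : set (measurableTypeR R)) (fun t => (pos_part H (x + t *: e))%:E).
  move=> mH; apply: measurable_funTS; apply/measurable_EFinP.
  have := measurableT_comp (measurable_pos_part mH)
    (measurableT_comp (measurable_translate2 i 1%R) (measurable_pair2 (x : B))).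
  by under eq_fun do rewrite /= mul1r.
have -> : \int[mu]_(t in `[0%R, T]) `|G (x + t *: e)|%:E =
   \int[mu]_(t in `[0%R, T]) (pos_part G (x + t *: e))%:E +
   \int[mu]_(t in `[0%R, T]) (pos_part (\- G)%R (x + t *: e))%:E.
  rewrite -ge0_integralD//.
  - apply: eq_integral => t _; rewrite -EFinD /pos_part/=.
    by case: (leP 0%R (G _)) => g0; congr EFin; [rewrite ger0_norm//|rewrite ltr0_norm//];
      case: leP => ?; lra.
  - by move=> t _; rewrite lee_fin pos_part_ge0.
  - exact: mGx.
  - by move=> t _; rewrite lee_fin pos_part_ge0.
  - by apply: mGx; exact: measurable_opp_fun.
have P0 : 0 <= \int[mu]_(t in `[0%R, T]) (pos_part G (x + t *: e))%:E.
  by apply: integral_ge0 => t _; rewrite lee_fin pos_part_ge0.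
have N0' : 0 <= \int[mu]_(t in `[0%R, T]) (pos_part (\- G)%R (x + t *: e))%:E.
  by apply: integral_ge0 => t _; rewrite lee_fin pos_part_ge0.
move: P0 N0'; case: (integral _ _ _) => [P| |]//; last first.
  by move=> _ q0 _; rewrite addye ?leey// -ltNye (lt_le_trans _ q0).
case: (integral _ _ _) => [Q| |]// P0 Q0.
rewrite -!EFinD => -[]; rewrite lee_fin /pos_part/= ler_norml; move: P0 Q0; rewrite !lee_fin.
case: (leP (F (x + T *: e)%R)); case: (leP (F x)); case: (leP (- F (x + T *: e))%R);
 case: (leP (- F x)%R) => ? ? ? ? ? ? ?; apply/andP; split; lra.
Qed.

End directional.

Section gradient.
Context (R : realType) (n : nat) (q : R) (F : 'rV[R]_n -> R) (G : 'rV[R]_n -> 'rV[R]_n).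
Local Open Scope ereal_scope.
Local Notation B := (borel_rV R n).
Local Notation lam := (borel_lebesgue R n).
Local Notation mu := (@lebesgue_measure R).
Local Notation E := (@euclid_norm R n).
Hypothesis q1 : (1 <= q)%R.
Hypothesis iF : integrable_on_cubes F.
Hypothesis iG : forall i, integrable_on_cubes (fun x => G x ord0 i).
Hypothesis FG : forall i, weak_partial i F (fun x => G x ord0 i).
Let q0 : (0 < q)%R. Proof. exact: lt_le_trans q1. Qed.
Let mF : measurable_fun setT (F : B -> R) := iF.1.
Let mG i : measurable_fun setT ((fun x => G x ord0 i) : B -> R) := (iG i).1.

Local Notation grad_energy Q := (\int[lam]_(x in Q) (E (G x) `^ q)%:E).

Lemma measurable_euclid_grad : measurable_fun setT (fun x : B => E (G x)).
Proof.
have mG' : measurable_fun setT (G : B -> B).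
  by apply: measurable_fun_borel_rV => i; exact: mG.
have := measurable_euclid_dist mG' (@measurable_cst _ _ B B setT (0 : 'rV[R]_n)%R).
by under eq_fun do rewrite subr0.
Qed.

Let menergy : measurable_fun setT (fun x : B => (E (G x) `^ q)%:E).
Proof. by apply/measurable_EFinP; apply: measurable_powR_comp; exact: measurable_euclid_grad. Qed.

Definition stays_in (Q : set 'rV[R]_n) (h : 'rV[R]_n) : set 'rV[R]_n :=
  Q `&` (fun x => x + h)%R @^-1` Q.

Lemma measurable_stays_in Q h : measurable (Q : set B) -> measurable (stays_in Q h : set B).
Proof.
by move=> mQ; apply: measurableI => //; exact: measurable_preimage_translation.
Qed.

Let mdiff h : measurable_fun setT (fun x : B => (`|F (x + h)%R - F x| `^ q)%:E).
Proof.
apply/measurable_EFinP; apply: measurable_powR_comp; apply: measurableT_comp => //.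
by apply: measurable_funB => //; exact: measurable_translate_fun.
Qed.

(** Raise directional_increment to the power q by weak_hoelder on [0, T] and exchange the
    integrals. The segment from x to x + T e_i stays in Q, so each t contributes at most the
    energy of the gradient on Q. *)
Lemma difference_along_axis_pos l Q i T : (0 < T)%R -> (0 < l)%R -> cube l Q ->
  \int[lam]_(x in stays_in Q (T *: delta_mx ord0 i))
     (`|F (x + T *: delta_mx ord0 i) - F x| `^ q)%:E <=
  (2 `^ q * T `^ q)%:E * grad_energy Q.
Proof.
move=> T0 l0 cQ; have mQ := measurable_cube cQ.
set e := delta_mx ord0 i; set D := stays_in _ _.
have mD : measurable (D : set B) by exact: measurable_stays_in.
pose Gi (x : 'rV[R]_n) : R := `|G x ord0 i|%R.
have mGi : measurable_fun setT (Gi : B -> R) by apply: measurableT_comp.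
have mGi2 : measurable_fun setT (fun z : measurableTypeR R * B => Gi (z.2 + z.1 *: e)%R).
  have := measurableT_comp mGi (measurable_translate2 i 1%R).
  by under eq_fun do rewrite /= mul1r.
have mGq2 : measurable_fun setT (fun z : measurableTypeR R * B => (Gi (z.2 + z.1 *: e)%R `^ q)%:E).
  by apply/measurable_EFinP; exact: measurable_powR_comp.
have mline : measurable_fun setT (fun x : B =>
    \int[mu]_(t in `[0%R, T]) (Gi (x + t *: e)%R `^ q)%:E).
  have mGq : measurable_fun setT (fun x : B => Gi x `^ q)%R by exact: measurable_powR_comp.
  exact: (@measurable_line_integral R n i T (fun x => Gi x `^ q)%R mGq (fun x => powR_ge0 _ _)).
have lT : mu `[0%R, T]%classic = T%:E.
  by rewrite lebesgue_measure_itv/= lte_fin T0 oppr0 adde0.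
have c0 : (0 <= 2 `^ q * T `^ (q - 1))%R by rewrite mulr_ge0 ?powR_ge0.
have [N [mN N0] hN] := directional_increment iF (iG i) (@FG i) T0.
apply: (@le_trans _ _ (\int[lam]_(x in D) ((2 `^ q * T `^ (q - 1))%:E *
    \int[mu]_(t in `[0%R, T]) (Gi (x + t *: e)%R `^ q)%:E))).
  apply: ae_ge0_le_integral => //.
  - by apply: measurable_funTS; exact: mdiff.
  - move=> x _; apply: mule_ge0; first by rewrite lee_fin.
    by apply: integral_ge0 => t _; rewrite lee_fin powR_ge0.
  - by apply: measurable_funTS; exact: measurable_funeM.
  exists N; split => // x /= Dx; apply: contrapT => Nx; apply: Dx => _.
  have mGx : measurable_fun (`[0%R, T] : set (measurableTypeR R)) (fun t => Gi (x + t *: e)%R).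
    by apply: measurable_funTS; exact: (measurableT_comp mGi2 (measurable_pair2 (x : B))).
  have wh := @weak_hoelder _ _ R mu _ T q _ (measurable_itv _) lT T0 q1 mGx (fun _ _ => normr_ge0 _).
  apply: le_trans wh.
  rewrite -poweR_EFin; apply: gt0_ler_poweR => //; rewrite ?in_itv/= ?leey ?andbT ?lee_fin ?(ltW q0)//.
    by apply: integral_ge0 => t _; rewrite lee_fin; exact: normr_ge0.
  exact: hN.
rewrite ge0_integralZl_EFin//; last 2 first.
- by move=> x _; apply: integral_ge0 => t _; rewrite lee_fin powR_ge0.
- exact: measurable_funTS.
have -> : (2 `^ q * T `^ q = (2 `^ q * T `^ (q - 1)) * T)%R.
  by rewrite -(mulr_powRB1 (ltW T0) q0); ring.
have : (0 < 2 `^ q * T `^ (q - 1))%R by rewrite mulr_gt0 ?powR_gt0.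
move: (2 `^ q * T `^ (q - 1))%R => w w0; rewrite EFinM -muleA lee_pmul2l ?lte_fin//.
rewrite -(@tonelli_subset _ _ _ _ R mu lam (fun t x => (Gi (x + t *: e)%R `^ q)%:E))//; last by move=> t x; rewrite lee_fin powR_ge0.
apply: (@le_trans _ _ (\int[mu]_(t in `[0%R, T]) grad_energy Q)).
  apply: ge0_le_integral => //.
  - by move=> t _; apply: integral_ge0 => x _; rewrite lee_fin powR_ge0.
  - apply: measurable_funTS; apply: measurable_integral_subset => //.
    by move=> t x; rewrite lee_fin powR_ge0.
  - move=> t; rewrite /= in_itv/= => /andP[t0 tT].
    have mt := measurable_preimage_translation (t *: e) mQ.
    have mGt : measurable_fun setT (fun x : B => (Gi (x + t *: e)%R `^ q)%:E).
      exact: (measurableT_comp mGq2 (measurable_pair1 t)).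
    have mGq : measurable_fun setT (fun x : B => (Gi x `^ q)%:E).
      by apply/measurable_EFinP; exact: measurable_powR_comp.
    apply: (@le_trans _ _ (\int[lam]_(x in (fun x => x + t *: e)%R @^-1` Q) (Gi (x + t *: e)%R `^ q)%:E)).
      apply: ge0_subset_integral => //.
      - exact: measurable_funTS.
      - by move=> x _; rewrite lee_fin powR_ge0.
      - move=> x [Qx QxT]; apply: (cube_between cQ Qx QxT) => j; rewrite !mxE eqxx/=.
        case: (j == i) => /=; rewrite ?mulr1 ?mulr0 ?addr0 ?minxx ?maxxx ?lexx//.
        by rewrite min_l ?max_r ?lerDl ?lerD2l ?t0 ?(ltW T0).
    rewrite (@ge0_integral_translate R n (t *: e) Q (fun x => (Gi x `^ q)%:E))//.
    - apply: ge0_le_integral => //.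
      + by move=> x _; rewrite lee_fin powR_ge0.
      + exact: measurable_funTS.
      + exact: measurable_funTS.
      + move=> x _; rewrite lee_fin ge0_ler_powR ?nnegrE ?(ltW q0) ?normr_ge0 ?euclid_norm_ge0//.
        exact: ler_coord_euclid.
    - exact: measurable_funTS.
    - by move=> x _; rewrite lee_fin powR_ge0.
by rewrite integral_cst// [X in _ * X]lT muleC.
Qed.

(** For T < 0 exchange the roles of x and x + T e_i by a translation. *)
Lemma difference_along_axis l Q i T : (0 < l)%R -> cube l Q ->
  \int[lam]_(x in stays_in Q (T *: delta_mx ord0 i))
     (`|F (x + T *: delta_mx ord0 i) - F x| `^ q)%:E <=
  (2 `^ q * `|T| `^ q)%:E * grad_energy Q.
Proof.
move=> l0 cQ; have mQ := measurable_cube cQ.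
set e := delta_mx ord0 i; have [T0|T0|->] := ltgtP T 0%R.
- have NT0 : (0 < - T)%R by rewrite oppr_gt0.
  rewrite ltr0_norm//; have step := difference_along_axis_pos i NT0 l0 cQ; apply: le_trans step.
  rewrite -/e.
  have mD : measurable (stays_in Q (- T *: e) : set B) by exact: measurable_stays_in.
  rewrite -(@ge0_integral_translate R n (T *: e) (stays_in Q (- T *: e))
    (fun x => (`|F (x + - T *: e) - F x| `^ q)%:E) mD); last 2 first.
  + by apply: measurable_funTS; exact: mdiff.
  + by move=> x _; rewrite lee_fin powR_ge0.
  rewrite le_eqVlt; apply/orP; left; apply/eqP.
  have -> : (fun x => x + T *: e)%R @^-1` stays_in Q (- T *: e) = stays_in Q (T *: e).
    by apply/seteqP; split => x; rewrite /stays_in /= scaleNr addrK => -[].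
  by apply: eq_integral => x _; rewrite scaleNr addrK distrC.
- by rewrite gtr0_norm//; exact: (difference_along_axis_pos i T0 l0 cQ).
- rewrite integral0_eq => [|x _].
    by apply: mule_ge0; [rewrite lee_fin mulr_ge0 ?powR_ge0|apply: integral_ge0 => x _; rewrite lee_fin powR_ge0].
  by rewrite scale0r addr0 subrr normr0 powR0// gt_eqF.
Qed.

Definition prefix (h : 'rV[R]_n) (k : nat) : 'rV[R]_n :=
  (\row_j if (j < k)%N then h ord0 j else 0)%R.

Lemma prefix0 h : prefix h 0 = 0%R.
Proof. by apply/rowP => j; rewrite !mxE. Qed.

Lemma prefixn h : prefix h n = h.
Proof. by apply/rowP => j; rewrite !mxE ltn_ord. Qed.

Lemma prefixS h (i : 'I_n) : prefix h i.+1 = (prefix h i + h ord0 i *: delta_mx ord0 i)%R.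
Proof.
apply/rowP => j; rewrite !mxE eqxx/= ltnS; have [->|ji] := eqVneq j i.
  by rewrite leqnn ltnn add0r mulr1.
by rewrite mulr0 addr0 leq_eqVlt (negbTE (ji : (j : nat) != i)).
Qed.

Lemma prefix_in_cube l Q (x h : 'rV[R]_n) k : cube l Q -> Q x -> Q (x + h)%R ->
  Q (x + prefix h k)%R.
Proof.
move=> cQ Qx Qxh; apply: (cube_between cQ Qx Qxh) => j; rewrite !mxE.
by case: ifP => _; rewrite ?addr0 ge_min le_max lexx ?orbT.
Qed.

Definition staircase_const (k : nat) : R := iter k (fun c => 2 `^ (q - 1) * (2 `^ q + c))%R 0%R.

Lemma staircase_const_ge0 k : (0 <= staircase_const k)%R.
Proof. by elim: k => //= k IH; rewrite mulr_ge0 ?addr_ge0 ?powR_ge0. Qed.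

(** Join x to x + h by moving the coordinates one at a time. The corners of this path remain in
    the cube, so each step is a difference along an axis of a translate. *)
Lemma staircase l Q h (k : nat) : (0 < l)%R -> cube l Q -> (k <= n)%N ->
  \int[lam]_(x in stays_in Q h) (`|F (x + prefix h k) - F x| `^ q)%:E <=
  (staircase_const k * E h `^ q)%:E * grad_energy Q.
Proof.
move=> l0 cQ; have mQ := measurable_cube cQ.
have mD : measurable (stays_in Q h : set B) by exact: measurable_stays_in.
have G0 : 0 <= grad_energy Q by apply: integral_ge0 => x _; rewrite lee_fin powR_ge0.
elim: k => [_|k IH kn].
  rewrite integral0_eq => [|x _]; first by rewrite mul0r mul0e.
  by rewrite prefix0 addr0 subrr normr0 powR0// gt_eqF.
pose i := Ordinal kn; pose hi := h ord0 i; pose e : 'rV[R]_n := delta_mx ord0 i.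
have step : \int[lam]_(x in stays_in Q h)
    (`|F (x + prefix h k + hi *: e) - F (x + prefix h k)| `^ q)%:E <=
    (2 `^ q * E h `^ q)%:E * grad_energy Q.
  apply: (@le_trans _ _ ((2 `^ q * `|hi| `^ q)%:E * grad_energy Q)); last first.
    apply: lee_wpmul2r => //; rewrite lee_fin ler_wpM2l ?powR_ge0//.
    by rewrite ge0_ler_powR ?nnegrE ?(ltW q0) ?euclid_norm_ge0//; exact: ler_coord_euclid.
  have bound := difference_along_axis i hi l0 cQ; apply: le_trans bound.
  have mD2 : measurable (stays_in Q (hi *: e) : set B) by exact: measurable_stays_in.
  rewrite -(@ge0_integral_translate R n (prefix h k) (stays_in Q (hi *: e))
    (fun x => (`|F (x + hi *: e) - F x| `^ q)%:E) mD2); last 2 first.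
  - by apply: measurable_funTS; exact: mdiff.
  - by move=> x _; rewrite lee_fin powR_ge0.
  apply: ge0_subset_integral => //.
  - exact: measurable_preimage_translation.
  - by apply: measurable_funTS; exact: measurable_translate_fun (mdiff _).
  - move=> x [Qx Qxh]; split => /=; first exact: (prefix_in_cube k cQ Qx Qxh).
    by rewrite -addrA -(prefixS h i); exact: (prefix_in_cube k.+1 cQ Qx Qxh).
have mprefix : measurable_fun setT (fun x : B =>
    (`|F (x + prefix h k + hi *: e)%R - F (x + prefix h k)%R| `^ q)%:E).
  exact: measurable_translate_fun (mdiff _).
apply: (@le_trans _ _ (\int[lam]_(x in stays_in Q h) ((2 `^ (q - 1))%:E *
   ((`|F (x + prefix h k + hi *: e)%R - F (x + prefix h k)%R| `^ q)%:E +
    (`|F (x + prefix h k)%R - F x| `^ q)%:E)))).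
  apply: ge0_le_integral => //.
  - by apply: measurable_funTS; exact: mdiff.
  - by apply: measurable_funTS; apply: measurable_funeM; apply: emeasurable_funD.
  - move=> x _; rewrite -EFinD -EFinM lee_fin.
    have -> : (prefix h k.+1 = prefix h k + hi *: e)%R by exact: (prefixS h i).
    rewrite addrA.
    by have := osc_triangle F q1 (x + prefix h k + hi *: e)%R x (x + prefix h k)%R.
rewrite ge0_integralZl_EFin ?powR_ge0//; last 2 first.
- by move=> x _; rewrite adde_ge0 ?lee_fin ?powR_ge0.
- by apply: measurable_funTS; apply: emeasurable_funD.
rewrite ge0_integralD//; try (by move=> x _; rewrite lee_fin powR_ge0); try exact: measurable_funTS.
rewrite /= -mulrA EFinM -muleA lee_pmul2l ?lte_fin ?powR_gt0//.
rewrite mulrDl EFinD ge0_muleDl ?lee_fin ?mulr_ge0 ?powR_ge0 ?staircase_const_ge0//.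
by apply: leeD => //; apply: IH; exact: ltnW.
Qed.

Lemma translation_difference l Q h : (0 < l)%R -> cube l Q ->
  \int[lam]_(x in stays_in Q h) (`|F (x + h) - F x| `^ q)%:E <=
  (staircase_const n * E h `^ q)%:E * grad_energy Q.
Proof. by move=> l0 cQ; have := @staircase l Q h n l0 cQ (leqnn n); rewrite prefixn. Qed.

(** With y = x + h, the integral in x is at most a constant times |h|^q times the energy of the
    gradient, which leaves the kernel |h|^(q - n - alpha q) to be integrated over |h| = O(l);
    this is kernel_bound with b = q (1 - alpha) > 0. *)
Lemma diffq_le_gradient (alpha : R) : (1 <= n)%N -> (alpha < 1)%R ->
  exists2 C : R, (0 < C)%R & forall l Q, (0 < l)%R -> cube l Q ->
  iint (diffq q F (n%:R + alpha * q)) Q Q <=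
    (C * l `^ (q * (1 - alpha)))%:E * grad_energy Q.
Proof.
move=> n_ge1 a1; pose b := (q * (1 - alpha))%R.
have b0 : (0 < b)%R by rewrite mulr_gt0// subr_gt0.
have [C C0 HC] := @kernel_bound R n b b0.
pose sqn : R := Num.sqrt n%:R; pose c := (staircase_const n + 1)%R.
have c0 : (0 < c)%R by rewrite ltr_wpDl// staircase_const_ge0.
have sq0 : (0 < sqn)%R by rewrite sqrtr_gt0 ltr0n.
exists (c * C * (2 * sqn) `^ b)%R; first by rewrite !mulr_gt0 ?powR_gt0// mulr_gt0.
move=> l Q l0 cQ; have mQ := measurable_cube cQ.
pose s := (n%:R + alpha * q)%R; pose k := diffq q F s.
have kk : nonneg_kernel k by exact: nonneg_kernel_diffq.
have G0 : 0 <= grad_energy Q by apply: integral_ge0 => x _; rewrite lee_fin powR_ge0.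
pose k' (x h : B) := k x (h + x)%R * (\1_Q (h + x)%R)%:E.
have madd : measurable_fun setT (fun z : B * B => (z.2 : 'rV[R]_n) + z.1 : B)%R.
  apply: measurable_fun_borel_rV => i.
  rewrite [X in measurable_fun _ X](_ : _ =
    (fun z => borel_rV_coord i z.2 + borel_rV_coord i z.1)%R); last first.
    by apply/funext => z; rewrite /= /borel_rV_coord !mxE.
  by apply: measurable_funD; apply: measurableT_comp => //; exact: measurable_borel_rV_coord.
have kk' : nonneg_kernel k'.
  split; last by move=> x h; rewrite mule_ge0 ?kk.2// lee_fin indicE.
  apply: emeasurable_funM.
    have := measurableT_comp kk.1 (measurable_fun_pair measurable_fst madd); exact.
  apply/measurable_EFinP; apply: (measurableT_comp _ madd); exact: measurable_indic.
have -> : iint k Q Q = iint k' Q setT.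
  apply: eq_integral => x _.
  have := @ge0_integral_translate R n x Q (k x) mQ (measurable_funTS (nonneg_kernel1 _ kk)) (fun y _ => kk.2 x y).
  move=> <-; rewrite [LHS]integral_mkcond; apply: eq_integral => h _.
  rewrite patchE /k' indicE; case: ifPn => hx.
    by move: hx; rewrite inE /= => hx; rewrite mem_set// mule1.
  by move: hx; rewrite notin_setE /= => hx; rewrite memNset// mule0.
rewrite (iintC kk' mQ measurableT).
(* The ball of kernel_bound is open, so its radius must exceed the diameter of Q. *)
pose rho := (2 * sqn * l)%R.
have rho0 : (0 < rho)%R by rewrite !mulr_gt0.
have inner h : \int[lam]_(x in Q) k' x h =
    (E h `^ (- s))%:E * \int[lam]_(x in stays_in Q h) (`|F (x + h) - F x| `^ q)%:E.
  have mD : measurable (stays_in Q h : set B) by exact: measurable_stays_in.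
  rewrite -ge0_integralZl_EFin ?powR_ge0//; last by apply: measurable_funTS; exact: mdiff.
  rewrite [LHS]integral_mkcond [RHS]integral_mkcond; apply: eq_integral => x _.
  have kE : k x (h + x)%R = (E h `^ (- s))%:E * (`|F (x + h) - F x| `^ q)%:E.
    by rewrite /k /diffq /osc opprD addrCA subrr addr0 euclid_normN distrC (addrC h) -EFinM mulrC.
  rewrite !patchE /k' in_setI; case: ifPn => //= xQ.
  rewrite kE indicE (addrC h).
  case: ifPn => hx.
    by move: hx; rewrite inE /= => hx; rewrite mem_set// mule1.
  by move: hx; rewrite notin_setE /= => hx; rewrite memNset// mule0.
have mball := @measurable_euclid_ball R n 0%R rho.
have mker : measurable_fun setT (fun h : B => (E (0 - h) `^ (b - n%:R))%:E).
  apply/measurable_EFinP; apply: measurable_powR_comp.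
  exact: measurable_euclid_dist (@measurable_cst _ _ B B setT (0 : 'rV[R]_n)%R) (@measurable_id _ B setT).
apply: (@le_trans _ _ (\int[lam]_(h in [set h | E (0 - h) < rho]%R)
   ((c * E (0 - h)%R `^ (b - n%:R))%:E * grad_energy Q))).
  rewrite /iint (@integral_support _ _ [set h | E (0 - h) < rho]%R); last first.
    move=> h /negP hrho; rewrite inner integral0_eq ?mule0// => x [Qx Qxh]; exfalso.
    move: hrho; rewrite -leNgt sub0r euclid_normN leNgt => /negP; apply.
    have := cube_dist (ltW l0) cQ Qxh Qx; rewrite addrAC subrr add0r => /le_lt_trans; apply.
    by rewrite /rho -mulrA ltr_pMl ?mulr_gt0// ltr1n.
  apply: ge0_le_integral => //.
  - by move=> h _; exact: inner_ge0 (nonneg_kernelC kk').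
  - by apply: measurable_funTS; exact: measurable_inner (nonneg_kernelC kk') mQ.
  - apply: measurable_funTS; apply: emeasurable_funM; last exact: measurable_cst.
    by under eq_fun do rewrite EFinM; exact: measurable_funeM.
  - move=> h _; rewrite inner sub0r euclid_normN.
    have [->|h0] := eqVneq h 0%R.
      rewrite integral0_eq => [|x _]; last by rewrite addr0 subrr normr0 powR0// gt_eqF.
      by rewrite mule0 mule_ge0// lee_fin mulr_ge0 ?powR_ge0// ltW.
    have Eh0 : (0 < E h)%R by rewrite euclid_norm_gt0.
    have bound := translation_difference h l0 cQ.
    have := lee_wpmul2l _ bound => /(_ (E h `^ (- s))%:E) H; apply: (le_trans (H _)).
      by rewrite lee_fin powR_ge0.
    have Es : (E h `^ (- s) * E h `^ q = E h `^ (b - n%:R))%R.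
      by rewrite -powRD ?(gt_eqF Eh0) ?implybT//; congr powR; rewrite /s /b; ring.
    rewrite muleA -EFinM lee_wpmul2r// lee_fin mulrCA Es.
    by rewrite ler_wpM2r ?powR_ge0// /c lerDl.
rewrite ge0_integralZr//; last 2 first.
- by apply: measurable_funTS; under eq_fun do rewrite EFinM; exact: measurable_funeM.
- by move=> h _; rewrite lee_fin mulr_ge0 ?powR_ge0// ltW.
apply: lee_wpmul2r => //; under eq_integral do rewrite EFinM.
rewrite ge0_integralZl_EFin ?(ltW c0)//; last 2 first.
- by move=> h _; rewrite lee_fin powR_ge0.
- exact: measurable_funTS.
have Hb := HC rho 0%R rho0.
have := lee_wpmul2l _ Hb => /(_ c%:E) H; apply: (le_trans (H _)).
  by rewrite lee_fin ltW.
rewrite -EFinM lee_fin /rho powRM ?mulr_ge0 ?(ltW sq0) ?(ltW l0)// !mulrA.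
exact: lexx.
Qed.

End gradient.

(** * Sums over families of cubes *)

Section poweR.
Context (R : realType).
Local Open Scope ereal_scope.
Implicit Types (x y : \bar R) (r : R).

Lemma le_poweR x y r : (0 <= r)%R -> 0 <= x -> x <= y -> x `^ r <= y `^ r.
Proof.
move=> r0 x0 xy; apply: gt0_ler_poweR => //; rewrite in_itv/= leey andbT//.
exact: le_trans xy.
Qed.

Lemma poweR_lty_inv x r : (0 < r)%R -> x `^ r < +oo -> x < +oo.
Proof.
by case: x => [x| |] r0; rewrite ?ltry ?ltNyr//= gt_eqF// ltxx.
Qed.

Lemma lty_poweR x r : (0 < r)%R -> x < +oo -> x `^ r < +oo.
Proof. by case: x => [x| |] r0 //= _; [exact: ltry|rewrite gt_eqF// ltry]. Qed.

(** x^r + y^r = x * x^(r-1) + y * y^(r-1), and both factors of exponent r - 1 >= 0 are at most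
    (x + y)^(r-1). *)
Lemma poweR_superadd x y r : (1 <= r)%R -> 0 <= x -> 0 <= y -> x `^ r + y `^ r <= (x + y) `^ r.
Proof.
move=> r1; have r0 : (0 < r)%R by exact: lt_le_trans r1.
case: x => [x| |]//; case: y => [y| |]// x0 y0; rewrite /= ?(gt_eqF r0) ?leey//.
rewrite -EFinD lee_fin; rewrite !lee_fin in x0 y0.
have r10 : (0 <= r - 1)%R by rewrite subr_ge0.
rewrite -(mulr_powRB1 x0 r0) -(mulr_powRB1 y0 r0) -(mulr_powRB1 (addr_ge0 x0 y0) r0).
have mono a : (0 <= a -> a <= x + y -> a `^ (r - 1) <= (x + y) `^ (r - 1))%R.
  by move=> a0 axy; apply: (ge0_ler_powR r10) => //; rewrite nnegrE ?addr_ge0.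
by rewrite mulrDl lerD// ler_wpM2l// mono// ?lerDl ?lerDr.
Qed.

Lemma sum_poweR_le (I : Type) (s : seq I) (a : I -> \bar R) r : (1 <= r)%R ->
  (forall i, 0 <= a i) -> \sum_(i <- s) a i `^ r <= (\sum_(i <- s) a i) `^ r.
Proof.
move=> r1 a0; elim: s => [|i s IH]; first by rewrite !big_nil poweR_ge0.
rewrite !big_cons; apply: (le_trans (leeD2l _ IH)).
by apply: poweR_superadd => //; exact: sume_ge0.
Qed.

End poweR.

Section cube_sums.
Context (R : realType) (n : nat).
Local Open Scope ereal_scope.
Local Notation B := (borel_rV R n).
Local Notation lam := (borel_lebesgue R n).
Local Notation vol := (lebesgue_rV R n).
Implicit Types (s : seq (set 'rV[R]_n)) (F : set 'rV[R]_n -> \bar R).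

(** A sum over a family is the supremum of its finite subsums, and subfamilies of an admissible
    family are admissible. *)
Lemma sup_over_cubes_lty p F : (0 < p)%R -> (forall Q, 0 <= F Q) ->
  sup_over_cubes p F < +oo <-> exists M : R, forall l s, (0 < l)%R -> uniq s ->
    cube_collection l [set` s] -> \sum_(Q <- s) vol Q * F Q <= M%:E.
Proof.
move=> p0 F0; have vF0 Q : 0 <= vol Q * F Q by rewrite mule_ge0.
have pi0 : (0 < p^-1)%R by rewrite invr_gt0.
split => [Foo|[M HM]].
  pose S := sup_over_cubes p F.
  have S0 : 0 <= S.
    apply: (@le_trans _ _ ((\esum_(Q in set0) (vol Q * F Q)) `^ p^-1)); first exact: poweR_ge0.
    apply: ereal_sup_ubound; exists 1%R, set0; split => //.
    by split; [exact: sub0set|by move=> ? ?].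
  have Sf : S \is a fin_num by rewrite ge0_fin_numE.
  exists (fine (S `^ p)) => l s l0 us cs.
  rewrite fineK; last by rewrite ge0_fin_numE ?poweR_ge0// lty_poweR.
  have h : (\sum_(Q <- s) vol Q * F Q) `^ p^-1 <= S.
    apply: ereal_sup_ubound; exists l, [set` s]; split => //.
    rewrite esum_fset//; last exact: finite_seq.
    by rewrite -fsbig_seq.
  have s0 : 0 <= \sum_(Q <- s) vol Q * F Q by exact: sume_ge0.
  have := le_poweR (ltW p0) (poweR_ge0 _ _) h.
  by rewrite -poweRrM mulVf ?gt_eqF// poweRe1.
apply: (@le_lt_trans _ _ (M%:E `^ p^-1)); last by rewrite lty_poweR// ltry.
apply: ub_ereal_sup => _ [l [C [l0 cC ->]]].
apply: le_poweR; [exact: ltW|by apply: esum_ge0|].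
apply: ub_ereal_sup => _ [A [fA AC] <-].
rewrite fsbig_finite//=; apply: (HM l _ l0); first exact: finmap.fset_uniq.
rewrite (fset_setK fA); split; first exact: subset_trans AC cC.1.
exact: sub_trivIset AC cC.2.
Qed.

Lemma cube_collection1 l Q : cube l Q -> cube_collection l [set` [:: Q : set 'rV[R]_n]].
Proof.
move=> cQ; split => [X|X Y]; rewrite /= mem_seq1; first by move=> /eqP ->.
by rewrite mem_seq1 => /eqP -> /eqP ->.
Qed.

(** Replace the cubes by their interiors, which are disjoint and have the same measure. *)
Lemma sum_integral_cubes l s (h : B -> \bar R) : (0 < l)%R -> uniq s ->
  cube_collection l [set` s] -> measurable_fun setT h -> (forall x, 0 <= h x) ->
  \sum_(Q <- s) \int[lam]_(x in Q) h x <= \int[lam]_x h x.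
Proof.
move=> l0 us [cs tI] mh h0.
have ex Q : exists U : set B, measurable U /\ (cube l Q -> U `<=` interior Q /\ lam U = (l ^+ n)%:E).
  have [cQ|ncQ] := pselect (cube l Q); last by exists set0; split => //.
  by have [U [mU UQ lU]] := cube_interior l0 cQ; exists U.
have [U HU] := choice ex.
have mU Q : measurable (U Q) by exact: (HU Q).1.
have intU Q : Q \in s -> \int[lam]_(x in Q) h x = \int[lam]_(x in U Q) h x.
  move=> Qs; have cQ : cube l Q by exact: cs.
  have [UQ lU] := (HU Q).2 cQ; have mQ := measurable_cube cQ.
  have UQ' : U Q `<=` Q by exact: subset_trans UQ (@interior_subset _ _).
  have mQU : measurable (Q `\` U Q : set B) by exact: measurableD.
  have Q0 : lam (Q `\` U Q) = 0.
    rewrite measureD//; last by rewrite [X in X < _](lebesgue_cube l0 cQ) ltry.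
    by rewrite (setIidr UQ') [X in _ - X]lU [X in X - _](lebesgue_cube l0 cQ) -EFinB subrr.
  rewrite -[X in \int[_]_(x in X) _](setDUK UQ') ge0_integral_setU//.
  - by rewrite [X in _ + X]null_set_integral ?adde0//; exact: measurable_funTS.
  - exact: measurable_funTS.
  - by apply/disj_setPS => x [Ux []].
rewrite (eq_big_seq _ intU) -ge0_integral_bigsetU//.
- apply: ge0_subset_integral => //.
  by apply: bigsetU_measurable.
- move=> Q1 Q2 Q1s Q2s [x [x1 x2]]; apply: tI => //; exists x; split.
    by apply: ((HU Q1).2 _).1 => //; exact: cs.
  by apply: ((HU Q2).2 _).1 => //; exact: cs.
- by apply: measurable_funTS.
Qed.

End cube_sums.

Section monotonicity.
Context d (T : measurableType d) (R : realType) (mu : {measure set T -> \bar R}).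
Local Open Scope ereal_scope.

(** From the definition of the integral as a supremum over simple functions, so that A may fail
    to be measurable. Compact sets are only known to lie in cubes. *)
Lemma ge0_integral_mono (A D : set T) (f : T -> \bar R) : A `<=` D -> (forall x, 0 <= f x) ->
  \int[mu]_(x in A) f x <= \int[mu]_(x in D) f x.
Proof.
move=> AD f0; rewrite integral_mkcond [leRHS]integral_mkcond.
rewrite !ge0_integralTE; try by move=> x; exact: erestrict_ge0.
apply: ub_ereal_sup => _ [h hA <-]; apply: ereal_sup_ubound; exists h => // x.
apply: (le_trans (hA x)); rewrite !patchE; case: ifPn => [/set_mem/AD/mem_set ->//|_].
by case: ifP.
Qed.

End monotonicity.

Section bounded_sets.
Context (R : realType) (n : nat).

Lemma cube_sub_ccube (l : R) (Q : set 'rV[R]_n) : cube l Q -> exists2 r, 0 < r & Q `<=` ccube r.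
Proof.
move=> [a [b [c ->]]]; have [k ak] := row_bounded a.
exists (k%:R + `|l| + 1); first by rewrite ltr_wpDl// addr_ge0.
move=> x xQ i; have := xQ i; rewrite itv_boundlr => /andP[ax xa].
have {}ax : a ord0 i <= x ord0 i by move: ax; case: (b i); rewrite bnd_simp// => /ltW.
have {}xa : x ord0 i <= a ord0 i + l by move: xa; case: (c i); rewrite bnd_simp// => /ltW.
move: (ak i) (ler_norm l); rewrite ltr_norml => /andP[? ?] ?; apply/andP; split; lra.
Qed.

Lemma compact_sub_ccube (K : set 'rV[R]_n) : compact K -> exists2 r, 0 < r & K `<=` ccube r.
Proof.
move=> cK; have [M [_ HM]] := compact_bounded cK.
exists (`|M| + 1); first by rewrite ltr_wpDl.
move=> x Kx i; have := HM (`|M| + 1); rewrite (le_lt_trans (ler_norm M)) ?ltrDl// => /(_ isT x Kx).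
rewrite -ler_norml; apply: le_trans.
rewrite [leRHS](_ : _ = mx_norm x)// mx_normrE.
exact: (le_bigmax _ (fun ij => `|x ij.1 ij.2|) (ord0, i)).
Qed.

End bounded_sets.

Section L1loc_representative.
Context (R : realType) (n : nat).
Local Notation B := (borel_rV R n).

Lemma integrable_on_cubes_of_L1loc (f : 'rV[R]_n -> \bar R) (F : 'rV[R]_n -> R) N :
  measurable_fun setT (F : B -> R) -> borel_null N ->
  (forall x, ~ N x -> f x = (F x)%:E) -> L1loc f -> integrable_on_cubes F.
Proof.
move=> mF N0 fF [_ Hf]; split => // r.
have cr := @compact_ccube R n r; have mr := measurable_cube (cube_ccube n r).
rewrite -(integral_vol (f := fun x => `|f x|%E) mr N0); first exact: Hf.
- by apply: measurable_funTS; apply/measurable_EFinP; exact: measurableT_comp.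
- by move=> x _ Nx; rewrite fF.
Qed.

Lemma borel_null_bigsetU (A : 'I_n -> set 'rV[R]_n) : (forall i, borel_null (A i)) ->
  borel_null (\big[setU/set0]_(i < n) A i).
Proof.
move=> A0; apply: (big_ind (@borel_null R n)) => //; last exact: borel_nullU.
Qed.

End L1loc_representative.

(** * The norms in terms of a Borel representative *)

Section representative.
Context (R : realType) (n : nat) (p q : R) (f : 'rV[R]_n -> \bar R) (F : 'rV[R]_n -> R)
  (N : set 'rV[R]_n).
Local Open Scope ereal_scope.
Local Notation B := (borel_rV R n).
Local Notation lam := (borel_lebesgue R n).
Local Notation vol := (lebesgue_rV R n).
Local Notation E := (@euclid_norm R n).
Hypothesis n_ge1 : (1 <= n)%N.
Hypotheses (p1 : (1 <= p)%R) (q1 : (1 <= q)%R).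
Hypotheses (mF : measurable_fun setT (F : B -> R)) (N0 : borel_null N).
Hypothesis fF : forall x, ~ N x -> f x = (F x)%:E.
Implicit Types (alpha l : R) (Q : set 'rV[R]_n).

Let p0 : (0 < p)%R. Proof. exact: lt_le_trans p1. Qed.
Let q0 : (0 < q)%R. Proof. exact: lt_le_trans q1. Qed.
Let pq0 : (0 < p / q)%R. Proof. by rewrite divr_gt0. Qed.
Let n0 : (0 < n%:R :> R)%R. Proof. by rewrite ltr0n. Qed.
Let kd s : nonneg_kernel (diffq q F s).
Proof. exact: nonneg_kernel_diffq. Qed.
Let ko : nonneg_kernel (oscE q F).
Proof. exact: nonneg_kernel_osc. Qed.

Lemma gagliardo_iint alpha (A : set B) : measurable A ->
  gagliardo alpha q f A = iint (diffq q F (n%:R + alpha * q)) A A.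
Proof.
move=> mA; set s := (n%:R + alpha * q)%R.
rewrite /gagliardo /iint; apply: (integral_vol mA N0).
  by apply: measurable_funTS; exact: measurable_inner.
move=> x Ax Nx; apply: (integral_vol mA N0).
  by apply: measurable_funTS; exact: nonneg_kernel1.
move=> y Ay Ny; rewrite !fF// -EFinB /= -/s /diffq /osc.
(* A vanishing denominator means x = y, where the numerator vanishes too. *)
have [E0|E0] := eqVneq (E (x - y) `^ s)%R 0%R.
  have xy : x = y.
    by move/powR_eq0_eq0/eqP: E0; rewrite euclid_norm_eq0 subr_eq0 => /eqP.
  by rewrite xy subrr normr0 powR0 ?gt_eqF// mul0e mul0r.
by rewrite inver (negbTE E0) -EFinM powRN.
Qed.

Local Notation energy alpha Q := (iint (diffq q F (n%:R + alpha * q)) Q Q).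

Lemma energy_ge0 alpha Q : 0 <= energy alpha Q.
Proof. exact: iint_ge0. Qed.

(** The exponent alpha0, for which l^(p (alpha - alpha0)) is the weight of a cube of edge l. *)
Definition smoothness_gap : R := (n%:R * (q^-1 - p^-1))%R.
Local Notation alpha0 := smoothness_gap.

Lemma vol_cube l Q : (0 < l)%R -> cube l Q -> vol Q = (l ^+ n)%:E.
Proof.
move=> l0 cQ; rewrite -(lebesgue_cube l0 cQ); apply: vol_borel; exact: measurable_cube cQ.
Qed.

Lemma JNQ_term alpha l Q : (0 < l)%R -> cube l Q ->
  vol Q * (vol Q `^ (q * alpha / n%:R - 1) * gagliardo alpha q f Q) `^ (p / q) =
  (l `^ (p * (alpha - alpha0)))%:E * energy alpha Q `^ (p / q).
Proof.
move=> l0 cQ; rewrite gagliardo_iint; last exact: measurable_cube cQ.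
rewrite (vol_cube l0 cQ) poweR_EFin poweRM ?energy_ge0//; last by rewrite lee_fin powR_ge0.
rewrite muleA poweR_EFin -EFinM; congr (_%:E * _).
rewrite -powR_mulrn ?(ltW l0)// -!powRrM -powRD; last by rewrite (gt_eqF l0) implybT.
congr powR; rewrite /alpha0; move: n0 q0 p0; move: (n%:R : R)%R => w w0 ? ?.
by field; rewrite !gt_eqF.
Qed.

Lemma JNQ_criterion alpha : JNQ_norm p q alpha f < +oo <->
  exists M : R, forall l s, (0 < l)%R -> uniq s -> cube_collection l [set` s] ->
    \sum_(Q <- s) (l `^ (p * (alpha - alpha0)))%:E * energy alpha Q `^ (p / q) <= M%:E.
Proof.
rewrite /JNQ_norm sup_over_cubes_lty//; last by move=> Q; exact: poweR_ge0.
have termE l (s : seq (set 'rV[R]_n)) : (0 < l)%R -> cube_collection l [set` s] ->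
    \sum_(Q <- s) vol Q * (vol Q `^ (q * alpha / n%:R - 1) * gagliardo alpha q f Q) `^ (p / q) =
    \sum_(Q <- s) (l `^ (p * (alpha - alpha0)))%:E * energy alpha Q `^ (p / q).
  by move=> l0 cs; apply: eq_big_seq => Q Qs; exact: JNQ_term (cs.1 _ Qs).
by split=> -[M HM]; exists M => l s l0 us cs; move: (HM l s l0 us cs); rewrite (termE l s l0 cs).
Qed.

(** Apply the criterion to a family of one cube. *)
Lemma JNQ_energy_bound alpha : JNQ_norm p q alpha f < +oo ->
  exists M : R, forall l Q, (0 < l)%R -> cube l Q ->
    energy alpha Q <= (M * l `^ (q * (alpha0 - alpha)))%:E.
Proof.
move=> /JNQ_criterion[M HM]; exists (M `^ (q / p))%R => l Q l0 cQ.
have := HM l [:: Q] l0 isT (cube_collection1 cQ); rewrite big_seq1 => le.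
have lp : (0 < l `^ (p * (alpha - alpha0)))%R by rewrite powR_gt0.
have e0 : 0 <= (l `^ (p * (alpha - alpha0)))%:E * energy alpha Q `^ (p / q).
  by rewrite mule_ge0 ?poweR_ge0// lee_fin ltW.
have M0 : (0 <= M)%R by have := le_trans e0 le; rewrite lee_fin.
have h := @le_poweR R _ _ (q / p) (ltW (divr_gt0 q0 p0)) e0 le.
move: h; rewrite poweRM ?poweR_ge0 ?energy_ge0 ?lee_fin ?(ltW lp)// -poweRrM.
have -> : (p / q * (q / p) = 1)%R by field; rewrite !gt_eqF.
rewrite poweRe1 ?energy_ge0// !poweR_EFin -powRrM => h.
rewrite (mulrC (M `^ _)%R) EFinM -(@lee_pmul2l _ (l `^ (p * (alpha - alpha0) * (q / p)))%:E) ?lte_fin ?powR_gt0//.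
apply: (le_trans h); rewrite muleA -EFinM -powRD; last by rewrite (gt_eqF l0) implybT.
rewrite (_ : p * (alpha - alpha0) * (q / p) + q * (alpha0 - alpha) = 0)%R; last first.
  by field; rewrite gt_eqF.
by rewrite powRr0 mul1r.
Qed.

Lemma ae_constant_of_ccubes :
  (forall k : nat, iint (oscE q F) (ccube k.+1%:R) (ccube k.+1%:R) = 0) -> ae_constant R n f.
Proof.
move=> H; have [c [N' [N'0 Fc]]] := ae_constant_of_osc_eq0 mF H.
exists c; apply: (borel_null_ae (borel_nullU N0 N'0)) => x /not_orP[Nx N'x].
by rewrite fF// Fc.
Qed.

(** By osc_le_diffq and the energy bound, the oscillation on a cube of edge l is
    O(l^(n + q alpha0)), and alpha0 < 0 allows osc_eq0_of_large_cubes. *)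
Lemma osc_eq0_of_subcritical alpha r : JNQ_norm p q alpha f < +oo -> (alpha0 < 0)%R ->
  (0 < r)%R -> iint (oscE q F) (ccube r) (ccube r) = 0.
Proof.
move=> /JNQ_energy_bound[M HM] a0 r0.
apply: (@osc_eq0_of_large_cubes _ _ q F q1 mF
  (osc_const n q (n%:R + alpha * q) * M)%R (q * alpha0)%R) => //.
  by rewrite pmulr_rlt0.
move=> l Q l0 cQ; apply: (le_trans (osc_le_diffq q1 mF n_ge1 (n%:R + alpha * q) l0 cQ)).
have h := HM l Q l0 cQ.
apply: (@le_trans _ _ ((osc_const n q (n%:R + alpha * q) * l `^ (n%:R + alpha * q))%:E *
   (M * l `^ (q * (alpha0 - alpha)))%:E)).
  by apply: lee_wpmul2l => //; rewrite lee_fin mulr_ge0 ?powR_ge0 ?osc_const_ge0.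
rewrite -EFinM lee_fin.
have -> : (n%:R + q * alpha0 = n%:R + alpha * q + q * (alpha0 - alpha))%R by ring.
rewrite [in X in (_ <= X)%R]powRD; last by rewrite (gt_eqF l0) implybT.
by rewrite le_eqVlt; apply/orP; left; apply/eqP; ring.
Qed.

(** The energy of a fixed cube is at most that of any larger one, which tends to 0 like the
    edge to the power q (alpha0 - alpha). *)
Lemma osc_eq0_of_supercritical alpha r : JNQ_norm p q alpha f < +oo -> (alpha0 < alpha)%R ->
  (0 < r)%R -> iint (oscE q F) (ccube r) (ccube r) = 0.
Proof.
move=> /JNQ_energy_bound[M HM] a0 r0.
have cK := cube_ccube n r; have mK := measurable_cube cK.
have e0 : energy alpha (ccube r) = 0.
  apply: (@eq0_of_decay R _ M (q * (alpha0 - alpha)) (2 * r)) => //.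
  - exact: energy_ge0.
  - by rewrite mulr_gt0.
  - by rewrite pmulr_rlt0// subr_lt0.
  move=> l rl; have cl := cube_ccube n (l / 2).
  rewrite (_ : 2 * (l / 2) = l)%R in cl; last by field.
  have l0 : (0 < l)%R by rewrite (lt_le_trans _ rl)// mulr_gt0.
  apply: le_trans (HM l _ l0 cl); apply: iint_subset => //; try exact: measurable_cube cl.
  - by apply: subset_ccube; lra.
  - by apply: subset_ccube; lra.
apply/eqP; rewrite eq_le (iint_ge0 _ _ ko) andbT.
have := osc_le_diffq q1 mF n_ge1 (n%:R + alpha * q) (mulr_gt0 (ltr0n _ 2) r0) cK.
by rewrite e0 mule0.
Qed.

(** The energy bound has exponent 0 here: energies of order n are uniformly bounded. *)
Lemma osc_eq0_of_critical r : JNQ_norm p q 0 f < +oo -> alpha0 = 0%R ->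
  (0 < r)%R -> iint (oscE q F) (ccube r) (ccube r) = 0.
Proof.
move=> /JNQ_energy_bound[M HM] a0 r0.
apply: (osc_eq0_of_bounded_diffq q1 mF n_ge1 (M := M) r0) => l Q l0 cQ.
have := HM l Q l0 cQ.
by rewrite mul0r addr0 a0 subrr mulr0 powRr0 mulr1.
Qed.

(** On a fixed cube, finite energy of order n + alpha q gives finite energy of order n + q. *)
Lemma osc_eq0_of_alpha_ge1 alpha r : JNQ_norm p q alpha f < +oo -> (1 <= alpha)%R ->
  (0 < r)%R -> iint (oscE q F) (ccube r) (ccube r) = 0.
Proof.
move=> /JNQ_energy_bound[M HM] a1 r0.
have cK := cube_ccube n r; have mK := measurable_cube cK.
have r20 : (0 < 2 * r)%R by rewrite mulr_gt0.
apply: (osc_eq0_of_diffq_finite q1 mF n_ge1 r20 cK).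
have ts : (n%:R + q <= n%:R + alpha * q)%R by rewrite lerD2l ler_peMl// ltW.
apply: (le_lt_trans (diffq_mono q1 mF n_ge1 r20 cK ts)).
apply: (@le_lt_trans _ _ ((((Num.sqrt n%:R * (2 * r)) `^ (n%:R + alpha * q - (n%:R + q)))%:E *
   (M * (2 * r) `^ (q * (alpha0 - alpha)))%:E))); last by rewrite -EFinM ltry.
by apply: lee_wpmul2l; [rewrite lee_fin powR_ge0|exact: HM].
Qed.

(** A bound between energies with the right power of l becomes one between the weighted terms
    of the norms; beta is the weight exponent on the left. *)
Lemma compare_terms (X Y : \bar R) (c l delta beta : R) : (0 <= c)%R -> (0 < l)%R ->
  0 <= X -> 0 <= Y -> X <= (c * l `^ (q * delta))%:E * Y ->
  (l `^ (p * beta))%:E * X `^ (p / q) <=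
  (c `^ (p / q))%:E * ((l `^ (p * (beta + delta)))%:E * Y `^ (p / q)).
Proof.
move=> c0 l0 X0 Y0 XY; have cl0 : (0 <= c * l `^ (q * delta))%R by rewrite mulr_ge0 ?powR_ge0.
have h := le_poweR (ltW pq0) X0 XY.
apply: (@le_trans _ _ ((l `^ (p * beta))%:E * ((c * l `^ (q * delta))%:E * Y) `^ (p / q))).
  by apply: lee_wpmul2l => //; rewrite lee_fin powR_ge0.
rewrite poweRM ?lee_fin// poweR_EFin powRM ?powR_ge0// -powRrM EFinM !muleA -!EFinM.
apply: lee_wpmul2r; first exact: poweR_ge0.
rewrite lee_fin (_ : q * delta * (p / q) = p * delta)%R; last by field; rewrite gt_eqF.
rewrite mulrDr powRD; last by rewrite (gt_eqF l0) implybT.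
by rewrite le_eqVlt; apply/orP; left; apply/eqP; ring.
Qed.

Definition bounded_sums (a : R -> set 'rV[R]_n -> \bar R) : Prop :=
  exists M : R, forall l s, (0 < l)%R -> uniq s -> cube_collection l [set` s] ->
    \sum_(Q <- s) a l Q <= M%:E.

Lemma bounded_sums_le a b (c : R) : (0 <= c)%R -> (forall l Q, 0 <= b l Q) ->
  (forall l Q, (0 < l)%R -> cube l Q -> a l Q <= c%:E * b l Q) ->
  bounded_sums b -> bounded_sums a.
Proof.
move=> c0 b0 ab [M HM]; exists (c * M)%R => l s l0 us cs.
rewrite EFinM; apply: (@le_trans _ _ (c%:E * \sum_(Q <- s) b l Q)).
  rewrite ge0_sume_distrr// big_seq [leRHS]big_seq; apply: lee_sum => Q Qs.
  by apply: ab => //; exact: cs.1.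
by apply: lee_wpmul2l; [rewrite lee_fin|exact: HM].
Qed.

Lemma JNQ_norm_const alpha c : (forall x, F x = c) -> JNQ_norm p q alpha f < +oo.
Proof.
move=> Fc; apply/JNQ_criterion; exists 0%R => l s l0 us cs.
rewrite big1// => Q _; rewrite [X in _ * X `^ _](_ : _ = 0).
  by rewrite poweR_EFin powR0 ?gt_eqF// mule0.
rewrite /iint integral0_eq// => x _; apply: integral0_eq => y _.
by rewrite /diffq /osc !Fc subrr normr0 powR0 ?gt_eqF// mul0r.
Qed.

Lemma L1loc_cubes : L1loc f <-> ae_finite_measurable f /\
  forall l Q, (0 < l)%R -> cube l Q -> \int[lam]_(x in Q) `|F x|%:E < +oo.
Proof.
have ccE r : \int[vol]_(x in ccube r) `|f x| = \int[lam]_(x in ccube r) `|F x|%:E.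
  apply: (integral_vol _ N0) => [||x _ Nx]; first exact: measurable_cube (cube_ccube n r).
    by apply: measurable_funTS; apply/measurable_EFinP; exact: measurableT_comp.
  by rewrite fF.
split=> -[ff H]; (split; first exact: ff); [move=> l Q l0 cQ|move=> K cK].
  have [r r0 Qr] := cube_sub_ccube cQ.
  apply: (@le_lt_trans _ _ (\int[lam]_(x in ccube r) `|F x|%:E)).
    by apply: ge0_integral_mono => // x; rewrite lee_fin.
  by rewrite -ccE; apply: H; exact: compact_ccube.
have [r r0 Kr] := compact_sub_ccube cK.
apply: (@le_lt_trans _ _ (\int[vol]_(x in ccube r) `|f x|)).
  by apply: ge0_integral_mono.
by rewrite ccE; apply: H (cube_ccube n r); rewrite mulr_gt0.
Qed.

Definition mean l Q : R := (fine (\int[lam]_(x in Q) (F x)%:E) / l ^+ n)%R.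
Local Notation spread l Q := (\int[lam]_(x in Q) (`|F x - mean l Q| `^ q)%:E).

Lemma JNcon_term l Q : (0 < l)%R -> cube l Q -> \int[lam]_(x in Q) `|F x|%:E < +oo ->
  vol Q * ((\int[vol]_(x in Q) (`|f x - average f Q| `^ q)) / vol Q) `^ (p / q) =
  (l `^ (p * (- alpha0)))%:E * spread l Q `^ (p / q).
Proof.
move=> l0 cQ Foo; have mQ := measurable_cube cQ.
have ln0 : (0 < l ^+ n)%R by rewrite exprn_gt0.
have iF : lam.-integrable (Q : set B) (EFin \o F).
  by apply/integrableP; split; [apply/measurable_EFinP; exact: measurable_funTS|].
have avE : average f Q = (mean l Q)%:E.
  rewrite /average (vol_cube l0 cQ) inver (gt_eqF ln0) /mean EFinM fineK; last exact: integrable_fin_num iF.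
  congr (_ * _); apply: (integral_vol mQ N0) => [|x _ Nx]; last exact: fF.
  by apply: measurable_funTS; exact/measurable_EFinP.
have -> : \int[vol]_(x in Q) (`|f x - average f Q| `^ q) = spread l Q.
  apply: (integral_vol mQ N0) => [|x _ Nx]; last by rewrite avE fF.
  apply: measurable_funTS; apply/measurable_EFinP; apply: measurable_powR_comp.
  by apply: measurableT_comp => //; apply: measurable_funB.
rewrite (vol_cube l0 cQ) inver (gt_eqF ln0) poweRM; last 2 first.
- by apply: integral_ge0 => x _; rewrite lee_fin powR_ge0.
- by rewrite lee_fin invr_ge0 ltW.
rewrite [X in _ * X]muleC muleA poweR_EFin -EFinM; congr (_%:E * _).
rewrite -(powR_inv1 (ltW ln0)) -powR_mulrn ?(ltW l0)// -!powRrM -powRD; last by rewrite (gt_eqF l0) implybT.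
by congr powR; rewrite /alpha0; field; rewrite !gt_eqF.
Qed.

Lemma JNcon_criterion : (forall l Q, (0 < l)%R -> cube l Q -> \int[lam]_(x in Q) `|F x|%:E < +oo) ->
  JNcon_norm p q f < +oo <->
  bounded_sums (fun l Q => (l `^ (p * (- alpha0)))%:E * spread l Q `^ (p / q)).
Proof.
move=> Foo; rewrite /JNcon_norm sup_over_cubes_lty//; last by move=> Q; exact: poweR_ge0.
have termE l (s : seq (set 'rV[R]_n)) : (0 < l)%R -> cube_collection l [set` s] ->
    \sum_(Q <- s) vol Q * ((\int[vol]_(x in Q) (`|f x - average f Q| `^ q)) / vol Q) `^ (p / q) =
    \sum_(Q <- s) (l `^ (p * (- alpha0)))%:E * spread l Q `^ (p / q).
  move=> l0 cs; apply: eq_big_seq => Q Qs.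
  by apply: JNcon_term; [exact: l0|exact: cs.1|apply: Foo l0 _; exact: cs.1].
by split=> -[M HM]; exists M => l s l0 us cs; move: (HM l s l0 us cs); rewrite (termE l s l0 cs).
Qed.

Lemma spread_ge0 l Q : 0 <= spread l Q.
Proof. by apply: integral_ge0 => x _; rewrite lee_fin powR_ge0. Qed.

(** The energy of order n + alpha q, alpha < 0, and the deviation from the mean bound each other
    up to constants and powers of l, by diffq_le_average in one direction and by osc_ge_average
    with osc_le_diffq in the other. *)
Lemma JNQ_eq_JNcon alpha : (alpha < 0)%R -> JNQ n p q alpha f <-> JNcon n p q f.
Proof.
move=> a0; split.
- move=> [ff fJ]; have [M HM] := JNQ_energy_bound fJ.
  have Foo l Q : (0 < l)%R -> cube l Q -> \int[lam]_(x in Q) `|F x|%:E < +oo.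
    move=> l0 cQ; apply: (L1_of_osc_finite q1 mF l0 cQ).
    apply: (le_lt_trans (osc_le_diffq q1 mF n_ge1 (n%:R + alpha * q) l0 cQ)).
    apply: (@le_lt_trans _ _ ((osc_const n q (n%:R + alpha * q) * l `^ (n%:R + alpha * q))%:E *
      (M * l `^ (q * (alpha0 - alpha)))%:E)); last by rewrite -EFinM ltry.
    apply: lee_wpmul2l; last exact: HM.
    by rewrite lee_fin mulr_ge0 ?powR_ge0 ?osc_const_ge0.
  split; first exact/L1loc_cubes.
  apply/(JNcon_criterion Foo); have /JNQ_criterion := fJ.
  pose c := (2 `^ q * osc_const n q (n%:R + alpha * q))%R.
  have c0 : (0 <= c)%R by rewrite mulr_ge0 ?powR_ge0 ?osc_const_ge0.
  apply: (@bounded_sums_le _ _ (c `^ (p / q))); first exact: powR_ge0.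
    by move=> l Q; rewrite mule_ge0 ?poweR_ge0// lee_fin powR_ge0.
  move=> l Q l0 cQ.
  rewrite (_ : alpha - alpha0 = - alpha0 + alpha)%R; last by ring.
  apply: compare_terms => //; [exact: spread_ge0|exact: energy_ge0|].
  apply: (le_trans (osc_ge_average q1 mF l0 cQ (Foo l Q l0 cQ))).
  have := osc_le_diffq q1 mF n_ge1 (n%:R + alpha * q) l0 cQ.
  move=> /(lee_wpmul2l _) => /(_ (2 `^ q / l ^+ n)%:E) H; apply: (le_trans (H _)).
    by rewrite lee_fin divr_ge0 ?powR_ge0 ?exprn_ge0// ltW.
  rewrite muleA -EFinM lee_wpmul2r ?energy_ge0// lee_fin powRD; last by rewrite (gt_eqF l0) implybT.
  rewrite powR_mulrn ?(ltW l0)// /c (mulrC q) le_eqVlt; apply/orP; left; apply/eqP.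
  by field; rewrite expf_neq0 // gt_eqF.
- move=> [/L1loc_cubes[ff Foo] /(JNcon_criterion Foo) fJ]; split => //.
  have b0 : (0 < - (q * alpha))%R by rewrite oppr_gt0 pmulr_rlt0.
  have [C C0 HC] := diffq_le_average q1 mF n_ge1 b0.
  apply/JNQ_criterion; move: fJ; apply: (@bounded_sums_le _ _ (C `^ (p / q))); first exact: powR_ge0.
    by move=> l Q; rewrite mule_ge0 ?poweR_ge0// lee_fin powR_ge0.
  move=> l Q l0 cQ.
  have := @compare_terms (energy alpha Q) (spread l Q) C l (- alpha) (alpha - alpha0) (ltW C0) l0
    (energy_ge0 _ _) (spread_ge0 _ _).
  rewrite (_ : alpha - alpha0 + - alpha = - alpha0)%R; last by ring.
  apply; have := HC (mean l Q) l Q l0 cQ; rewrite opprK mulrN.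
  by rewrite (mulrC alpha).
Qed.

Lemma energy_sum alpha l s : (0 < l)%R -> uniq s -> cube_collection l [set` s] ->
  \sum_(Q <- s) energy alpha Q <= gagliardo alpha q f setT.
Proof.
move=> l0 us cs; rewrite gagliardo_iint//; set k := diffq _ _ _.
apply: (@le_trans _ _ (\sum_(Q <- s) \int[lam]_(x in Q) \int[lam]_y k x y)).
  rewrite big_seq [leRHS]big_seq; apply: lee_sum => Q Qs.
  have mQ := measurable_cube (cs.1 _ Qs).
  exact: (@iint_subset _ _ k Q Q Q setT (kd _) mQ mQ mQ measurableT (@subset_refl _ _) (@subsetT _ _)).
apply: sum_integral_cubes l0 us cs _ _; first exact: (measurable_inner (kd _) measurableT).
by move=> x; exact: (inner_ge0 _ _ (kd _)).
Qed.

(** Since alpha <= alpha0, the energy may be replaced by that of order n + alpha0 q, which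
    turns the weight l^(p (alpha - alpha0)) into 1. As p / q >= 1, the sum of powers is at most
    the power of the sum, and the energies of the cubes add up to at most that of the space. *)
Lemma Ws_sub_JNQ alpha : (0 < alpha0)%R -> (alpha <= alpha0)%R ->
  Ws n alpha0 q f -> JNQ n p q alpha f.
Proof.
move=> a0 aa0 [ff Wf]; split => //; apply/JNQ_criterion.
have pq1 : (1 <= p / q)%R.
  rewrite ler_pdivlMr// mul1r -lef_pV2 ?posrE//.
  by rewrite -subr_ge0 -(pmulr_rge0 _ n0) ltW.
have Goo : gagliardo alpha0 q f setT < +oo.
  by apply: poweR_lty_inv Wf; rewrite invr_gt0.
have G0 : 0 <= gagliardo alpha0 q f setT by rewrite gagliardo_iint//; exact: energy_ge0.
pose c := (Num.sqrt n%:R `^ (q * (alpha0 - alpha)) : R)%R.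
apply: (@bounded_sums_le _ (fun l Q => (l `^ (p * (alpha - alpha0 + (alpha0 - alpha))))%:E *
  energy alpha0 Q `^ (p / q)) (c `^ (p / q))); first exact: powR_ge0.
- by move=> l Q; rewrite mule_ge0 ?poweR_ge0// lee_fin powR_ge0.
- move=> l Q l0 cQ; apply: compare_terms => //; [exact: powR_ge0|exact: energy_ge0|exact: energy_ge0|].
  have ts : (n%:R + alpha * q <= n%:R + alpha0 * q)%R by rewrite lerD2l ler_wpM2r// ltW.
  have := diffq_mono q1 mF n_ge1 l0 cQ ts.
  rewrite powRM ?sqrtr_ge0 ?(ltW l0)//.
  by rewrite (_ : n%:R + alpha0 * q - (n%:R + alpha * q) = q * (alpha0 - alpha))%R; last by ring.
- exists (fine (gagliardo alpha0 q f setT `^ (p / q))) => l s l0 us cs.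
  rewrite fineK; last by rewrite ge0_fin_numE ?poweR_ge0// lty_poweR.
  rewrite (_ : alpha - alpha0 + (alpha0 - alpha) = 0)%R; last by ring.
  under eq_bigr do rewrite mulr0 powRr0 mul1e.
  apply: (le_trans (sum_poweR_le _ pq1 (fun Q => energy_ge0 alpha0 Q))).
  apply: le_poweR; [exact: ltW|by apply: sume_ge0 => Q _; exact: energy_ge0|].
  exact: (energy_sum alpha0 l0 us cs).
Qed.

Section sobolev.
Variable g : 'rV[R]_n -> 'rV[R]_n.
Hypotheses (L1f : L1loc f) (wg : weak_gradient f g).

Lemma borel_gradient : exists (G : 'rV[R]_n -> 'rV[R]_n) (N' : set 'rV[R]_n),
  [/\ borel_null N', forall x, ~ N' x -> g x = G x,
    forall i, integrable_on_cubes (fun x => G x ord0 i) &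
    forall i, weak_partial i F (fun x => G x ord0 i)].
Proof.
have ex i : exists Z : ('rV[R]_n -> R) * set 'rV[R]_n,
    [/\ measurable_fun setT (Z.1 : B -> R), borel_null Z.2 &
        forall x, ~ Z.2 x -> (g x ord0 i)%:E = (Z.1 x)%:E].
  have [[ffi _] _] := wg i.
  by have [H [A [mH A0 gH]]] := borel_representative ffi; exists (H, A).
have [Z HZ] := choice ex.
have mZ i : measurable_fun setT ((Z i).1 : B -> R) by have [] := HZ i.
have Z0 i : borel_null (Z i).2 by have [] := HZ i.
have gZ i x : ~ (Z i).2 x -> (g x ord0 i)%:E = ((Z i).1 x)%:E by have [_ _] := HZ i; exact.
pose G x := (\row_i (Z i).1 x)%R : 'rV[R]_n.
have GE i : (fun x => G x ord0 i) = (Z i).1 by apply/funext => x; rewrite mxE.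
exists G, (\big[setU/set0]_(i < n) (Z i).2); split.
- exact: borel_null_bigsetU.
- move=> x Nx; apply/rowP => i; rewrite mxE.
  have : ~ (Z i).2 x by move=> Zx; apply: Nx; rewrite (bigD1 i)//=; left.
  by move/gZ => -[].
- move=> i; rewrite GE.
  exact: (integrable_on_cubes_of_L1loc (mZ i) (Z0 i) (gZ i) (wg i).1).
- move=> i; rewrite GE => phi tphi mphi mdphi.
  rewrite -(integral_vol (f := fun x => f x * (partial i phi x)%:E) measurableT N0); last 2 first.
  + by apply/measurable_EFinP; exact: measurable_funM.
  + by move=> x _ Nx; rewrite fF// EFinM.
  rewrite (wg i).2//; congr (- _); apply: (integral_vol measurableT (Z0 i)).
    by apply/measurable_EFinP; exact: measurable_funM.
  by move=> x _ /gZ[->].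
Qed.

(** By diffq_le_gradient the energy is bounded by the q-th power integral of the gradient on Q,
    and by weak_hoelder with exponent gam / q >= 1 by its gam-th power integral. After raising
    to the power p / q the exponent of l is 0 and that of the last integral is
    p / gam = 1 + p / n >= 1, so superadditivity sums over the cubes. *)
Lemma dotW1_sub_JNQ alpha : (1 <= alpha0)%R -> (alpha < 1)%R ->
  \int[vol]_x (E (g x) `^ (p^-1 + n%:R^-1)^-1)%:E < +oo -> JNQ_norm p q alpha f < +oo.
Proof.
move=> a01 a1; set gam := (p^-1 + n%:R^-1)^-1%R => goo.
have [G [N' [N'0 gG iG wG]]] := borel_gradient.
have iF := integrable_on_cubes_of_L1loc mF N0 fF L1f.
have mE := measurable_euclid_grad iG.
have gi0 : (0 < p^-1 + n%:R^-1 :> R)%R by rewrite addr_gt0 ?invr_gt0.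
have gam0 : (0 < gam)%R by rewrite invr_gt0.
(* That gam >= q is the assumption alpha0 >= 1 rewritten. *)
have gq1 : (1 <= gam / q)%R.
  rewrite ler_pdivlMr// mul1r -lef_pV2 ?posrE// invrK.
  rewrite -(ler_pM2l n0) mulrDr mulfV ?gt_eqF//.
  by move: a01; rewrite /alpha0 mulrBr; lra.
have pgE : (p / gam = 1 + p / n%:R)%R by rewrite /gam invrK mulrDr mulfV ?gt_eqF.
have pg1 : (1 <= p / gam)%R by rewrite pgE lerDl mulr_ge0 ?invr_ge0 ?ltW.
have gpE : (gam / q * (p / gam) = p / q)%R by field; rewrite !gt_eqF.
have pg0 : (0 < p / gam)%R by rewrite divr_gt0.
have [C C0 HC] := diffq_le_gradient q1 iF iG wG n_ge1 a1.
pose Y Q := \int[lam]_(x in Q) (E (G x) `^ q)%:E.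
pose Z Q := \int[lam]_(x in Q) (E (G x) `^ gam)%:E.
have Y0 Q : 0 <= Y Q by apply: integral_ge0 => x _; rewrite lee_fin powR_ge0.
have Z0 Q : 0 <= Z Q by apply: integral_ge0 => x _; rewrite lee_fin powR_ge0.
have mEg : measurable_fun setT (fun x : B => (E (G x) `^ gam)%:E).
  by apply/measurable_EFinP; exact: measurable_powR_comp.
have Zoo : Z setT < +oo.
  rewrite /Z -(integral_vol (f := fun x => (E (g x) `^ gam)%:E) measurableT N'0)//.
  by move=> x _ /gG ->.
apply/JNQ_criterion.
apply: (@bounded_sums_le _ (fun l Q => (l `^ (p * (alpha - alpha0 + (1 - alpha))))%:E * Y Q `^ (p / q))
   (C `^ (p / q))); first exact: powR_ge0.
- by move=> l Q; rewrite mule_ge0 ?poweR_ge0// lee_fin powR_ge0.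
- move=> l Q l0 cQ; have cmp := @compare_terms (energy alpha Q) (Y Q) C l (1 - alpha) (alpha - alpha0).
  apply: cmp => //; [exact: ltW|exact: energy_ge0|exact: HC].
apply: (@bounded_sums_le _ (fun l Q => Z Q `^ (p / gam)) (2 `^ (p / q))); first exact: powR_ge0.
- by move=> l Q; exact: poweR_ge0.
- move=> l Q l0 cQ; have mQ := measurable_cube cQ.
  have ln0 : (0 < l ^+ n)%R by rewrite exprn_gt0.
  have := @weak_hoelder _ _ R lam Q _ (gam / q) (fun x => E (G x) `^ q)%R mQ (lebesgue_cube l0 cQ) ln0 gq1
    (measurable_funTS (measurable_powR_comp q mE)) (fun x _ => powR_ge0 _ _).
  have -> : \int[lam]_(x in Q) ((E (G x) `^ q) `^ (gam / q))%:E = Z Q.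
    apply: eq_integral => x _; rewrite -powRrM; congr (_ `^ _)%:E.
    by field; rewrite gt_eqF.
  rewrite -/(Y Q) => h.
  have := le_poweR (ltW pg0) (poweR_ge0 _ _) h.
  rewrite -poweRrM gpE.
  rewrite poweRM ?lee_fin ?mulr_ge0 ?powR_ge0// poweR_EFin => {}h.
  rewrite (_ : alpha - alpha0 + (1 - alpha) = 1 - alpha0)%R; last by ring.
  have := lee_wpmul2l _ h => /(_ (l `^ (p * (1 - alpha0)))%:E) H; apply: (le_trans (H _)).
    by rewrite lee_fin powR_ge0.
  rewrite muleA -EFinM lee_wpmul2r ?poweR_ge0// lee_fin.
  rewrite powRM ?powR_ge0// -!powRrM gpE.
  rewrite -powR_mulrn ?(ltW l0)// -powRrM mulrCA -powRD; last by rewrite (gt_eqF l0) implybT.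
  rewrite (_ : p * (1 - alpha0) + n%:R * ((gam / q - 1) * (p / gam)) = 0)%R.
    by rewrite powRr0 mulr1.
  rewrite mulrBl mul1r gpE pgE /alpha0; move: n0; move: (n%:R : R)%R => w w0.
  by field; rewrite !gt_eqF.
- exists (fine (Z setT `^ (p / gam))) => l s l0 us cs.
  rewrite fineK; last by rewrite ge0_fin_numE ?poweR_ge0// lty_poweR.
  apply: (le_trans (sum_poweR_le _ pg1 Z0)).
  apply: le_poweR; [exact: ltW|exact: sume_ge0|].
  by apply: sum_integral_cubes l0 us cs mEg _ => x; rewrite lee_fin powR_ge0.
Qed.

End sobolev.

End representative.

(** * The four ranges of alpha0 *)

Section space_identities.
Context (R : realType) (n : nat) (p q : R).
Local Notation B := (borel_rV R n).
Hypotheses (n_ge1 : (1 <= n)%N) (p1 : 1 <= p) (q1 : 1 <= q).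

Lemma ae_constant_sub_JNQ alpha : ae_constant R n `<=` JNQ n p q alpha.
Proof.
move=> f [c fc]; have [N N0 fN] := negligible_borel_null fc.
have fF x : ~ N x -> f x = (cst c x)%:E.
  by move=> Nx; apply: contrapT => fx; apply: Nx; apply: fN.
split; last exact: (JNQ_norm_const n_ge1 p1 q1 (measurable_cst c) N0 fF alpha (c := c)).
split; last by apply: borel_null_ae N0 _ => x /fF ->.
have ae : ae_eq (lebesgue_rV R n) setT (cst c%:E : lebesgue_rV_type R n -> \bar R) f.
  by move: fc; apply: filterS => x -> _.
apply: ae_measurable_fun ae (measurable_cst _).
exact: measure_is_complete_caratheodory.
Qed.

Lemma JNQ_eq_ae_constant alpha :
  (forall f F N, measurable_fun setT (F : B -> R) -> borel_null N ->
     (forall x, ~ N x -> f x = (F x)%:E) -> (JNQ_norm p q alpha f < +oo)%E ->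
     forall r, 0 < r -> iint (oscE q F) (ccube r) (ccube r) = 0%E) ->
  JNQ n p q alpha = ae_constant R n.
Proof.
move=> H; apply/seteqP; split; last exact: ae_constant_sub_JNQ.
move=> f [ff fJ]; have [F [N [mF N0 fF]]] := borel_representative ff.
exact: (ae_constant_of_ccubes mF N0 fF (fun k => H f F N mF N0 fF fJ _ (ltr0Sn _ k))).
Qed.

Lemma JNQ_JNcon alpha : alpha < 0 -> JNQ n p q alpha = JNcon n p q.
Proof.
move=> a0; have K f : ae_finite_measurable f -> JNQ n p q alpha f <-> JNcon n p q f.
  by move=> /borel_representative[F [N [mF N0 fF]]]; exact: (JNQ_eq_JNcon n_ge1 p1 q1 mF N0 fF).
apply/seteqP; split => f fJ.
  by apply/K => //; exact: fJ.1.
by apply/K => //; exact: fJ.1.1.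
Qed.

End space_identities.

Theorem theorem2p17 (R : realType) (n : nat) (p q alpha alpha0 : R)
    (n_ge1 : (1 <= n)%N) (p_ge1 : 1 <= p) (q_ge1 : 1 <= q)
    (alpha0E : alpha0 = n%:R * (q^-1 - p^-1)) :
  [/\ (alpha0 < 0 -> JNQ n p q alpha = ae_constant R n),
      (alpha0 = 0 ->
        (alpha < 0 -> JNQ n p q alpha = JNcon n p p) /\
        (0 <= alpha -> JNQ n p q alpha = ae_constant R n)),
      (0 < alpha0 < 1 ->
        [/\ (alpha < 0 -> JNQ n p q alpha = JNcon n p q),
            (0 <= alpha <= alpha0 -> Ws n alpha0 q `<=` JNQ n p q alpha) &
            (alpha0 < alpha -> JNQ n p q alpha = ae_constant R n)]) &
      (1 <= alpha0 ->
        [/\ (alpha < 0 -> JNQ n p q alpha = JNcon n p q),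
            (0 <= alpha < 1 ->
               dotW1 n (p^-1 + n%:R^-1)^-1 `<=` JNQ n p q alpha) &
            (1 <= alpha -> JNQ n p q alpha = ae_constant R n)])].
Proof.
have gapE : smoothness_gap n p q = alpha0 by rewrite alpha0E.
have super : alpha0 < alpha -> JNQ n p q alpha = ae_constant R n.
  move=> a0; apply: JNQ_eq_ae_constant => // f F N mF N0 fF fJ r r0.
  by apply: (osc_eq0_of_supercritical n_ge1 p_ge1 q_ge1 mF N0 fF fJ) => //; rewrite gapE.
split.
- move=> a0; apply: JNQ_eq_ae_constant => // f F N mF N0 fF fJ r r0.
  by apply: (osc_eq0_of_subcritical n_ge1 p_ge1 q_ge1 mF N0 fF fJ) => //; rewrite gapE.
- move=> a0; split => [alt|]; rewrite ?a0.
    have -> : q = p.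
      apply/invr_inj/eqP; rewrite -subr_eq0; move: a0; rewrite alpha0E => /eqP.
      by rewrite mulf_eq0 pnatr_eq0 => /orP[/eqP n0|//]; move: n_ge1; rewrite n0.
    exact: JNQ_JNcon.
  rewrite le_eqVlt => /predU1P[a00|alt]; last by apply: super; rewrite a0.
  apply: JNQ_eq_ae_constant => // f F N mF N0 fF fJ r r0.
  rewrite -a00 in fJ.
  by apply: (osc_eq0_of_critical n_ge1 p_ge1 q_ge1 mF N0 fF fJ) => //; rewrite gapE.
- move=> /andP[a00 a01]; split; [exact: JNQ_JNcon| |exact: super].
  move=> /andP[_ aa0] f fW; have [F [N [mF N0 fF]]] := borel_representative fW.1.
  rewrite -gapE in a00 aa0 fW.
  exact: (Ws_sub_JNQ n_ge1 p_ge1 q_ge1 mF N0 fF a00 aa0 fW).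
- move=> a01; split; first exact: JNQ_JNcon.
    move=> /andP[_ a1] f [L1f [g wg goo]].
    have [F [N [mF N0 fF]]] := borel_representative L1f.1.
    split; first exact: L1f.1.
    have g0 : 0 < (p^-1 + n%:R^-1)^-1 :> R.
      by rewrite invr_gt0 addr_gt0// invr_gt0 ?ltr0n// (lt_le_trans _ p_ge1).
    apply: (dotW1_sub_JNQ n_ge1 p_ge1 q_ge1 mF N0 fF L1f wg _ a1); first by rewrite gapE.
    by apply: poweR_lty_inv goo; rewrite invr_gt0.
  move=> a1; apply: JNQ_eq_ae_constant => // f F N mF N0 fF fJ r r0.
  exact: (osc_eq0_of_alpha_ge1 n_ge1 p_ge1 q_ge1 mF N0 fF fJ).
Qed.
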